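(* Let $(M,\varphi,g)$ be an almost Golden Riemannian manifold. The $G_{(\varphi,g)}$-structure defined by $(\varphi,g)$ over $M$ is integrable if and only if the torsion tensor and the curvature tensor of the well adapted connection of $(\varphi,g)$ both vanish.
   Context: Manifolds and tensor fields are of class $C^\infty$; $\mathfrak{X}(M)$ denotes the module of vector fields on $M$. An almost Golden structure on $M$ is a tensor field $\varphi$ of type $(1,1)$ with $\varphi^2=\varphi+Id$ (a polynomial structure of degree exactly 2, i.e. $\varphi$ and $Id$ are linearly independent). An almost Golden Riemannian manifold $(M,\varphi,g)$ is a manifold with an almost Golden structure $\varphi$ and a Riemannian metric $g$ such that $g(\varphi X,Y)=g(X,\varphi Y)$ for all $X,Y\in\mathfrak{X}(M)$. Let $\phi=\frac{1+\sqrt5}{2}$, $\bar\phi=\frac{1-\sqrt5}{2}$, $D_\phi=\ker(\varphi-\phi\, Id)$, $D_{\bar\phi}=\ker(\varphi-\bar\phi\, Id)$, so $TM=D_\phi\oplus D_{\bar\phi}$, with $r=\dim D_\phi$, $s=\dim D_{\bar\phi}$ constant on $M$. The $G_{(\varphi,g)}$-structure defined by $(\varphi,g)$ is the $O(r;\mathbb{R})\times O(s;\mathbb{R})$-reduction of the bundle of linear frames of $M$ consisting of the $g$-orthonormal frames $(X_1,\dots,X_r,Y_1,\dots,Y_s)$ of $T_p(M)$, $p\in M$, with $X_1,\dots,X_r\in(D_\phi)_p$ and $Y_1,\dots,Y_s\in(D_{\bar\phi})_p$. A $G$-structure is integrable if around each point of $M$ there is a coordinate chart whose coordinate frame is a local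 section of the $G$-structure. The well adapted connection of $(\varphi,g)$ is the linear connection whose covariant derivative is the unique $\nabla^{\mathrm w}$ such that $\nabla^{\mathrm w}\varphi=0$, $\nabla^{\mathrm w}g=0$ and whose torsion tensor $\mathrm{T}^{\mathrm w}$ satisfies $g(\mathrm{T}^{\mathrm w}(X,Y),Z)=g(\mathrm{T}^{\mathrm w}(Z,Y),X)$ for all $Y\in\mathfrak{X}(M)$ whenever $X,Z$ are both vector fields in $D_\phi$ or both vector fields in $D_{\bar\phi}$. *)

(* Defs.v *)
From HB Require Import structures.
From mathcomp Require Import all_boot all_order all_algebra.
From mathcomp Require Import all_classical all_reals all_analysis.

Set Implicit Arguments.
Unset Strict Implicit.
Unset Printing Implicit Defensive.

Import Order.TTheory GRing.Theory Num.Theory.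
Import numFieldNormedType.Exports.
Local Open Scope classical_set_scope.
Local Open Scope ring_scope.

(* Vectors are rows, so a matrix represents the linear map [v |-> v *m A] and,
   by [deriveEjacobian], ['D_v f x = v *m 'J f x]. *)

Fixpoint Ck {R : realType} {V W : normedModType R} (k : nat) (U : set V)
    (f : V -> W) : Prop :=
  match k with
  | 0%N => forall x, U x -> {for x, continuous f}
  | k'.+1 => (forall x, U x -> differentiable f x) /\
             forall v, Ck k' U (fun x => 'D_v f x)
  end.

(* Used for open [U] only. *)
Definition smooth_on {R : realType} {V W : normedModType R} (U : set V)
    (f : V -> W) : Prop := forall k, Ck k U f.

Record chart (R : realType) (n : nat) (T : topologicalType) := Chart {
  chart_fun :> T -> 'rV[R]_n ;
  chart_inv : 'rV[R]_n -> T ;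
  chart_dom : set T ;
  chart_dom_open : open chart_dom ;
  chart_img_open : open (chart_fun @` chart_dom) ;
  chart_funK : {in chart_dom, cancel chart_fun chart_inv} ;
  chart_fun_continuous : {within chart_dom, continuous chart_fun} ;
  chart_inv_continuous :
    {within chart_fun @` chart_dom, continuous chart_inv} }.

Definition chart_img {R : realType} {n : nat} {T : topologicalType}
  (c : chart R n T) : set 'rV[R]_n := c @` chart_dom c.

Definition compatible {R : realType} {n : nat} {T : topologicalType}
    (c d : chart R n T) : Prop :=
  smooth_on (c @` (chart_dom c `&` chart_dom d)) (d \o chart_inv c) /\
  smooth_on (d @` (chart_dom c `&` chart_dom d)) (c \o chart_inv d).

Record manifold (R : realType) (n : nat) := Manifold {
  carrier :> topologicalType ;
  manifold_hausdorff : hausdorff_space carrier ;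
  manifold_second_countable : second_countable (T := carrier) ;
  atlas : set (chart R n carrier) ;
  atlas_compatible : forall c d, atlas c -> atlas d -> compatible c d ;
  chart_at : carrier -> chart R n carrier ;
  chart_at_atlas : forall p, atlas (chart_at p) ;
  chart_at_dom : forall p, chart_dom (chart_at p) p }.

Section Manifold.
Context {R : realType} {n : nat} (M : manifold R n).

Definition smooth_chart (c : chart R n M) : Prop :=
  forall d, atlas d -> compatible c d.

(* The tangent space at [p] is R^n, a vector being identified with its
   components in the preferred chart [chart_at p]; [coords c p] and
   [coord_frame c p] are the changes of basis from and to the components in any
   other chart [c] around [p].  The rows of [coord_frame c p] are the coordinate
   vectors of [c] at [p]. *)
Definition coords (c : chart R n M) (p : M) : 'M[R]_n :=
  'J (c \o chart_inv (chart_at p)) (chart_at p p).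

Definition coord_frame (c : chart R n M) (p : M) : 'M[R]_n :=
  'J (chart_at p \o chart_inv c) (c p).

(* The local expression of a field in a chart, on [chart_img c]. *)
Definition smooth_local {W : normedModType R}
    (local : chart R n M -> M -> W) : Prop :=
  forall c, atlas c -> smooth_on (chart_img c) (local c \o chart_inv c).

Definition smooth_function (f : M -> R) : Prop :=
  smooth_local (fun _ p => f p : R^o).

Definition smooth_vector_field (X : M -> 'rV[R]_n) : Prop :=
  smooth_local (fun c p => X p *m coords c p).

(* Type (1,1). *)
Definition smooth_endomorphism (phi : M -> 'M[R]_n) : Prop :=
  smooth_local (fun c p => coord_frame c p *m phi p *m coords c p).

(* Type (0,2). *)
Definition smooth_form (g : M -> 'M[R]_n) : Prop :=
  smooth_local (fun c p => coord_frame c p *m g p *m (coord_frame c p)^T).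

Definition directional_derivative (X : M -> 'rV[R]_n) (f : M -> R) (p : M) : R :=
  'D_(X p) ((f : M -> R^o) \o chart_inv (chart_at p)) (chart_at p p).

Definition local_field (c : chart R n M) (X : M -> 'rV[R]_n) (x : 'rV[R]_n)
  : 'rV[R]_n := X (chart_inv c x) *m coords c (chart_inv c x).

(* [X, Y]^i = X^j d_j Y^i - Y^j d_j X^i, computed at [p] in [chart_at p]. *)
Definition lie_bracket (X Y : M -> 'rV[R]_n) (p : M) : 'rV[R]_n :=
  'D_(X p) (local_field (chart_at p) Y) (chart_at p p) -
  'D_(Y p) (local_field (chart_at p) X) (chart_at p p).

Definition inner (g : M -> 'M[R]_n) (X Y : M -> 'rV[R]_n) (p : M) : R :=
  (X p *m g p *m (Y p)^T) 0 0.

Definition riemannian_metric (g : M -> 'M[R]_n) : Prop :=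
  [/\ smooth_form g,
      forall p, (g p)^T = g p &
      forall p (v : 'rV[R]_n), v != 0 -> 0 < (v *m g p *m v^T) 0 0].

Definition apply_endo (phi : M -> 'M[R]_n) (X : M -> 'rV[R]_n) (p : M) : 'rV[R]_n :=
  X p *m phi p.

(* A covariant derivative is an operator on smooth vector fields; its values on
   non-smooth arguments are irrelevant. *)
Definition covariant_derivative
    (nabla : (M -> 'rV[R]_n) -> (M -> 'rV[R]_n) -> M -> 'rV[R]_n) : Prop :=
  [/\ forall X Y, smooth_vector_field X -> smooth_vector_field Y ->
        smooth_vector_field (nabla X Y),
      forall f X X' Y, smooth_function f -> smooth_vector_field X ->
        smooth_vector_field X' -> smooth_vector_field Y ->
        forall p, nabla (fun q => f q *: X q + X' q) Y p
                  = f p *: nabla X Y p + nabla X' Y p &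
      forall f X Y Y', smooth_function f -> smooth_vector_field X ->
        smooth_vector_field Y -> smooth_vector_field Y' ->
        forall p, nabla X (fun q => f q *: Y q + Y' q) p
                  = directional_derivative X f p *: Y p + f p *: nabla X Y p
                    + nabla X Y' p].

Section Connection.
Context (nabla : (M -> 'rV[R]_n) -> (M -> 'rV[R]_n) -> M -> 'rV[R]_n).

Definition torsion (X Y : M -> 'rV[R]_n) (p : M) : 'rV[R]_n :=
  nabla X Y p - nabla Y X p - lie_bracket X Y p.

Definition curvature (X Y Z : M -> 'rV[R]_n) (p : M) : 'rV[R]_n :=
  nabla X (nabla Y Z) p - nabla Y (nabla X Z) p - nabla (lie_bracket X Y) Z p.

Definition torsion_vanishes : Prop :=
  forall X Y, smooth_vector_field X -> smooth_vector_field Y ->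
  forall p, torsion X Y p = 0.

Definition curvature_vanishes : Prop :=
  forall X Y Z, smooth_vector_field X -> smooth_vector_field Y ->
  smooth_vector_field Z -> forall p, curvature X Y Z p = 0.

Definition parallel_endomorphism (phi : M -> 'M[R]_n) : Prop :=
  forall X Y, smooth_vector_field X -> smooth_vector_field Y ->
  forall p, nabla X (apply_endo phi Y) p - apply_endo phi (nabla X Y) p = 0.

Definition parallel_metric (g : M -> 'M[R]_n) : Prop :=
  forall X Y Z, smooth_vector_field X -> smooth_vector_field Y ->
  smooth_vector_field Z ->
  forall p, directional_derivative X (inner g Y Z) p
            - inner g (nabla X Y) Z p - inner g Y (nabla X Z) p = 0.

End Connection.

Definition integrable_frames (P : forall p : M, set 'M[R]_n) : Prop :=
  forall p, exists c : chart R n M,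
    [/\ smooth_chart c, chart_dom c p &
        forall q, chart_dom c q -> P q (coord_frame c q)].

Definition golden : R := (1 + Num.sqrt 5) / 2.
Definition golden_conj : R := (1 - Num.sqrt 5) / 2.

Definition almost_golden_structure (phi : M -> 'M[R]_n) : Prop :=
  [/\ smooth_endomorphism phi,
      forall p, phi p *m phi p = phi p + 1%:M &
      forall p (a b : R), a *: phi p + b *: 1%:M = 0 -> a = 0 /\ b = 0].

Definition almost_golden_riemannian (phi g : M -> 'M[R]_n) : Prop :=
  [/\ almost_golden_structure phi, riemannian_metric g &
      forall X Y, smooth_vector_field X -> smooth_vector_field Y ->
      forall p, inner g (apply_endo phi X) Y p
              = inner g X (apply_endo phi Y) p].

(* [eigenspace A a] is the matrix whose row space is ker (A - a Id). *)
Definition in_eigendistribution (phi : M -> 'M[R]_n) (a : R)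
    (X : M -> 'rV[R]_n) : Prop :=
  forall p, (X p <= eigenspace (phi p) a)%MS.

Definition golden_dimensions (phi : M -> 'M[R]_n) (r s : nat) : Prop :=
  forall p, \rank (eigenspace (phi p) golden) = r /\
            \rank (eigenspace (phi p) golden_conj) = s.

(* A frame is the matrix of its vectors (as rows): the first [r] ones lie in the
   golden eigenspace, the remaining ones in the conjugate eigenspace. *)
Definition golden_frames (phi g : M -> 'M[R]_n) (r : nat) (p : M)
    : set 'M[R]_n :=
  [set F | F *m g p *m F^T = 1%:M /\
    forall i : 'I_n,
      (row i F <= eigenspace (phi p) (if (i < r)%N then golden
                                      else golden_conj))%MS].

Definition well_adapted (phi g : M -> 'M[R]_n)
    (nabla : (M -> 'rV[R]_n) -> (M -> 'rV[R]_n) -> M -> 'rV[R]_n) : Prop :=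
  [/\ covariant_derivative nabla, parallel_endomorphism nabla phi,
      parallel_metric nabla g &
      forall X Y Z, smooth_vector_field X -> smooth_vector_field Y ->
        smooth_vector_field Z ->
        (in_eigendistribution phi golden X /\
         in_eigendistribution phi golden Z) \/
        (in_eigendistribution phi golden_conj X /\
         in_eigendistribution phi golden_conj Z) ->
        forall p, inner g (torsion nabla X Y) Z p
                  = inner g (torsion nabla Z Y) X p].

End Manifold.

(* Main.v *)
From HB Require Import structures.
Require Import Defs.
From mathcomp Require Import all_boot all_order all_algebra.
From mathcomp Require Import all_classical all_reals all_analysis.
From mathcomp Require Import ring lra.
Set Implicit Arguments.
Unset Strict Implicit.
Unset Printing Implicit Defensive.
Import Order.TTheory GRing.Theory Num.Theory.
Import numFieldNormedType.Exports.
Local Open Scope classical_set_scope.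
Local Open Scope ring_scope.

(* In a chart, the connection is a family of matrices [Gam v], linear in [v], and
   the coordinate frame of a chart [y] is the inverse of the matrix [theta] with
   [D_v y = v *m theta]; it is adapted to [(phi, g)] iff [g = theta theta^T] and
   [phi theta = theta D] for the constant diagonal matrix [D].

   If torsion and curvature vanish, the linear system
   [D_v y = v *m theta], [D_v theta = Gam v *m theta] is completely integrable, so it
   has a local solution with [theta] adapted at a given point.  Since [g] and
   [phi] are parallel, [theta] stays adapted, and [y] is a chart by the inverse
   function theorem.

   Conversely, in the presence of an adapted chart, the flat torsion-free
   connection [(D_v theta) theta^-1] preserves [g] and [phi].  A connection that
   preserves [g] and [phi] is determined by the symmetry condition on its torsion,
   so this flat connection is the well adapted one. *)

(** * Differential calculus *)

(** A covariant derivative is given only as an operator on global smooth fields, so it has matrices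
    [Gam] only once its locality is proved. Bump functions do this; their extension by zero is
    smooth because the manifold is Hausdorff.

    The linear system is solved along the rays from one point, and the variation of the solution
    with the ray is estimated; flatness removes the first-order error. The equations for [y] and
    [theta] form one linear system for the stacked matrix, and its flatness condition has two
    blocks, vanishing torsion and vanishing curvature. All equations are solved on a ball so small
    that integration over the unit interval contracts by 1/2; the same smallness replaces the
    exponential in Gronwall's inequality.

    The torsion condition speaks only of fields in one eigendistribution, so testing it in a chart
    takes genuine eigenfields, not fields with constant components. In the uniqueness argument,
    skewness and commutation with [phi] dispose of arguments in distinct eigenspaces; on the rest
    the torsion condition acts as torsion-freeness does for the Levi-Civita connection. *)

Section Differentials.
Context {R : realType} {V W : normedModType R}.

Lemma diff_remainderP (f : V -> W) (x : V) (L : {linear V -> W}) :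
  continuous L ->
  (forall e, 0 < e ->
    \forall y \near x, `|f y - f x - L (y - x)| <= e * `|y - x|) ->
  differentiable f x /\ 'd f x = L :> (V -> W).
Proof.
move=> cL fL.
have H : f \o shift x = cst (f x) + L +o_ (0 : V) id.
  apply/eqaddoP => e e0; have := fL e e0; rewrite (near_shift 0 x).
  apply: filterS => k /=; rewrite subr0 addrK.
  by rewrite opprD -![(_ + _ : _ -> _) _]/(_ + _) -![(- _ : _ -> _) _]/(- _) /cst /= addrA.
have dL := diff_unique cL H; split=> //.
by apply/diff_locallyP; rewrite dL.
Qed.

Lemma diff_remainder (f : V -> W) (x : V) : differentiable f x ->
  forall e, 0 < e ->
  \forall y \near x, `|f y - f x - 'd f x (y - x)| <= e * `|y - x|.
Proof.
move=> /diff_locallyP[_ /eqaddoP H] e e0; have := H e e0.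
rewrite (near_shift 0 x); apply: filterS => k /=; rewrite subr0 addrK.
by rewrite opprD -![(_ + _ : _ -> _) _]/(_ + _) -![(- _ : _ -> _) _]/(- _) /cst /= addrA.
Qed.

Lemma near_eq_diff (f g : V -> W) (x : V) :
  (\forall y \near x, f y = g y) -> differentiable f x ->
  differentiable g x.
Proof.
move=> fg df; have fx := nbhs_singleton fg.
suff : differentiable g x /\ 'd g x = 'd f x :> (V -> W) by case.
apply: diff_remainderP; first by apply: diff_continuous.
move=> e e0; apply: filterS2 fg (diff_remainder df e0) => y <-.
by rewrite -fx.
Qed.

(** Within distance e / (|K| + 1) a quadratic error is at most [e] times the distance. Solutions of
    the flat system and the flat exponential at 0 are differentiated in this form. *)
Lemma quadratic_remainder (f : V -> W) (x : V) (L : {linear V -> W}) (K : R) :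
  continuous L ->
  (\forall y \near x, `|f y - f x - L (y - x)| <= K * `|y - x| ^+ 2) ->
  differentiable f x /\ 'd f x = L :> (V -> W).
Proof.
move=> cL fL; apply: diff_remainderP => // e e0.
have d0 : 0 < e / (`|K| + 1) by rewrite divr_gt0// ltr_wpDl.
near=> y; have yx : `|y - x| < e / (`|K| + 1).
  by rewrite distrC; near: y; exact: (@cvgr_dist_lt _ _ _ _ _ idfun x cvg_id).
apply: (@le_trans _ _ (K * `|y - x| ^+ 2)); first by near: y.
rewrite expr2 mulrA ler_wpM2r//.
rewrite (le_trans (ler_wpM2r _ (ler_norm K)))//.
rewrite (le_trans (ler_wpM2l _ (ltW yx)))// mulrA ler_pdivrMr ?ltr_wpDl//.
by rewrite mulrC ler_wpM2l ?(ltW e0)// lerDl.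
Unshelve. all: by end_near. Qed.

End Differentials.

Section Lines.
Context {R : realType} {V W : normedModType R}.

Lemma is_derive_line (f : V -> W) (x v : V) (t : R) :
  differentiable f (x + t *: v) ->
  is_derive t 1 (fun s : R => f (x + s *: v)) ('D_v f (x + t *: v)).
Proof.
move=> df.
have E : (fun h : R => h^-1 *: (((fun s : R => f (x + s *: v)) \o shift t) (h *: 1) -
      f (x + t *: v))) =
    (fun h : R => h^-1 *: ((f \o shift (x + t *: v)) (h *: v) - f (x + t *: v))).
  apply/funext => h /=; congr (_ *: (f _ - _)).
  by rewrite [h *: 1]mulr1 scalerDl addrCA addrA.
split; first by rewrite /derivable E; exact: diff_derivable.
by rewrite /derive E.
Qed.

End Lines.

Section MatrixNorm.
Context {R : realType}.

Lemma mx_entry_le m n (A : 'M[R]_(m, n)) i j : `|A i j| <= `|A|.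
Proof.
rewrite [leRHS]/Num.Def.normr/= mx_normrE.
by apply: (le_bigmax _ (fun ij : 'I_m * 'I_n => `|A ij.1 ij.2|) (i, j)).
Qed.

Lemma mx_norm_leP m n (A : 'M[R]_(m, n)) (K : R) : 0 <= K ->
  (forall i j, `|A i j| <= K) -> `|A| <= K.
Proof.
move=> K0 AK; rewrite [leLHS]/Num.Def.normr/= mx_normrE.
by apply: bigmax_le => // ij _.
Qed.

(** The norm of a matrix is its largest entry in absolute value, so it is submultiplicative only up
    to the inner dimension. The factors [m%:R] and [n%:R] in later estimates come from here. *)
Lemma mx_norm_mul m n p (A : 'M[R]_(m, n)) (B : 'M[R]_(n, p)) :
  `|A *m B| <= n%:R * `|A| * `|B|.
Proof.
apply: mx_norm_leP => [|i j]; first by rewrite !mulr_ge0.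
rewrite mxE (le_trans (ler_norm_sum _ _ _))//.
have -> : n%:R * `|A| * `|B| = \sum_(k < n) (`|A| * `|B|).
  by rewrite sumr_const card_ord -mulrA mulr_natl.
by apply: ler_sum => k _; rewrite normrM ler_pM// mx_entry_le.
Qed.

End MatrixNorm.

Section MeanValue.
Context {R : realType}.

(** With the entrywise maximum as norm, the scalar mean value theorem on each entry loses no
    constant, although the intermediate point depends on the entry. *)
Lemma mx_mean_value m n (f df : R -> 'M[R]_(m, n)) (a b K : R) : a <= b -> 0 <= K ->
  (forall t, t \in `[a, b] -> is_derive t 1 f (df t)) ->
  (forall t, t \in `[a, b] -> `|df t| <= K) ->
  `|f b - f a| <= K * (b - a).
Proof.
move=> ab K0 fd dfK; apply: mx_norm_leP => [|i j].
  by rewrite mulr_ge0 ?subr_ge0.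
have fij t : t \in `[a, b] -> is_derive t 1 (fun s => f s i j) (df t i j).
  move=> /fd[fdt <-]; split; first by move/derivable_mxP: fdt.
  by rewrite (derive_mx fdt) mxE.
have A t : t \in `]a, b[ -> is_derive t 1 (fun s => f s i j) (df t i j).
  by move=> tab; apply: fij; apply: subset_itv tab; rewrite bnd_simp.
have B : {within `[a, b], continuous (fun s => f s i j)}.
  by apply: derivable_within_continuous => t /fij[].
have [c cab /= E] := MVT_segment ab A B.
rewrite !mxE E normrM [`|b - a|]ger0_norm ?subr_ge0// ler_wpM2r ?subr_ge0//.
by rewrite (le_trans (mx_entry_le _ _ _))// dfK.
Qed.

Lemma mean_value_segment (V : normedModType R) m n (f : V -> 'M[R]_(m, n))
    (x v : V) (K : R) : 0 <= K ->
  (forall t, 0 <= t <= 1 -> differentiable f (x + t *: v)) ->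
  (forall t, 0 <= t <= 1 -> `|'D_v f (x + t *: v)| <= K) ->
  `|f (x + v) - f x| <= K.
Proof.
move=> K0 fd fK.
have := @mx_mean_value m n (fun s => f (x + s *: v)) (fun s => 'D_v f (x + s *: v))
  0 1 K ler01 K0.
rewrite scale1r scale0r addr0 subr0 mulr1; apply.
  by move=> t; rewrite in_itv/= => /fd; exact: is_derive_line.
by move=> t; rewrite in_itv/= => /fK.
Qed.

End MeanValue.

(** * Functions of class C^k *)

Section CkGeneral.
Context {R : realType} {V W : normedModType R}.
Implicit Types (U : set V) (f g : V -> W).

Lemma near_eq_continuous f g (x : V) : (\forall y \near x, f y = g y) ->
  {for x, continuous f} -> {for x, continuous g}.
Proof.
move=> fg cf; have fx : f x = g x := nbhs_singleton fg.
have H : g @ x --> f x by apply: cvg_trans cf; exact: near_eq_cvg fg.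
by rewrite fx in H.
Qed.

Lemma Ck_ext k U f g : open U -> {in U, f =1 g} -> Ck k U f -> Ck k U g.
Proof.
move=> oU; elim: k f g => [|k IH] f g fg /=.
  move=> cf x Ux; apply: near_eq_continuous (cf x Ux).
  by apply: (open_in_nearW oU) => //; rewrite inE.
have nfg x : U x -> \forall y \near x, f y = g y.
  by move=> Ux; apply: (open_in_nearW oU) => //; rewrite inE.
move=> [df Df]; split=> [x Ux|v]; first exact: near_eq_diff (nfg x Ux) (df x Ux).
apply: IH (Df v) => x; rewrite inE => Ux.
exact: near_eq_derive (nfg x Ux).
Qed.

Lemma Ck_sub k U U' f : U' `<=` U -> Ck k U f -> Ck k U' f.
Proof.
move=> sU; elim: k f => [|k IH] f /= => [cf x /sU|[df Df]]; first exact: cf.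
by split=> [x /sU|v]; [exact: df|exact: IH].
Qed.

Lemma CkW k U f : Ck k.+1 U f -> Ck k U f.
Proof.
elim: k f => [|k IH] f [df Df]; first by move=> x /df/differentiable_continuous.
by split=> // v; apply: IH.
Qed.

Lemma Ck_local k U f :
  (forall x, U x -> exists U', [/\ open U', U' x & Ck k U' f]) -> Ck k U f.
Proof.
elim: k f => [|k IH] f fU /=; first by move=> x /fU[U' [_ U'x]]; apply.
split=> [x /fU[U' [_ U'x [+ _]]]|v]; first by apply.
by apply: IH => x /fU[U' [oU' U'x [_ /(_ v) H]]]; exists U'.
Qed.

Lemma Ck_cst k U (a : W) : Ck k U (fun=> a).
Proof.
elim: k a => [|k IH] a /=; first by move=> x _; apply: cvg_cst.
split=> [x _|v]; first exact: differentiable_cst.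
have -> : (fun x => 'D_v (fun=> a) x) = (fun=> 0) :> (V -> W).
  by apply/funext => x; exact: derive_cst.
exact: IH.
Qed.

Lemma Ck_lin k U (L : {linear V -> W}) : continuous L -> Ck k U L.
Proof.
move=> cL; case: k => [|k] /=; first by move=> x _; apply: cL.
split=> [x _|v]; first exact: linear_differentiable.
have -> : (fun x => 'D_v L x) = (fun=> L v) :> (V -> W).
  apply/funext => x; rewrite deriveE ?diff_lin//; exact: linear_differentiable.
exact: Ck_cst.
Qed.

Lemma Ck_add k U f g : open U -> Ck k U f -> Ck k U g -> Ck k U (fun x => f x + g x).
Proof.
move=> oU; elim: k f g => [|k IH] f g /= => [cf cg x Ux|[df Df] [dg Dg]].
  by apply: continuousD; [exact: cf|exact: cg].
split=> [x Ux|v]; first by apply: differentiableD; [exact: df|exact: dg].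
apply: (Ck_ext oU _ (IH _ _ (Df v) (Dg v))) => x; rewrite inE => Ux.
by rewrite -[RHS]/('D_v (f + g) x) deriveD//; apply: diff_derivable; [exact: df|exact: dg].
Qed.

Lemma Ck_scale k U f (a : R) : open U -> Ck k U f -> Ck k U (fun x => a *: f x).
Proof.
move=> oU; elim: k f => [|k IH] f /= => [cf x Ux|[df Df]].
  by apply: continuousZ; [exact: cvg_cst|exact: cf].
split=> [x Ux|v]; first by apply: differentiableZ; exact: df.
apply: (Ck_ext oU _ (IH _ (Df v))) => x; rewrite inE => Ux.
by rewrite -[RHS]/('D_v (a \*: f) x) deriveZ//; apply: diff_derivable; exact: df.
Qed.

Lemma Ck_opp k U f : open U -> Ck k U f -> Ck k U (fun x => - f x).
Proof.
move=> oU /(Ck_scale (-1) oU); apply: Ck_ext => // x _; exact: scaleN1r.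
Qed.

Lemma Ck_sum k U I (r : seq I) (P : pred I) (F : I -> V -> W) : open U ->
  (forall i, P i -> Ck k U (F i)) -> Ck k U (fun x => \sum_(i <- r | P i) F i x).
Proof.
move=> oU FC; elim: r => [|i r IH].
  by apply: (Ck_ext oU _ (Ck_cst k U 0)) => x _; rewrite big_nil.
case Pi : (P i).
  apply: (Ck_ext oU _ (Ck_add oU (FC i Pi) IH)) => x _; by rewrite big_cons Pi.
by apply: (Ck_ext oU _ IH) => x _; rewrite big_cons Pi.
Qed.

Lemma smooth_onD v U f : smooth_on U f -> smooth_on U (fun x => 'D_v f x).
Proof. by move=> fS k; apply: (fS k.+1).2. Qed.

Lemma smooth_on_diff U f x : smooth_on U f -> U x -> differentiable f x.
Proof. by move=> fS; apply: (fS 1%N).1. Qed.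

Lemma smooth_on_cont U f x : smooth_on U f -> U x -> {for x, continuous f}.
Proof. by move=> fS; apply: (fS 0%N). Qed.

End CkGeneral.

Section CkScalar.
Context {R : realType} {V : normedModType R}.
Implicit Types (U : set V) (f g : V -> R).

Lemma Ck_mul k U f g : open U -> Ck k U f -> Ck k U g -> Ck k U (fun x => f x * g x).
Proof.
move=> oU; elim: k f g => [|k IH] f g /= => [cf cg x Ux|[df Df] [dg Dg]].
  by apply: continuousM; [exact: cf|exact: cg].
split=> [x Ux|v]; first by apply: differentiableM; [exact: df|exact: dg].
have Cf : Ck k U f by apply: CkW.
have Cg : Ck k U g by apply: CkW.
apply: (Ck_ext oU _ (Ck_add oU (IH _ _ Cf (Dg v)) (IH _ _ Cg (Df v)))) => x; rewrite inE => Ux.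
by rewrite -[RHS]/('D_v (f * g) x) deriveM//; apply: diff_derivable; [exact: df|exact: dg].
Qed.

Lemma Ck_inv k U f : open U -> (forall x, U x -> f x != 0) ->
  Ck k U f -> Ck k U (fun x => (f x)^-1).
Proof.
move=> oU f0; elim: k => [|k IH] /= => [cf x Ux|[df Df]].
  by apply: continuousV; [exact: f0|exact: cf].
split=> [x Ux|v]; first by apply: differentiableV; [exact: df|exact: f0].
have {}IH := IH (CkW (conj df Df)).
apply: (Ck_ext oU _ (Ck_opp oU (Ck_mul oU (Ck_mul oU IH IH) (Df v)))) => x; rewrite inE => Ux.
rewrite deriveV ?f0//; last by apply: diff_derivable; exact: df.
rewrite -exprVn expr2 -[RHS]/(- _ * _); ring.
Qed.

Lemma Ck_prod k U I (r : seq I) (P : pred I) (F : I -> V -> R) : open U ->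
  (forall i, P i -> Ck k U (F i)) -> Ck k U (fun x => \prod_(i <- r | P i) F i x).
Proof.
move=> oU FC; elim: r => [|i r IH].
  by apply: (Ck_ext oU _ (@Ck_cst _ _ R k U 1)) => x _; rewrite big_nil.
case Pi : (P i).
  apply: (Ck_ext oU _ (Ck_mul oU (FC i Pi) IH)) => x _; by rewrite big_cons Pi.
by apply: (Ck_ext oU _ IH) => x _; rewrite big_cons Pi.
Qed.

End CkScalar.

Section CkMatrix.
Context {R : realType} {V : normedModType R}.
Implicit Types (U : set V).

Lemma diff_mxP m n (F : V -> 'M[R]_(m, n)) x :
  differentiable F x <-> forall i j, differentiable (fun y => F y i j : R) x.
Proof.
split=> [dF i j|dF].
  by have := differentiable_comp dF (differentiable_coord (F x) i j).
have -> : F = (\sum_(i < m) (\sum_(j < n) (fun y => F y i j *: delta_mx i j)))%R.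
  apply/funext => y; rewrite [LHS]matrix_sum_delta fct_sumE; apply: eq_bigr => i _.
  by rewrite fct_sumE.
apply: differentiable_sum => i; apply: differentiable_sum => j.
exact: differentiableZl.
Qed.

Lemma derive_entry m n (F : V -> 'M[R]_(m, n)) x v i j : differentiable F x ->
  ('D_v F x) i j = 'D_v (fun y => F y i j : R) x.
Proof. by move=> dF; rewrite derive_mx ?mxE//; exact: diff_derivable. Qed.

Lemma Ck_mxP k U m n (F : V -> 'M[R]_(m, n)) : open U ->
  Ck k U F <-> forall i j, Ck k U (fun y => F y i j : R).
Proof.
move=> oU; elim: k F => [|k IH] F /=.
  split=> [cF i j x Ux|cF x Ux].
    have := @continuous_comp _ _ _ F (fun A : 'M[R]_(m, n) => A i j) x (cF x Ux).
    by apply; exact: coord_continuous.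
  apply/cvgrPdist_le => e e0; near=> y.
  apply: mx_norm_leP => [|i j]; first exact: ltW.
  rewrite !mxE; move: i j; near: y.
  apply: filter_forall => i; apply: filter_forall => j.
  by have /cvgrPdist_le/(_ e e0) := cF i j x Ux.
split=> [[dF DF] i j|H].
  split=> [x Ux|v]; first by move: (dF x Ux) => /diff_mxP.
  have /IH/(_ i j) := DF v; apply: Ck_ext => // x; rewrite inE => Ux.
  by rewrite derive_entry//; exact: dF.
have dF x : U x -> differentiable F x.
  by move=> Ux; apply/diff_mxP => i j; apply: (H i j).1.
split=> // v; apply/IH => i j; have := (H i j).2 v; apply: Ck_ext => // x.
by rewrite inE => Ux; rewrite derive_entry//; exact: dF.
Unshelve. all: by end_near. Qed.

Lemma Ck_mx k U m n (F : V -> 'M[R]_(m, n)) : open U ->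
  (forall i j, Ck k U (fun y => F y i j : R)) -> Ck k U F.
Proof. by move=> oU /(Ck_mxP _ _ oU). Qed.

Lemma Ck_entry k U m n (F : V -> 'M[R]_(m, n)) i j : open U ->
  Ck k U F -> Ck k U (fun y => F y i j : R).
Proof. by move=> oU /(Ck_mxP _ _ oU). Qed.

Lemma Ck_mulmx k U m n p (F : V -> 'M[R]_(m, n)) (G : V -> 'M[R]_(n, p)) :
  open U -> Ck k U F -> Ck k U G -> Ck k U (fun x => F x *m G x).
Proof.
move=> oU CF CG; apply: Ck_mx => // i j.
apply: (@Ck_ext _ _ _ k U (fun x => \sum_l F x i l * G x l j)) => //.
  by move=> x _; rewrite mxE.
by apply: Ck_sum => // l _; apply: Ck_mul => //; apply: Ck_entry.
Qed.

Lemma Ck_scalemx k U m n (a : V -> R) (F : V -> 'M[R]_(m, n)) :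
  open U -> Ck k U a -> Ck k U F -> Ck k U (fun x => a x *: F x).
Proof.
move=> oU Ca CF; apply: Ck_mx => // i j.
apply: (@Ck_ext _ _ _ k U (fun x => a x * F x i j)) => //.
  by move=> x _; rewrite mxE.
by apply: Ck_mul => //; apply: Ck_entry.
Qed.

Lemma Ck_trmx k U m n (F : V -> 'M[R]_(m, n)) :
  open U -> Ck k U F -> Ck k U (fun x => (F x)^T).
Proof.
move=> oU CF; apply: Ck_mx => // i j.
apply: (@Ck_ext _ _ _ k U (fun x => F x j i)) => //.
  by move=> x _; rewrite mxE.
exact: Ck_entry.
Qed.

Lemma Ck_det k U n (F : V -> 'M[R]_n) : open U -> Ck k U F -> Ck k U (fun x => \det (F x)).
Proof.
move=> oU CF; apply: Ck_sum => // s _; apply: Ck_mul => //; first exact: Ck_cst.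
by apply: Ck_prod => // i _; exact: Ck_entry.
Qed.

Lemma Ck_invmx k U n (F : V -> 'M[R]_n) : open U ->
  (forall x, U x -> F x \in unitmx) -> Ck k U F -> Ck k U (fun x => invmx (F x)).
Proof.
(* Cramer's rule: the adjugate is polynomial in the entries, and the determinant has no zero on
   [U]. *)
move=> oU uF CF; apply: (@Ck_ext _ _ _ k U (fun x => (\det (F x))^-1 *: \adj (F x))) => //.
  by move=> x; rewrite inE => /uF; rewrite /invmx => ->.
apply: Ck_scalemx => //.
  apply: Ck_inv => //; last exact: Ck_det.
  by move=> x /uF; rewrite unitmxE unitfE.
apply: Ck_mx => // i j.
apply: (@Ck_ext _ _ _ k U (fun x => cofactor (F x) j i)) => //.
  by move=> x _; rewrite mxE.
apply: Ck_mul => //; first exact: Ck_cst.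
apply: Ck_det => //; apply: Ck_mx => // a b.
apply: (@Ck_ext _ _ _ k U (fun x => F x (lift j a) (lift i b))) => //.
  by move=> x _; rewrite !mxE.
exact: Ck_entry.
Qed.

End CkMatrix.

Section CkComp.
Context {R : realType} {V : normedModType R} {m : nat}.

Lemma derive_compE (W : normedModType R) (f : V -> 'rV[R]_m) (g : 'rV[R]_m -> W) x v :
  differentiable f x -> differentiable g (f x) ->
  'D_v (g \o f) x = \sum_i ('D_v f x) 0 i *: 'D_(delta_mx 0 i) g (f x).
Proof.
move=> df dg; rewrite deriveE; last exact: differentiable_comp.
rewrite diff_comp //=.
have <- : 'D_v f x = 'd f x v by rewrite deriveE.
rewrite [in LHS](row_sum_delta ('D_v f x)) raddf_sum /=.
by apply: eq_bigr => i _; rewrite linearZ /= (deriveE _ dg).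
Qed.

(** [Ck] differentiates along fixed directions, while the chain rule differentiates [g] along the
    moving direction ['D_v f x]. Expanding that vector in the standard basis restores fixed
    directions, so that the induction on [k] closes. *)
Lemma Ck_comp_scalar k (U : set V) (U' : set 'rV[R]_m) (f : V -> 'rV[R]_m) (g : 'rV[R]_m -> R) :
  open U -> (forall x, U x -> U' (f x)) -> Ck k U f -> Ck k U' g -> Ck k U (g \o f).
Proof.
move=> oU fU; elim: k g => [|k IH] g /= => [cf cg x Ux|[df Df] [dg Dg]].
  by apply: continuous_comp; [exact: cf|apply: cg; exact: fU].
split=> [x Ux|v].
  by apply: differentiable_comp; [exact: df|apply: dg; exact: fU].
apply: (@Ck_ext _ _ _ k U (fun x => \sum_i ('D_v f x) 0 i * 'D_(delta_mx 0 i) g (f x))) => //.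
  by move=> x; rewrite inE => Ux; rewrite derive_compE //; [exact: df|apply: dg; exact: fU].
apply: Ck_sum => // i _; apply: Ck_mul => //.
  exact: (Ck_entry 0 i oU (Df v)).
by apply: (IH (fun x => 'D_(delta_mx 0 i) g x)) => //; exact: CkW.
Qed.

Lemma Ck_comp k p q (U : set V) (U' : set 'rV[R]_m) (f : V -> 'rV[R]_m)
    (g : 'rV[R]_m -> 'M[R]_(p, q)) :
  open U -> open U' -> (forall x, U x -> U' (f x)) -> Ck k U f -> Ck k U' g -> Ck k U (g \o f).
Proof.
move=> oU oU' fU Cf Cg; apply: Ck_mx => // i j.
exact: (Ck_comp_scalar (g := fun z => g z i j) oU fU Cf (Ck_entry i j oU' Cg)).
Qed.

End CkComp.

Section Jacobian.
Context {R : realType} {n m : nat}.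
Implicit Types (f : 'rV[R]_n -> 'rV[R]_m) (U : set 'rV[R]_n).

Lemma jacobianE f (x : 'rV[R]_n) i j : differentiable f x ->
  ('J f x) i j = ('D_(delta_mx 0 i) f x) 0 j.
Proof. by move=> df; rewrite deriveEjacobian // -rowE [RHS]mxE. Qed.

Lemma Ck_jacobian k U f : open U -> Ck k.+1 U f -> Ck k U (fun x => 'J f x).
Proof.
move=> oU [df Df]; apply: Ck_mx => // i j.
apply: (@Ck_ext _ _ _ k U (fun x => ('D_(delta_mx 0 i) f x) 0 j)) => //.
  by move=> x; rewrite inE => Ux; rewrite jacobianE//; exact: df.
exact: (Ck_entry 0 j oU (Df _)).
Qed.

Lemma derive_sum_delta (W : normedModType R) (f : 'rV[R]_n -> W) x v :
  differentiable f x -> 'D_v f x = \sum_i v 0 i *: 'D_(delta_mx 0 i) f x.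
Proof.
move=> df; rewrite deriveE // [X in 'd f _ X]row_sum_delta raddf_sum /=.
by apply: eq_bigr => i _; rewrite linearZ /= deriveE.
Qed.

Lemma jacobian_comp p f (g : 'rV[R]_m -> 'rV[R]_p) x :
  differentiable f x -> differentiable g (f x) ->
  'J (g \o f) x = 'J f x *m 'J g (f x).
Proof.
move=> df dg; apply/row_matrixP => i; rewrite !rowE mulmxA.
rewrite -(deriveEjacobian _ (differentiable_comp df dg)).
rewrite deriveE; last exact: differentiable_comp.
by rewrite diff_comp //= -deriveE // -deriveE// !deriveEjacobian.
Qed.

Lemma near_eq_jacobian f g (x : 'rV[R]_n) : (\forall y \near x, f y = g y) ->
  differentiable f x -> 'J f x = 'J g x.
Proof.
move=> fg df; apply/matrixP => i j.
apply: etrans (jacobianE i j df) _.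
apply: etrans _ (esym (jacobianE i j (near_eq_diff fg df))).
by rewrite (near_eq_derive _ fg).
Qed.

End Jacobian.

Lemma jacobian_id (R : realType) n (x : 'rV[R]_n) : 'J id x = 1%:M.
Proof.
apply/row_matrixP => i; rewrite !rowE -deriveEjacobian ?derive_id ?mulmx1//.
Qed.

(** * Symmetry of second derivatives *)

Section Schwarz.
Context {R : realType} {V : normedModType R}.

(** The mean value theorem is used twice: on the increment along [h *: w] as a function of [s], then
    on ['D_v f] as a function of [t]. The left-hand side is symmetric in [v] and [w], which
    [derive_swap] exploits. *)
Lemma second_difference (U : set V) (f : V -> R) (x v w : V) (h : R) :
  Ck 2 U f -> 0 <= h ->
  (forall s t : R, 0 <= s <= h -> 0 <= t <= h -> U (x + s *: v + t *: w)) ->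
  exists s t : R, [/\ 0 <= s <= h, 0 <= t <= h &
    f (x + h *: v + h *: w) - f (x + h *: v) - (f (x + h *: w) - f x) =
    'D_w (fun y => 'D_v f y) (x + s *: v + t *: w) * h * h].
Proof.
move=> [df Df] h0 hU.
have h00 : 0 <= (0 : R) <= h by rewrite lexx.
have hh : 0 <= h <= h by rewrite h0 lexx.
pose G s : R := f (x + s *: v + h *: w) - f (x + s *: v).
pose G' s : R := 'D_v f (x + s *: v + h *: w) - 'D_v f (x + s *: v).
have dG s : s \in `[0, h] -> is_derive s 1 G (G' s).
  rewrite in_itv/= => sh; apply: is_deriveB.
    have := @is_derive_line R V R f (x + h *: w) v s.
    rewrite addrAC => /(_ (df _ (hU _ _ sh hh))).
    have -> // : (fun s0 : R => f (x + s0 *: v + h *: w)) = (fun s0 : R => f (x + h *: w + s0 *: v)).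
    by apply/funext => z; rewrite addrAC.
  apply: is_derive_line; apply: df; have := hU _ _ sh h00.
  by rewrite scale0r addr0.
have dG' s : s \in `]0, h[ -> is_derive s 1 G (G' s).
  by move=> sh; apply: dG; apply: subset_itv sh; rewrite bnd_simp.
have cG : {within `[0, h], continuous G}.
  by apply: derivable_within_continuous => s /dG[].
have [s sh EG] := MVT_segment h0 dG' cG; move: sh; rewrite in_itv/= => sh.
pose H t : R := 'D_v f (x + s *: v + t *: w).
pose H' t : R := 'D_w (fun y => 'D_v f y) (x + s *: v + t *: w).
have dH t : t \in `[0, h] -> is_derive t 1 H (H' t).
  rewrite in_itv/= => th; apply: is_derive_line.
  by apply: (Df v).1; exact: hU.
have dH' t : t \in `]0, h[ -> is_derive t 1 H (H' t).
  by move=> th; apply: dH; apply: subset_itv th; rewrite bnd_simp.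
have cH : {within `[0, h], continuous H}.
  by apply: derivable_within_continuous => t /dH[].
have [t th EH] := MVT_segment h0 dH' cH; move: th; rewrite in_itv/= => th.
exists s, t; split=> //.
have -> : f (x + h *: v + h *: w) - f (x + h *: v) - (f (x + h *: w) - f x) = G h - G 0.
  by rewrite /G scale0r addr0.
rewrite EG subr0; congr (_ * _).
have -> : G' s = H h - H 0 by rewrite /G' /H scale0r addr0.
by rewrite EH subr0.
Qed.

(** The two orders of differentiation attain their mean values at different points [p] and [q];
    continuity at [x] brings both to [x]. *)
Lemma eq_of_near_values (a b : V -> R) (x : V) :
  {for x, continuous a} -> {for x, continuous b} ->
  (forall r, 0 < r -> exists p q, [/\ ball x r p, ball x r q & a p = b q]) ->
  a x = b x.
Proof.
move=> ca cb H; apply/eqP; rewrite -subr_eq0 -normr_le0; apply/ler_addgt0Pl => e e0.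
rewrite addr0.
have e20 : 0 < e / 2 by rewrite divr_gt0.
have /cvgrPdist_le/(_ _ e20)/nbhs_ballP[r1 /= r10 A1] := ca.
have /cvgrPdist_le/(_ _ e20)/nbhs_ballP[r2 /= r20 A2] := cb.
have r0 : 0 < Num.min r1 r2 by rewrite lt_min r10.
have [p [q [pr qr ab]]] := H _ r0.
have B1 : ball x r1 p by apply: le_ball pr; rewrite ge_min lexx.
have B2 : ball x r2 q by apply: le_ball qr; rewrite ge_min lexx orbT.
rewrite -(subrKA (a p)) (le_trans (ler_normD _ _))// (splitr e) lerD//.
  exact: A1.
rewrite ab distrC; exact: A2.
Qed.

Lemma derive_swap (U : set V) (f : V -> R) (x v w : V) :
  open U -> Ck 2 U f -> U x ->
  'D_w (fun y => 'D_v f y) x = 'D_v (fun y => 'D_w f y) x.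
Proof.
move=> oU fC Ux; apply: (@eq_of_near_values (fun y => 'D_w (fun y => 'D_v f y) y)
  (fun y => 'D_v (fun y => 'D_w f y) y) x ((fC.2 v).2 w x Ux) ((fC.2 w).2 v x Ux)) => r1 r10.
have /nbhs_ballP[r2 /= r20 rU'] : nbhs x U by apply: open_nbhs_nbhs.
pose r := Num.min r1 r2.
have r0 : 0 < r by rewrite lt_min r10.
have rU : ball x r `<=` U.
  by apply: subset_trans rU'; apply: le_ball; rewrite ge_min lexx orbT.
have rr1 : ball x r `<=` ball x r1.
  by apply: le_ball; rewrite ge_min lexx.
(* Keeps [x + s *: v + t *: w] in the ball of radius [r] for [s] and [t] up to [h]; the [+ 1] covers
   [v = w = 0]. *)
pose h := r / (`|v| + `|w| + 1) / 2.
have P0 : 0 < `|v| + `|w| + 1 by rewrite ltr_wpDl ?addr_ge0.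
have h0 : 0 < h by rewrite !divr_gt0.
have inb a b s t : `|a| + `|b| = `|v| + `|w| -> 0 <= s <= h -> 0 <= t <= h -> ball x r (x + s *: a + t *: b).
  move=> ab /andP[s0 sh] /andP[t0 th]; rewrite -ball_normE /=.
  rewrite -addrA opprD addrA subrr sub0r normrN (le_lt_trans (ler_normD _ _))//.
  rewrite !normrZ !ger0_norm// (@le_lt_trans _ _ (h * (`|v| + `|w|)))//.
    by rewrite -ab mulrDr lerD// ler_wpM2r.
  have -> : h * (`|v| + `|w|) = r * ((`|v| + `|w|) / (`|v| + `|w| + 1) / 2) by rewrite /h; ring.
  rewrite -[ltRHS]mulr1 ltr_pM2l// ltr_pdivrMr// mul1r ltr_pdivrMr//.
  rewrite mulrDr mulr1 (@lt_le_trans _ _ (`|v| + `|w| + 2))// ?ltrDl// lerD2r.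
  by have := addr_ge0 (normr_ge0 v) (normr_ge0 w); lra.
have vw : `|w| + `|v| = `|v| + `|w| by rewrite addrC.
have [s [t [sh th E1]]] := second_difference fC (ltW h0)
  (fun s t sh th => rU _ (inb v w s t erefl sh th)).
have [s' [t' [sh' th' E2]]] := second_difference fC (ltW h0)
  (fun s t sh th => rU _ (inb w v s t vw sh th)).
exists (x + s *: v + t *: w), (x + s' *: w + t' *: v); split.
- exact/rr1/inb.
- exact/rr1/inb.
have hn : h != 0 by rewrite gt_eqF.
apply: (mulIf hn); apply: (mulIf hn); apply: etrans (esym E1) _; apply: etrans _ E2.
by rewrite (addrAC x (h *: w)); ring.
Qed.

Lemma derive_swap_mx m n (U : set V) (f : V -> 'M[R]_(m, n)) (x v w : V) :
  open U -> Ck 2 U f -> U x ->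
  'D_w (fun y => 'D_v f y) x = 'D_v (fun y => 'D_w f y) x.
Proof.
move=> oU fC Ux.
have E a b : 'D_a (fun y => 'D_b f y) x =
    \matrix_(i, j) 'D_a (fun y => 'D_b (fun z => f z i j : R) y) x.
  apply/matrixP => i j; rewrite mxE derive_entry; last exact: (fC.2 b).1.
  apply: near_eq_derive; apply: (open_in_nearW oU); last by rewrite inE.
  by move=> y; rewrite inE => Uy; rewrite derive_entry//; exact: fC.1.
apply: etrans (E w v) _; apply: etrans _ (esym (E v w)).
apply/matrixP => i j; rewrite [LHS]mxE [RHS]mxE.
exact: (derive_swap v w oU (Ck_entry i j oU fC) Ux).
Qed.

End Schwarz.

(** * Linear differential equations *)

Section LinearODE.
Context {R : realType}.

Lemma ex_primitive (f : R -> R) : continuous f ->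
  exists P : R -> R, P 0 = 0 /\ forall x : R, -1 < x < 2 -> is_derive x 1 P (f x).
Proof.
(* Integration starts at -1, so that 0 and 1 are interior points and the derivative there is
   two-sided. *)
move=> cf; pose F (x : R) : R := (\int[lebesgue_measure]_(t in `[(-1)%R, x]) f t)%R.
have H (x : R) : -1 < x < 2 -> is_derive x 1 F (f x).
  move=> /andP[x1 x2].
  have iF : lebesgue_measure.-integrable `[(-1)%R, 2%R] (EFin \o f).
    apply: continuous_compact_integrable; first exact: segment_compact.
    exact: continuous_subspaceT.
  have [dF EF] : derivable F x 1 /\ derive1 F x = f x.
    exact: continuous_FTC1_closed x2 iF x1 (cf x).
  by rewrite derive1E in EF; split; [exact: dF|exact: EF].
exists (fun x => F x - F 0); split=> [|x /H dF]; first by rewrite subrr.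
have -> : f x = f x - 0 by rewrite subr0.
by apply: is_deriveB.
Qed.

Lemma ex_mx_primitive m p (f : R -> 'M[R]_(m, p)) : continuous f ->
  exists P : R -> 'M[R]_(m, p), P 0 = 0 /\ forall x : R, -1 < x < 2 -> is_derive x 1 P (f x).
Proof.
move=> cf.
have cfij i j : continuous (fun x => f x i j : R).
  move=> x; have := @continuous_comp _ _ _ f (fun A : 'M[R]_(m, p) => A i j) x (cf x).
  by apply; exact: coord_continuous.
pose Q i j := sval (cid (ex_primitive (cfij i j))).
have QP i j : Q i j 0 = 0 /\ forall x : R, -1 < x < 2 -> is_derive x 1 (Q i j) (f x i j).
  by rewrite /Q; case: cid.
exists (fun x => \matrix_(i, j) Q i j x); split.
  by apply/matrixP => i j; rewrite !mxE (QP i j).1.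
move=> x x12.
have dQ : derivable (fun x => \matrix_(i, j) Q i j x) x 1.
  apply/derivable_mxP => i j.
  have -> : (fun x => (\matrix_(i, j) Q i j x) i j) = Q i j.
    by apply/funext => y; rewrite mxE.
  by have [_ /(_ x x12)[]] := QP i j.
split=> //; apply/matrixP => i j; rewrite (derive_mx dQ) mxE.
have -> : (fun x => (\matrix_(i, j) Q i j x) i j) = Q i j.
  by apply/funext => y; rewrite mxE.
by have [_ /(_ x x12)[]] := QP i j.
Qed.

(** The increments are summed as a geometric series. The explicit rate matters: the integral
    equation and the fixed point equation are later verified by letting the error at step [k] tend
    to 0. *)
Lemma geometric_limit m p (u : nat -> 'M[R]_(m, p)) (D : R) :
  (forall k, `|u k.+1 - u k| <= D / 2 ^+ k) ->
  exists l, forall k, `|u k - l| <= 2 * D / 2 ^+ k.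
Proof.
move=> uD.
have D0 : 0 <= D by rewrite -[D]divr1 -(expr0 2) (le_trans _ (uD 0%N)).
have H k j : `|u (j + k)%N - u k| <= 2 * D / 2 ^+ k.
  (* The factor [1 - 2 ^- j] is the exact partial sum, and it makes the induction on [j] close. *)
  have : `|u (j + k)%N - u k| <= 2 * D / 2 ^+ k * (1 - 2 ^- j).
    elim: j => [|j IH]; first by rewrite add0n subrr normr0 expr0 invr1 subrr mulr0.
    rewrite addSn -(subrKA (u (j + k)%N)) (le_trans (ler_normD _ _))//.
    apply: (le_trans (lerD (uD _) IH)).
    rewrite exprD exprS !invfM le_eqVlt; apply/orP; left; apply/eqP.
    have n2 i : (2 : R) ^+ i != 0 by rewrite expf_neq0.
    by field; rewrite !n2.
  move=> /le_trans; apply; rewrite -[leRHS]mulr1 ler_wpM2l//.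
    by rewrite divr_ge0// mulr_ge0.
have geo (e : R) : 0 < e -> exists N, 2 * D / 2 ^+ N < e.
  move=> e0; have := @cvg_geometric R (2 * D) 2^-1.
  rewrite ger0_norm ?invr_ge0// invf_lt1// ltr1n => /(_ isT).
  move=> /cvgrPdist_lt/(_ e e0)[N _ /(_ N (leqnn N))] /=.
  by rewrite sub0r normrN ger0_norm ?exprVn; [exists N|rewrite divr_ge0// mulr_ge0].
have cu : cvgn u.
  apply/cauchy_cvgP/cauchy_exP => e e0.
  have [N NE] := geo e e0; exists (u N); exists N => // k /= Nk.
  by rewrite -ball_normE /= distrC -(subnK Nk) (le_lt_trans (H _ _)).
exists (limn u) => k.
have cd : (fun j => `|u k - u j|) @ \oo --> `|u k - limn u|.
  by apply: cvg_norm; apply: cvgB => //; exact: cvg_cst.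
rewrite -(cvg_lim _ cd)//; apply: limr_le; first by apply/cvg_ex; eexists; exact: cd.
exists k => // j /= kj; by rewrite distrC -(subnK kj).
Qed.

(** At a point [c] where the norm of [G] is largest on [0, 1], the mean value inequality bounds that
    norm by [q] times itself plus [e]; as [q] is at most 1/2, the first term is absorbed on the
    left. *)
Lemma gronwall m p (G G' : R -> 'M[R]_(m, p)) (q e : R) : 0 <= e -> 0 <= q <= 2^-1 ->
  G 0 = 0 -> (forall t : R, t \in `[0, 1] -> is_derive t 1 G (G' t)) ->
  (forall t : R, t \in `[0, 1] -> `|G' t| <= q * `|G t| + e) ->
  forall t : R, t \in `[0, 1] -> `|G t| <= 2 * e.
Proof.
move=> e0 /andP[q0 q2] G0 dG GB t t01.
have cG : {within `[0, 1], continuous (fun s => `|G s|)}.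
  move=> s; apply: (@continuous_comp _ _ _ (G : subspace _ -> _) Num.norm); last exact: norm_continuous.
  by apply: derivable_within_continuous => z /dG[].
have [c c01 cM] := EVT_max (@ler01 R) cG.
apply: (le_trans (cM t t01)).
have c01' := c01; move: c01'; rewrite in_itv/= => /andP[c0 c1].
have sub s : s \in `[0, c] -> s \in `[0, 1].
  by rewrite !in_itv/= => /andP[-> /le_trans]; exact.
have K0 : 0 <= q * `|G c| + e by rewrite addr_ge0// mulr_ge0.
have GK s : s \in `[0, c] -> `|G' s| <= q * `|G c| + e.
  by move=> /sub s01; rewrite (le_trans (GB s s01))// lerD2r ler_wpM2l// cM.
have := mx_mean_value c0 K0 (fun s sc => dG s (sub s sc)) GK.
rewrite G0 !subr0; have := normr_ge0 (G c); nra.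
Qed.

(** The projection of the line onto [0, 1], written with absolute values to be visibly continuous.
    It makes the Picard iterates continuous on the whole line although [A] is bounded only on
    [0, 1]. *)
Definition clamp (t : R) : R := (`|t| - `|t - 1| + 1) / 2.

Lemma clamp_id (t : R) : t \in `[0, 1] -> clamp t = t.
Proof.
rewrite in_itv/= /clamp => /andP[t0 t1].
by rewrite ger0_norm// distrC ger0_norm ?subr_ge0//; field.
Qed.

Lemma clamp_in (t : R) : clamp t \in `[0, 1].
Proof.
rewrite in_itv/= /clamp.
have a : `|t| <= `|t - 1| + 1.
  by rewrite -{1}[t](subrK 1) (le_trans (ler_normD _ _))// normr1.
have b : `|t - 1| <= `|t| + 1 by rewrite (le_trans (ler_normB _ _))// normr1.
apply/andP; split; lra.
Qed.

Lemma clamp_continuous : continuous clamp.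
Proof.
move=> t; apply: cvgM; last exact: cvg_cst.
apply: cvgD; last exact: cvg_cst.
apply: cvgB; first exact: norm_continuous.
by apply: cvg_norm; apply: cvgB; [exact: cvg_id|exact: cvg_cst].
Qed.

Section Picard.
Context (m p : nat) (A : R -> 'M[R]_m) (u0 : 'M[R]_(m, p)) (q : R).
Hypotheses (cA : continuous A) (q0 : 0 <= q) (mq : m%:R * q <= 2^-1)
  (Aq : forall t : R, t \in `[0, 1] -> `|A t| <= q).

Definition is_primitive (f P : R -> 'M[R]_(m, p)) : Prop :=
  P 0 = 0 /\ forall x : R, -1 < x < 2 -> is_derive x 1 P (f x).

Definition primitive (f : R -> 'M[R]_(m, p)) : R -> 'M[R]_(m, p) :=
  xget 0 (is_primitive f).

Lemma primitiveP f : continuous f -> is_primitive f (primitive f).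
Proof. by move=> /ex_mx_primitive[P HP]; apply: xgetPex; exists P. Qed.

Lemma mulA_continuous (P : R -> 'M[R]_(m, p)) : continuous P ->
  continuous (fun t => A t *m P t).
Proof.
move=> cP t.
have oT : open [set: R] := openT.
have CA : Ck 0 setT A by move=> x _; exact: cA.
have CP : Ck 0 setT P by move=> x _; exact: cP.
exact: (Ck_mulmx oT CA CP).
Qed.

Lemma derive1_continuous (P : R -> 'M[R]_(m, p)) (x : R) (d : 'M[R]_(m, p)) :
  is_derive x 1 P d -> {for x, continuous P}.
Proof. by move=> [/derivable1_diffP dP _]; apply: differentiable_continuous. Qed.

Fixpoint picard (k : nat) : R -> 'M[R]_(m, p) :=
  if k is k'.+1 then fun t => u0 + primitive (fun s => A s *m picard k' s) (clamp t)
  else fun=> u0.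

Lemma picardS k t :
  picard k.+1 t = u0 + primitive (fun s => A s *m picard k s) (clamp t).
Proof. by []. Qed.

Lemma in01 (t : R) : t \in `[0, 1] -> -1 < t < 2.
Proof. by rewrite in_itv/= => /andP[t0 t1]; apply/andP; split; lra. Qed.

Lemma primitive_clamp_continuous f : continuous f ->
  continuous (fun t => u0 + primitive f (clamp t)).
Proof.
move=> cf t; apply: cvgD; first exact: cvg_cst.
apply: (@continuous_comp _ _ _ clamp (primitive f)); first exact: clamp_continuous.
exact: (derive1_continuous ((primitiveP cf).2 _ (in01 (clamp_in t)))).
Qed.

Lemma picard_continuous k : continuous (picard k).
Proof.
elim: k => [|k IH] /=; first by move=> t; exact: cvg_cst.
exact/primitive_clamp_continuous/mulA_continuous.
Qed.

(** The Picard map contracts by 1/2: the product costs a factor [m%:R], the hypothesis is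
    [m%:R * q <= 2^-1], and the time is at most 1. *)
Lemma primitive_dist (P Q : R -> 'M[R]_(m, p)) (e t : R) :
  continuous P -> continuous Q -> 0 <= e ->
  (forall s : R, s \in `[0, 1] -> `|P s - Q s| <= e) -> t \in `[0, 1] ->
  `|primitive (fun s => A s *m P s) t - primitive (fun s => A s *m Q s) t| <= e / 2.
Proof.
move=> cP cQ e0 PQ t01.
have [P0 dP] := primitiveP (mulA_continuous cP).
have [Q0 dQ] := primitiveP (mulA_continuous cQ).
have t01' := t01; move: t01'; rewrite in_itv/= => /andP[t0 t1].
have sub s : s \in `[0, t] -> s \in `[0, 1].
  by rewrite !in_itv/= => /andP[-> /le_trans]; exact.
have dPQ s : s \in `[0, t] -> is_derive s 1
   (fun s => primitive (fun s => A s *m P s) s - primitive (fun s => A s *m Q s) s)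
   (A s *m P s - A s *m Q s).
  move=> /sub/in01 s12; exact: (is_deriveB (dP s s12) (dQ s s12)).
have e20 : 0 <= e / 2 by rewrite divr_ge0.
have := mx_mean_value t0 e20 dPQ; rewrite P0 Q0 !subr0 => H.
apply: le_trans (H _) _ => [s /sub s01|]; last by rewrite ler_piMr.
rewrite -mulmxBr (le_trans (mx_norm_mul _ _))//.
apply: (@le_trans _ _ (m%:R * q * e)).
  by rewrite ler_pM ?mulr_ge0 ?ler_wpM2l ?Aq ?PQ.
by rewrite [leRHS]mulrC ler_wpM2r.
Qed.

Lemma picard_dist k (t : R) : `|picard k.+1 t - picard k t| <= `|u0| / 2 ^+ k.
Proof.
elim: k t => [|k IH] t.
  rewrite expr0 divr1 /= addrAC subrr add0r.
  (* The first increment is the primitive of [A *m u0]. Comparing it with the primitive of the zero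
     function, which vanishes, bounds it by half the norm of [u0]. *)
  have := @primitive_dist (fun=> u0) (fun=> 0) `|u0| (clamp t).
  have [P0 dP] := @primitiveP (fun s => A s *m 0) (mulA_continuous (fun=> cvg_cst _)).
  have -> : primitive (fun s => A s *m 0) (clamp t) = 0.
    have ct := clamp_in t; have ct' := ct; move: ct'; rewrite in_itv/= => /andP[t0 t1].
    have dP0 s : s \in `[0, clamp t] -> is_derive s 1 (primitive (fun s => A s *m (0 : 'M[R]_(m, p)))) 0.
      rewrite in_itv/= => /andP[s0 st]; have := dP s; rewrite mulmx0; apply.
      by apply: in01; rewrite in_itv/= s0 (le_trans st).
    have := mx_mean_value t0 (lexx 0) dP0; rewrite P0 subr0 mul0r => H.
    by apply/eqP; rewrite -normr_le0 H// => s _; rewrite normr0.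
  have e1 (s : R) : s \in `[0, 1] -> `|u0| <= `|u0| by [].
  rewrite subr0 => /(_ (fun=> cvg_cst _) (fun=> cvg_cst _) (normr_ge0 _) e1 (clamp_in t)) H.
  move: H; rewrite [_ - 0]subr0 => H.
  by rewrite (le_trans H)// ler_pdivrMr// ler_peMr// ler1n.
rewrite (picardS k.+1) (picardS k) opprD addrACA subrr add0r.
rewrite exprS invfM mulrA mulrAC.
apply: (primitive_dist (@picard_continuous k.+1) (@picard_continuous k) _ _ (clamp_in t)).
  by rewrite divr_ge0// exprn_ge0.
by move=> s _.
Qed.

(** Picard iteration: [A] is so small that the iterates converge on all of [0, 1] at once, and the
    limit inherits the integral equation from the rate of convergence. *)
Lemma linear_ode : exists F : R -> 'M[R]_(m, p), F 0 = u0 /\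
  forall t : R, t \in `[0, 1] -> is_derive t 1 F (A t *m F t).
Proof.
have lim t := cid (@geometric_limit m p (fun k => picard k t) _ (fun k => picard_dist k t)).
pose P t := sval (lim t).
have PE k t : `|picard k t - P t| <= 2 * `|u0| / 2 ^+ k by apply: (svalP (lim t)).
have small (e : R) : 0 < e -> exists k : nat, 2 * `|u0| / 2 ^+ k < e.
  move=> e0; have := @cvg_geometric R (2 * `|u0|) 2^-1.
  rewrite ger0_norm ?invr_ge0// invf_lt1// ltr1n => /(_ isT).
  move=> /cvgrPdist_lt/(_ e e0)[N _ /(_ N (leqnn N))] /=.
  by rewrite sub0r normrN ger0_norm ?exprVn; [exists N|rewrite divr_ge0// mulr_ge0].
have cP : continuous P.
  move=> t; apply/cvgrPdist_le => e e0.
  have e30 : 0 < e / 3 by rewrite divr_gt0.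
  have [k kE] := small _ e30.
  have /cvgrPdist_le/(_ _ e30) := @picard_continuous k t.
  apply: filterS => s ts.
  have -> : P t - P s = - (picard k t - P t) + (picard k t - picard k s) + (picard k s - P s).
    by apply/matrixP => i j; rewrite !mxE; ring.
  have -> : e = e / 3 + e / 3 + e / 3 by field.
  rewrite (le_trans (ler_normD _ _))// lerD ?(le_trans (PE _ _) (ltW kE))//.
  by rewrite (le_trans (ler_normD _ _))// lerD// normrN (le_trans (PE _ _) (ltW kE)).
have PI t : P t = u0 + primitive (fun s => A s *m P s) (clamp t).
  apply/eqP; rewrite -subr_eq0 -normr_le0; apply/ler_addgt0Pl => e e0; rewrite addr0.
  have e20 : 0 < e / 2 by rewrite divr_gt0.
  have [k kE] := small _ e20.
  rewrite -(subrKA (picard k.+1 t)) (le_trans (ler_normD _ _))// (splitr e) lerD//.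
    rewrite distrC (le_trans (PE _ _))// (le_trans _ (ltW kE))//.
    rewrite ler_wpM2l ?mulr_ge0// lef_pV2 ?posrE ?exprn_gt0//.
    by rewrite exprS ler_peMl ?exprn_ge0// ler1n.
  rewrite picardS opprD addrACA subrr add0r.
  apply: le_trans (primitive_dist _ cP _ (fun s _ => PE k s) (clamp_in t)) _.
  - exact: picard_continuous.
  - by rewrite divr_ge0 ?exprn_ge0// mulr_ge0.
  - by rewrite ler_pdivrMr// (le_trans (ltW kE))// ler_peMr ?ler1n// ltW.
have [p0 dp] := primitiveP (mulA_continuous cP).
(* The clamp is dropped in the witness: [P] is constant on either side of [0, 1], so it may lack a
   two-sided derivative at 0 and 1, which the unclamped primitive has. *)
exists (fun t => u0 + primitive (fun s => A s *m P s) t); split; first by rewrite p0 addr0.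
move=> t t01; have := PI t; rewrite clamp_id// => <-.
rewrite -[A t *m P t]add0r; apply: is_deriveD.
exact/dp/in01.
Qed.

End Picard.

End LinearODE.

Section MatrixDerive.
Context {R : realType} {V : normedModType R}.

Lemma is_derive_mxP m n (F : V -> 'M[R]_(m, n)) (dF : 'M[R]_(m, n)) (t v : V) :
  is_derive t v F dF <-> forall i j, is_derive t v (fun s => F s i j : R) (dF i j).
Proof.
split=> [[Fd <-] i j|H].
  by split; [move/derivable_mxP: Fd|rewrite (derive_mx Fd) mxE].
have Fd : derivable F t v by apply/derivable_mxP => i j; have [] := H i j.
by split=> //; rewrite (derive_mx Fd); apply/matrixP => i j; rewrite mxE; have [] := H i j.
Qed.

Lemma is_derive_mulmx m n p (F : V -> 'M[R]_(m, n)) (G : V -> 'M[R]_(n, p)) dF dG (t v : V) :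
  is_derive t v F dF -> is_derive t v G dG ->
  is_derive t v (fun s => F s *m G s) (dF *m G t + F t *m dG).
Proof.
move=> /is_derive_mxP HF /is_derive_mxP HG; apply/is_derive_mxP => i j.
have -> : (fun s => (F s *m G s) i j) =
    \sum_(l < n) ((fun s => F s i l) * (fun s => G s l j) : V -> R).
  by apply/funext => s; rewrite mxE fct_sumE.
have -> : (dF *m G t + F t *m dG) i j = \sum_(l < n) (F t i l *: dG l j + G t l j *: dF i l).
  rewrite !mxE -big_split /=; apply: eq_bigr => l _; rewrite addrC; congr (_ + _); exact: mulrC.
by apply: is_derive_sum => l; apply: is_deriveM.
Qed.

Lemma is_derive_scalemx m n (a : V -> R) (F : V -> 'M[R]_(m, n)) da dF (t v : V) :
  is_derive t v a da -> is_derive t v F dF ->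
  is_derive t v (fun s => a s *: F s) (da *: F t + a t *: dF).
Proof.
move=> Ha /is_derive_mxP HF; apply/is_derive_mxP => i j.
have -> : (fun s => (a s *: F s) i j) = (a * (fun s => F s i j) : V -> R).
  by apply/funext => s; rewrite mxE.
have -> : (da *: F t + a t *: dF) i j = a t *: dF i j + F t i j *: da.
  by rewrite !mxE addrC; congr (_ + _); exact: mulrC.
exact: is_deriveM.
Qed.

Lemma derive_mulmx m n p (F : V -> 'M[R]_(m, n)) (G : V -> 'M[R]_(n, p)) (x v : V) :
  differentiable F x -> differentiable G x ->
  'D_v (fun y => F y *m G y) x = 'D_v F x *m G x + F x *m 'D_v G x.
Proof.
move=> dF dG.
have /derivableP hF : derivable F x v by apply: diff_derivable.
have /derivableP hG : derivable G x v by apply: diff_derivable.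
by have [] := is_derive_mulmx hF hG.
Qed.

Lemma derive_scalemx m n (a : V -> R) (F : V -> 'M[R]_(m, n)) (x v : V) :
  differentiable a x -> differentiable F x ->
  'D_v (fun y => a y *: F y) x = 'D_v a x *: F x + a x *: 'D_v F x.
Proof.
move=> dF dG.
have /derivableP hF : derivable a x v by apply: diff_derivable.
have /derivableP hG : derivable F x v by apply: diff_derivable.
by have [] := is_derive_scalemx hF hG.
Qed.

Lemma derive_mulmxl m n p (A : 'M[R]_(m, n)) (G : V -> 'M[R]_(n, p)) (x v : V) :
  differentiable G x -> 'D_v (fun y => A *m G y) x = A *m 'D_v G x.
Proof.
move=> dG; apply: etrans (derive_mulmx v (differentiable_cst A x) dG) _.
by rewrite derive_cst mul0mx add0r.
Qed.

Lemma derive_mulmxr m n p (F : V -> 'M[R]_(m, n)) (A : 'M[R]_(n, p)) (x v : V) :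
  differentiable F x -> 'D_v (fun y => F y *m A) x = 'D_v F x *m A.
Proof.
move=> dF; apply: etrans (derive_mulmx v dF (differentiable_cst A x)) _.
by rewrite derive_cst mulmx0 addr0.
Qed.

Lemma derive_trmx m n (F : V -> 'M[R]_(m, n)) (x v : V) :
  differentiable F x -> 'D_v (fun y => (F y)^T) x = ('D_v F x)^T.
Proof.
move=> dF; have dFT : differentiable (fun y => (F y)^T) x.
  apply/diff_mxP => i j; have -> : (fun y => (F y)^T i j) = (fun y => F y j i).
    by apply/funext => y; rewrite mxE.
  exact: (diff_mxP F x).1.
apply/matrixP => i j; rewrite mxE (derive_entry v i j dFT) (derive_entry v j i dF).
by congr ('D_v _ x); apply/funext => y; rewrite mxE.
Qed.

End MatrixDerive.

Section ContinuityLemmas.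
Context {R : realType} {V W : normedModType R}.

Lemma bounded_linear_continuous (L : {linear V -> W}) (C : R) :
  (forall v, `|L v| <= C * `|v|) -> continuous L.
Proof.
move=> LC x; apply/cvgrPdist_lt => e e0.
have d0 : 0 < e / (`|C| + 1) by rewrite divr_gt0// ltr_wpDl.
near=> y.
have : `|x - y| < e / (`|C| + 1) by near: y; exact: (@cvgr_dist_lt _ _ _ _ _ idfun x cvg_id).
rewrite ltr_pdivlMr ?ltr_wpDl// => H; apply: le_lt_trans H.
rewrite -linearB (le_trans (LC _))// mulrC ler_wpM2l//.
by rewrite (le_trans (ler_norm _))// lerDl.
Unshelve. all: by end_near. Qed.

Lemma sum_continuous_at (I : Type) (r : seq I) (f : I -> V -> W) (x : V) :
  (forall i, {for x, continuous (f i)}) ->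
  {for x, continuous (fun y => \sum_(i <- r) f i y)}.
Proof.
move=> fC; apply: cvg_big => [|i _]; first exact: add_continuous.
exact: fC.
Qed.

Lemma norm_continuous_at (f : V -> W) (x : V) : {for x, continuous f} ->
  {for x, continuous (fun y => `|f y|)}.
Proof. by move=> fC; apply: cvg_norm. Qed.

End ContinuityLemmas.

Section LinearRow.
Context {R : realType} {n : nat} {W : normedModType R}.

(** Makes a bound at the finitely many basis directions uniform in all directions. *)
Lemma linear_row_bound (L : 'rV[R]_n -> W) (v : 'rV[R]_n) : linear L ->
  `|L v| <= `|v| * \sum_i `|L (delta_mx 0 i)|.
Proof.
move=> lL; pose LM : {linear 'rV[R]_n -> W} := HB.pack L (GRing.isLinear.Build _ _ _ _ _ lL).
have -> : L v = \sum_i v 0 i *: L (delta_mx 0 i).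
  rewrite -[L]/(LM : _ -> _) [X in LM X]row_sum_delta raddf_sum.
  by apply: eq_bigr => i _; exact: linearZ_LR.
rewrite (le_trans (ler_norm_sum _ _ _))// mulr_sumr; apply: ler_sum => i _.
by rewrite normrZ ler_wpM2r// mx_entry_le.
Qed.

Lemma linear_row_continuous (L : 'rV[R]_n -> W) : linear L -> continuous L.
Proof.
move=> lL; pose LM : {linear 'rV[R]_n -> W} := HB.pack L (GRing.isLinear.Build _ _ _ _ _ lL).
apply: (@bounded_linear_continuous _ _ _ LM (\sum_i `|L (delta_mx 0 i)|)) => v.
by rewrite mulrC; exact: linear_row_bound.
Qed.

End LinearRow.

Section Taylor.
Context {R : realType} {V : normedModType R}.

(** ['D_v f] varies by at most [K] along the segment, and its variation is the derivative of
    [f (x + s *: v) - s *: 'D_v f x]. Two mean value inequalities lose only the factor 1/2 of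
    Taylor's formula. *)
Lemma taylor2_segment m n (f : V -> 'M[R]_(m, n)) (U : set V) (x v : V) (K : R) :
  Ck 2 U f -> 0 <= K -> (forall t : R, 0 <= t <= 1 -> U (x + t *: v)) ->
  (forall t : R, 0 <= t <= 1 -> `|'D_v (fun y => 'D_v f y) (x + t *: v)| <= K) ->
  `|f (x + v) - f x - 'D_v f x| <= K.
Proof.
move=> fC K0 hU hK.
have d0 (s t : R) : 0 <= s <= 1 -> 0 <= t <= 1 -> 0 <= t * s <= 1.
  by move=> /andP[s0 s1] /andP[t0 t1]; rewrite mulr_ge0//= mulr_ile1.
have H1 (s : R) : 0 <= s <= 1 -> `|'D_v f (x + s *: v) - 'D_v f x| <= K.
  move=> s01; have := @mean_value_segment R V m n (fun y => 'D_v f y) x (s *: v) K K0.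
  apply=> t t01; rewrite scalerA.
    by apply: (fC.2 v).1; exact/hU/d0.
  have df : differentiable (fun y => 'D_v f y) (x + (t * s) *: v).
    by apply: (fC.2 v).1; exact/hU/d0.
  rewrite deriveE// linearZ /= -deriveE// normrZ.
  have /andP[s0 s1] := s01; rewrite ger0_norm//.
  by rewrite (le_trans _ (hK _ (d0 _ _ s01 t01)))// ler_piMl.
pose g (s : R) := f (x + s *: v) - s *: 'D_v f x.
have dg (s : R) : s \in `[0, 1] -> is_derive s 1 g ('D_v f (x + s *: v) - 'D_v f x).
  rewrite in_itv/= => s01; apply: is_deriveB.
    by apply: is_derive_line; apply: fC.1; exact: hU.
  have := is_derive_scalemx (is_derive_id s (1 : R)) (is_derive_cst ('D_v f x) s (1 : R)).
  by rewrite scale1r scaler0 addr0.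
have B s : s \in `[0, 1] -> `|'D_v f (x + s *: v) - 'D_v f x| <= K.
  by rewrite in_itv/=; exact: H1.
have := mx_mean_value ler01 K0 dg B.
by rewrite /g scale1r scale0r addr0 subr0 scale1r scale0r subr0 mulr1 addrAC.
Qed.

End Taylor.

(** * Completely integrable linear systems *)

Section FlatSystem.
Context {R : realType} {n m p : nat}.
Implicit Types (U : set 'rV[R]_n).

Lemma ex_ball_bound U (x0 : 'rV[R]_n) (S : 'rV[R]_n -> R) : open U -> U x0 ->
  {for x0, continuous S} -> exists r C, [/\ 0 < r, 0 <= C & forall x, ball x0 r x -> U x /\ S x <= C].
Proof.
move=> oU Ux cS.
have /cvgrPdist_lt/(_ _ ltr01)/nbhs_ballP[r1 /= r10 H1] := cS.
have /nbhs_ballP[r2 /= r20 H2] : nbhs x0 U by apply: open_nbhs_nbhs.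
exists (Num.min r1 r2), (`|S x0| + 1); split.
- by rewrite lt_min r10.
- by rewrite addr_ge0.
move=> x xr; split.
  by apply: H2; apply: le_ball xr; rewrite ge_min lexx orbT.
have /H1 : ball x0 r1 x by apply: le_ball xr; rewrite ge_min lexx.
rewrite /= distrC => H; rewrite (le_trans (ler_norm _))// -(subrK (S x0) (S x)).
by rewrite (le_trans (ler_normD _ _))// addrC lerD2l ltW.
Qed.

Context (U : set 'rV[R]_n) (x0 : 'rV[R]_n) (B : 'rV[R]_n -> 'rV[R]_n -> 'M[R]_m) (u0 : 'M[R]_(m, p)).
Hypotheses (oU : open U) (Ux0 : U x0) (BC : forall v, Ck 2 U (B v))
  (Blin : forall x, linear (B^~ x))
  (Bflat : forall x v w, U x -> 'D_w (B v) x + B v x *m B w x = 'D_v (B w) x + B w x *m B v x).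

Local Lemma Blin_derive w x : U x -> linear (fun v => 'D_w (B v) x).
Proof.
move=> Ux a v1 v2.
have d v : differentiable (B v) x by apply: (BC v).1.
have -> : B (a *: v1 + v2) = (a \*: B v1) + B v2.
  by apply/funext => y; rewrite Blin.
rewrite deriveD ?deriveZ//; apply: diff_derivable => //; exact: differentiableZ.
Qed.

Local Lemma Blin_derive2 w w' x : U x -> linear (fun v => 'D_w' (fun y => 'D_w (B v) y) x).
Proof.
move=> Ux a v1 v2.
have d v : differentiable (fun y => 'D_w (B v) y) x by apply: ((BC v).2 w).1.
have -> : 'D_w' (fun y => 'D_w (B (a *: v1 + v2)) y) x =
   'D_w' (a \*: (fun y => 'D_w (B v1) y) + (fun y => 'D_w (B v2) y)) x.
  apply: near_eq_derive; apply: (open_in_nearW oU); last by rewrite inE.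
  by move=> y; rewrite inE => Uy; rewrite Blin_derive.
rewrite deriveD ?deriveZ//; apply: diff_derivable => //; exact: differentiableZ.
Qed.

Local Lemma derive_linear q1 q2 (f : 'rV[R]_n -> 'M[R]_(q1, q2)) x : differentiable f x ->
  linear (fun v => 'D_v f x).
Proof. by move=> df a v w; rewrite !deriveE// linearP. Qed.

(** All three expressions are multilinear in the directions, so they are controlled by sums of norms
    over basis directions; these sums are continuous at [x0], hence bounded nearby. *)
Local Lemma system_bounds : exists r C, [/\ 0 < r, 0 <= C, ball x0 r `<=` U &
  forall x v w w', ball x0 r x ->
   [/\ `|B v x| <= C * `|v|, `|'D_w (B v) x| <= C * `|v| * `|w| &
       `|'D_w' (fun y => 'D_w (B v) y) x| <= C * `|v| * `|w| * `|w'|]].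
Proof.
pose e i : 'rV[R]_n := delta_mx 0 i.
pose S0 x := \sum_i `|B (e i) x|.
pose S1 x := \sum_j \sum_i `|'D_(e j) (B (e i)) x|.
pose S2 x := \sum_k \sum_j \sum_i `|'D_(e k) (fun y => 'D_(e j) (B (e i)) y) x|.
have S00 x : 0 <= S0 x by apply: sumr_ge0.
have S10 x : 0 <= S1 x by apply: sumr_ge0 => j _; apply: sumr_ge0.
have S20 x : 0 <= S2 x by apply: sumr_ge0 => k _; apply: sumr_ge0 => j _; apply: sumr_ge0.
have cS : {for x0, continuous (fun x => S0 x + S1 x + S2 x)}.
  have c0 : {for x0, continuous S0}.
    apply: sum_continuous_at => i; apply: norm_continuous_at.
    by apply: differentiable_continuous; apply: (BC _).1.
  have c1 : {for x0, continuous S1}.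
    apply: sum_continuous_at => j; apply: sum_continuous_at => i; apply: norm_continuous_at.
    by apply: differentiable_continuous; apply: ((BC _).2 _).1.
  have c2 : {for x0, continuous S2}.
    apply: sum_continuous_at => k; apply: sum_continuous_at => j; apply: sum_continuous_at => i.
    by apply: norm_continuous_at; apply: ((BC _).2 _).2.
  exact: (continuousD (continuousD c0 c1) c2).
have [r [C [r0 C0 H]]] := ex_ball_bound oU Ux0 cS.
exists r, C; split=> // [x /H[]//|x v w w' /H[Ux SC]].
have b0 v' : `|B v' x| <= `|v'| * S0 x.
  exact: (linear_row_bound v' (Blin x)).
have b1 v' w1 : `|'D_w1 (B v') x| <= `|w1| * (`|v'| * S1 x).
  apply: le_trans (linear_row_bound w1 (derive_linear _)) _; first exact: (BC v').1.
  rewrite ler_wpM2l// mulr_sumr; apply: ler_sum => j _.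
  exact: (linear_row_bound v' (Blin_derive _ Ux)).
have b2 : `|'D_w' (fun y => 'D_w (B v) y) x| <= `|w'| * (`|w| * (`|v| * S2 x)).
  apply: le_trans (linear_row_bound w' (derive_linear _)) _; first exact: ((BC v).2 w).1.
  rewrite ler_wpM2l// !mulr_sumr; apply: ler_sum => k _.
  (* [derive_linear] expands only the outermost direction, so the two derivatives are exchanged to
     expand in [w] and exchanged back before expanding in [v]. *)
  have -> : 'D_(delta_mx 0 k) (fun y => 'D_w (B v) y) x = 'D_w (fun y => 'D_(delta_mx 0 k) (B v) y) x.
    exact: (derive_swap_mx _ _ oU (BC v) Ux).
  apply: le_trans (linear_row_bound w (derive_linear _)) _; first exact: ((BC v).2 _).1.
  rewrite ler_wpM2l// mulr_sumr; apply: ler_sum => j _.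
  rewrite (derive_swap_mx _ _ oU (BC v) Ux).
  exact: (linear_row_bound v (Blin_derive2 _ _ Ux)).
split.
- rewrite (le_trans (b0 v))// mulrC ler_wpM2r//.
  by rewrite (le_trans _ SC)// -addrA lerDl addr_ge0.
- apply: le_trans (b1 v w) _.
  have -> : `|w| * (`|v| * S1 x) = S1 x * (`|v| * `|w|) by ring.
  rewrite -mulrA ler_wpM2r ?mulr_ge0//.
  by rewrite (le_trans _ SC)// addrAC lerDr addr_ge0.
- apply: le_trans b2 _.
  have -> : `|w'| * (`|w| * (`|v| * S2 x)) = S2 x * (`|v| * `|w| * `|w'|) by ring.
  have -> : C * `|v| * `|w| * `|w'| = C * (`|v| * `|w| * `|w'|) by ring.
  rewrite ler_wpM2r ?mulr_ge0//.
  by rewrite (le_trans _ SC)// lerDr addr_ge0.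
Qed.

Local Lemma remainder_identity (t : R) (X1 X2 X3 X4 X5 X6 X7 : 'M[R]_(m, p)) :
  X1 - X2 - (X3 + (t *: X4 + t *: X5)) =
  X6 - X2 - t *: X5 + (X1 - X7 - (X6 - X2)) + (X7 - X2 - X3 - t *: X4).
Proof. by apply/matrixP => i j; rewrite !mxE; ring. Qed.

(** [linear_ode] gives existence only, so one solution is selected for each [h]; the estimates that
    follow compare whichever ones are selected. The default value is never met for small [h]. *)
Definition ray_solution (h : 'rV[R]_n) : R -> 'M[R]_(m, p) :=
  xget (fun=> u0) (fun F => F 0 = u0 /\
    forall t : R, t \in `[0, 1] -> is_derive t 1 F (B h (x0 + t *: h) *m F t)).

(* With F_h the solution along the ray in direction h, the error
   F_(h+k) - F_h - t B_k F_h solves the equation of F_h up to O(|k|^2):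
   this is where flatness is used. *)
Lemma flat_system : exists d u, [/\ 0 < d, ball x0 d `<=` U, u x0 = u0 &
  forall x, ball x0 d x -> differentiable u x /\ forall v, 'D_v u x = B v x *m u x].
Proof.
have [r [C [r0 C0 rU HB]]] := system_bounds.
have M0 : 0 < 2 * (m%:R * C + 1) :> R by rewrite mulr_gt0// ltr_wpDl// mulr_ge0.
(* [r] gives the bounds of [system_bounds], 1 gives that [C] times the norm of [h] is at most [C],
   and the last term gives the smallness required by [linear_ode] and [gronwall]. *)
pose d := Num.min (Num.min r 1) (2 * (m%:R * C + 1))^-1.
have d0 : 0 < d by rewrite !lt_min r0 ltr01 invr_gt0.
have dr : d <= r by rewrite !ge_min lexx.
have d1 : d <= 1 by rewrite !ge_min lexx orbT.
have dM : m%:R * (C * d) <= 2^-1.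
  have : d <= (2 * (m%:R * C + 1))^-1 by rewrite ge_min lexx orbT.
  rewrite -[leRHS]mul1r ler_pdivlMr// => H.
  have mC0 : 0 <= m%:R * C by rewrite mulr_ge0.
  rewrite mulrA; nra.
have q0 : 0 <= C * d by rewrite mulr_ge0// ltW.
have inb (h : 'rV[R]_n) (t : R) : `|h| < d -> 0 <= t <= 1 -> ball x0 r (x0 + t *: h).
  move=> hd /andP[t0 t1]; rewrite -ball_normE /= opprD addrA subrr sub0r normrN normrZ.
  by rewrite ger0_norm// (lt_le_trans _ dr)// (le_lt_trans _ hd)// ler_piMl.
have HBd v x : ball x0 r x -> `|v| < d -> `|B v x| <= C * d.
  by move=> /HB - /(_ v 0 0)[+ _ _] vd => /le_trans; apply; rewrite ler_wpM2l// ltW.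
have solP h : `|h| < d -> ray_solution h 0 = u0 /\
    forall t : R, t \in `[0, 1] -> is_derive t 1 (ray_solution h) (B h (x0 + t *: h) *m ray_solution h t).
  move=> hd; pose A (t : R) := B h (x0 + clamp t *: h).
  have cA : continuous A.
    move=> t; have cl : {for t, continuous (fun s : R => x0 + clamp s *: h)}.
      by apply: cvgD; [exact: cvg_cst|apply: cvgZr_tmp; exact: clamp_continuous].
    apply: (continuous_comp cl (g := B h)); apply: differentiable_continuous.
    apply: (BC h).1; apply: rU; apply: inb => //.
    by have := clamp_in t; rewrite in_itv.
  have Aq (t : R) : t \in `[0, 1] -> `|A t| <= C * d.
    move=> t01; apply: (HBd h) => //; apply: inb => //.
    by have := clamp_in t; rewrite in_itv.
  have [F [F0 dF]] := linear_ode u0 cA dM Aq.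
  suff : [set F | F 0 = u0 /\ forall t : R, t \in `[0, 1] ->
      is_derive t 1 F (B h (x0 + t *: h) *m F t)] (ray_solution h) by [].
  apply: xgetPex; exists F; split=> // t t01; have := dF t t01.
  by rewrite /A clamp_id.
have bnd h (t : R) : `|h| < d -> t \in `[0, 1] -> `|ray_solution h t| <= 2 * `|u0|.
  move=> hd t01; have [F0 dF] := solP h hd.
  have e0 : 0 <= `|u0| / 2 by rewrite divr_ge0.
  have qq : 0 <= m%:R * (C * d) <= 2^-1 by rewrite dM mulr_ge0.
  have G0 : ray_solution h 0 - u0 = 0 by rewrite F0 subrr.
  have dG (s : R) : s \in `[0, 1] -> is_derive s 1 (fun s => ray_solution h s - u0)
      (B h (x0 + s *: h) *m ray_solution h s).
    move=> /dF H; rewrite -[X in is_derive _ _ _ X]subr0; exact: is_deriveB.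
  have GB (s : R) : s \in `[0, 1] -> `|B h (x0 + s *: h) *m ray_solution h s| <=
      m%:R * (C * d) * `|ray_solution h s - u0| + `|u0| / 2.
    move=> s01; rewrite (le_trans (mx_norm_mul _ _))//.
    have Bs : `|B h (x0 + s *: h)| <= C * d.
      by apply: (HBd h) => //; apply: inb => //; rewrite in_itv in s01.
    apply: (@le_trans _ _ (m%:R * (C * d) * `|ray_solution h s|)).
      by rewrite ler_wpM2r// ler_wpM2l.
    apply: (@le_trans _ _ (m%:R * (C * d) * (`|ray_solution h s - u0| + `|u0|))).
      apply: ler_wpM2l; first by rewrite mulr_ge0.
      by rewrite -{1}(subrK u0 (ray_solution h s)) ler_normD.
    by rewrite mulrDr lerD2l [leRHS]mulrC ler_wpM2r.
  have := gronwall e0 qq G0 dG GB t01.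
  rewrite mulrCA divff// mulr1 => H.
  rewrite -(subrK u0 (ray_solution h t)) (le_trans (ler_normD _ _))//.
  by rewrite mulr_natl mulr2n lerD2r.
pose u x := ray_solution (x - x0) 1.
exists d, u; split=> //.
- by apply: subset_trans rU; apply: le_ball.
- rewrite /u subrr; have z0 : `|0 : 'rV[R]_n| < d by rewrite normr0.
  have [F0 dF] := solP 0 z0.
  have K0 (s : R) : s \in `[0, 1] -> `|B 0 (x0 + s *: 0) *m ray_solution 0 s| <= 0.
    rewrite in_itv => s01; have [+ _ _] := HB _ 0 0 0 (inb 0 s z0 s01).
    by rewrite normr0 mulr0 normr_le0 => /eqP->; rewrite mul0mx normr0.
  have := mx_mean_value ler01 (lexx 0) dF K0.
  by rewrite mul0r normr_le0 F0 subr_eq0 => /eqP.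
move=> x xd; pose h := x - x0.
have hd : `|h| < d by move: xd; rewrite -ball_normE /= distrC.
have xh : x = x0 + h by rewrite addrC subrK.
have lL : linear (fun k => B k x *m u x).
  by move=> a v w; rewrite Blin mulmxDl scalemxAl.
pose L : {linear 'rV[R]_n -> 'M[R]_(m, p)} := HB.pack (fun k => B k x *m u x) (GRing.isLinear.Build _ _ _ _ _ lL).
(* The outer 2 is that of [gronwall]. The first summand bounds the variation of the coefficient
   times [G - F], the second its Taylor remainder times [F], both relative to the squared norm of
   [k]. *)
pose K := 2 * (m%:R * (2 * C) * (2 * (m%:R * (2 * C) * (2 * `|u0|))) + m%:R * (2 * C) * (2 * `|u0|)).
suff [dL EL] : differentiable u x /\ 'd u x = L :> (_ -> _).
  by split=> // v; rewrite deriveE// EL.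
apply: (@quadratic_remainder _ _ _ u x L K).
  exact: linear_row_continuous.
have : nbhs x (ball x0 d) by apply: open_nbhs_nbhs; split=> //; exact: ball_open.
apply: filterS => y yd; pose k := y - x.
have hkE : h + k = y - x0 by rewrite /h /k [LHS]addrC addrA subrK.
have hkd : `|h + k| < d by move: yd; rewrite -ball_normE /= distrC hkE.
have -> : u y = ray_solution (h + k) 1 by rewrite hkE.
have -> : u x = ray_solution h 1 by [].
rewrite -/k /=.
have [F0 dF] := solP h hd; have [G0 dG] := solP (h + k) hkd.
set F := ray_solution h in F0 dF *; set G := ray_solution (h + k) in G0 dG *.
have CK0 : 0 <= C * `|k| by rewrite mulr_ge0.
have inseg (t s : R) : 0 <= t <= 1 -> 0 <= s <= 1 -> ball x0 r (x0 + t *: h + s *: (t *: k)).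
  move=> t01 /andP[s0 s1]; have -> : x0 + t *: h + s *: (t *: k) = x0 + t *: (h + s *: k).
    by apply/matrixP => i j; rewrite !mxE; ring.
  apply: inb => //; have -> : h + s *: k = (1 - s) *: h + s *: (h + k).
    by apply/matrixP => i j; rewrite !mxE; ring.
  rewrite (le_lt_trans (ler_normD _ _))// !normrZ !ger0_norm ?subr_ge0//.
  have [s01|s11] := ltP s 1; last first.
    have -> : s = 1 by apply: le_anti; rewrite s1 s11.
    by rewrite subrr mul0r add0r mul1r.
  have : (1 - s) * `|h| < (1 - s) * d by rewrite ltr_pM2l// subr_gt0.
  have : s * `|h + k| <= s * d by rewrite ler_wpM2l// ltW.
  nra.
have kd : `|k| <= 2 * d.
  have -> : k = (h + k) - h by rewrite addrC addKr.
  by rewrite (le_trans (ler_normB _ _))// mulr_natl mulr2n lerD// ltW.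
have tk (t : R) : 0 <= t <= 1 -> `|t *: k| <= `|k|.
  by move=> /andP[t0 t1]; rewrite normrZ ger0_norm// ler_piMl.
have pt (t : R) : x0 + t *: (h + k) = x0 + t *: h + t *: k by rewrite scalerDr addrA.
have var v (t : R) : 0 <= t <= 1 -> `|B v (x0 + t *: h + t *: k) - B v (x0 + t *: h)| <= C * `|v| * `|k|.
  move=> t01; apply: mean_value_segment => [|s s01|s s01]; first by rewrite !mulr_ge0.
    by apply: (BC v).1; apply: rU; exact: inseg.
  have [_ + _] := HB _ v (t *: k) 0 (inseg t s t01 s01).
  by move=> /le_trans; apply; rewrite ler_wpM2l ?mulr_ge0 ?tk.
have hC : C * `|h| <= C by rewrite ler_piMr// (le_trans (ltW hd)).
have dA (t : R) : 0 <= t <= 1 -> `|B (h + k) (x0 + t *: (h + k)) - B h (x0 + t *: h)| <= 2 * C * `|k|.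
  move=> t01; rewrite pt.
  have -> : B (h + k) (x0 + t *: h + t *: k) = B h (x0 + t *: h + t *: k) + B k (x0 + t *: h + t *: k).
    by have := Blin (x0 + t *: h + t *: k) 1 h k; rewrite !scale1r.
  rewrite addrAC (le_trans (ler_normD _ _))//.
  have [+ _ _] := HB _ k 0 0 (inb _ _ hkd t01); rewrite pt => H1.
  have := var h t t01 => H2.
  have : C * `|h| * `|k| <= C * `|k| by rewrite ler_wpM2r.
  lra.
have dFG (t : R) : t \in `[0, 1] -> `|G t - F t| <= 2 * (m%:R * (2 * C) * (2 * `|u0|) * `|k|).
  apply: (@gronwall _ _ _ (fun t => G t - F t) (fun t => B (h + k) (x0 + t *: (h + k)) *m G t -
     B h (x0 + t *: h) *m F t) (m%:R * (C * d))).
  - by rewrite !mulr_ge0.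
  - by rewrite dM mulr_ge0.
  - by rewrite F0 G0 subrr.
  - by move=> s s01; apply: is_deriveB; [exact: dG|exact: dF].
  move=> s s01; have s01' : 0 <= s <= 1 by rewrite in_itv in s01.
  have -> : B (h + k) (x0 + s *: (h + k)) *m G s - B h (x0 + s *: h) *m F s =
     B (h + k) (x0 + s *: (h + k)) *m (G s - F s) + (B (h + k) (x0 + s *: (h + k)) - B h (x0 + s *: h)) *m F s.
    move: (B (h + k) _) (B h _) => M1 M2.
    by rewrite mulmxBr mulmxBl addrA subrK.
  rewrite (le_trans (ler_normD _ _))// lerD//.
    rewrite (le_trans (mx_norm_mul _ _))// ler_wpM2r// ler_wpM2l//.
    by apply: (HBd _) => //; exact: inb.
  rewrite (le_trans (mx_norm_mul _ _))//.
  have -> : m%:R * (2 * C) * (2 * `|u0|) * `|k| = m%:R * (2 * C * `|k|) * (2 * `|u0|) by ring.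
  by rewrite ler_pM ?mulr_ge0// ?ler_wpM2l ?dA ?bnd.
have dR (t : R) : 0 <= t <= 1 -> `|B (h + k) (x0 + t *: (h + k)) - B h (x0 + t *: h) -
    B k (x0 + t *: h) - t *: 'D_k (B h) (x0 + t *: h)| <= 2 * C * `|k| ^+ 2.
  move=> t01; rewrite pt.
  have -> : B (h + k) (x0 + t *: h + t *: k) = B h (x0 + t *: h + t *: k) + B k (x0 + t *: h + t *: k).
    by have := Blin (x0 + t *: h + t *: k) 1 h k; rewrite !scale1r.
  have z01 : 0 <= (0 : R) <= 1 by rewrite lexx ler01.
  have dBh : differentiable (B h) (x0 + t *: h).
    by apply: (BC h).1; apply: rU; have := inseg t 0 t01 z01; rewrite scale0r addr0.
  have -> : t *: 'D_k (B h) (x0 + t *: h) = 'D_(t *: k) (B h) (x0 + t *: h).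
    by rewrite !deriveE// linearZ.
  set z := x0 + t *: h; set w := t *: k.
  have -> : B h (z + w) + B k (z + w) - B h z - B k z - 'D_w (B h) z =
    (B h (z + w) - B h z - 'D_w (B h) z) + (B k (z + w) - B k z).
    by apply/matrixP => i j; rewrite !mxE; ring.
  rewrite (le_trans (ler_normD _ _))//.
  have T1 : `|B h (z + w) - B h z - 'D_w (B h) z| <= C * `|k| ^+ 2.
    apply: (@taylor2_segment _ _ _ _ (B h) U) => // [|s s01|s s01].
    - by rewrite mulr_ge0// exprn_ge0.
    - by apply: rU; exact: inseg.
    have [_ _] := HB _ h w w (inseg t s t01 s01).
    move=> /le_trans; apply; rewrite expr2 -mulrA ler_pM ?mulr_ge0//.
    by rewrite ler_pM// tk.
  have T2 : `|B k (z + w) - B k z| <= C * `|k| ^+ 2.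
    by rewrite expr2 mulrA; exact: var.
  lra.
pose E (t : R) := G t - F t - t *: (B k (x0 + t *: h) *m F t).
(* The derivative of [E], arranged for [gronwall]: the coefficient [B h] acting on [E], plus two
   terms of second order in [k]. *)
pose E' (t : R) := B h (x0 + t *: h) *m E t
   + (B (h + k) (x0 + t *: (h + k)) - B h (x0 + t *: h)) *m (G t - F t)
   + (B (h + k) (x0 + t *: (h + k)) - B h (x0 + t *: h) - B k (x0 + t *: h)
       - t *: 'D_k (B h) (x0 + t *: h)) *m F t.
have dE (t : R) : t \in `[0, 1] -> is_derive t 1 E (E' t).
  move=> t01; have t01' : 0 <= t <= 1 by rewrite in_itv in t01.
  have Uz : U (x0 + t *: h) by apply: rU; exact: inb.
  have dB : is_derive t 1 (fun s : R => B k (x0 + s *: h)) ('D_h (B k) (x0 + t *: h)).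
    by apply: is_derive_line; exact: (BC k).1.
  have := is_deriveB (is_deriveB (dG t t01) (dF t t01))
    (is_derive_scalemx (is_derive_id t (1 : R)) (is_derive_mulmx dB (dF t t01))).
  rewrite /E' /E scale1r; congr (is_derive _ _ _ _).
  set z := x0 + t *: h; set z' := x0 + t *: (h + k).
  (* Both sides are mixed derivatives of a solution. Without this exchange [E'] would keep a
     curvature term that is only of first order in [k]. *)
  have -> : 'D_h (B k) z *m F t + B k z *m (B h z *m F t) =
      'D_k (B h) z *m F t + B h z *m (B k z *m F t).
    by rewrite !mulmxA -!mulmxDl Bflat.
  rewrite scalerDr !(mulmxBl, mulmxBr) -!scalemxAl -!scalemxAr.
  exact: remainder_identity.
have P0 : 0 <= m%:R * (2 * C) * (2 * (m%:R * (2 * C) * (2 * `|u0|))) + m%:R * (2 * C) * (2 * `|u0|).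
  by rewrite addr_ge0// !mulr_ge0.
have i1 : (1 : R) \in `[0, 1] by rewrite in_itv/= lexx ler01.
have -> : G 1 - F 1 - B k x *m u x = E 1 by rewrite /E !scale1r -xh.
have -> : K * `|k| ^+ 2 = 2 * ((m%:R * (2 * C) * (2 * (m%:R * (2 * C) * (2 * `|u0|)))
    + m%:R * (2 * C) * (2 * `|u0|)) * `|k| ^+ 2) by rewrite [RHS]mulrA.
apply: (@gronwall _ _ _ E E' (m%:R * (C * d)) _ _ _ _ dE _ 1 i1).
- by rewrite mulr_ge0// exprn_ge0.
- by rewrite dM mulr_ge0.
- by rewrite /E F0 G0 subrr scale0r subrr.
move=> t t01; have t01' : 0 <= t <= 1 by rewrite in_itv in t01.
rewrite /E' -/(E t) (le_trans (ler_normD _ _))//.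
rewrite [X in _ <= _ + X]mulrDl [leRHS]addrA; apply: lerD; last first.
  rewrite (le_trans (mx_norm_mul _ _))//.
  have -> : m%:R * (2 * C) * (2 * `|u0|) * `|k| ^+ 2 = m%:R * (2 * C * `|k| ^+ 2) * (2 * `|u0|) by ring.
  by rewrite ler_pM ?mulr_ge0// ?ler_wpM2l ?dR ?bnd.
rewrite (le_trans (ler_normD _ _))// lerD//.
  rewrite (le_trans (mx_norm_mul _ _))// ler_wpM2r// ler_wpM2l//.
  by apply: (HBd _) => //; exact: inb.
rewrite (le_trans (mx_norm_mul _ _))//.
have -> : m%:R * (2 * C) * (2 * (m%:R * (2 * C) * (2 * `|u0|))) * `|k| ^+ 2 =
  m%:R * (2 * C * `|k|) * (2 * (m%:R * (2 * C) * (2 * `|u0|) * `|k|)) by ring.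
by rewrite ler_pM ?mulr_ge0// ?ler_wpM2l ?dA ?dFG.
Qed.

End FlatSystem.

(** * The inverse function theorem *)

Section InverseFunction.
Context {R : realType} {n : nat}.

Lemma ball_segment m (c x v : 'rV[R]_m) (r t : R) :
  ball c r x -> ball c r (x + v) -> 0 <= t <= 1 -> ball c r (x + t *: v).
Proof.
rewrite -!ball_normE /= => xr vr /andP[t0 t1].
have -> : c - (x + t *: v) = (1 - t) *: (c - x) + t *: (c - (x + v)).
  by apply/matrixP => i j; rewrite !mxE; ring.
rewrite (le_lt_trans (ler_normD _ _))// !normrZ !ger0_norm ?subr_ge0//.
have [t01|t11] := ltP t 1; last first.
  have -> : t = 1 by apply: le_anti; rewrite t1 t11.
  by rewrite subrr mul0r add0r mul1r.
have : (1 - t) * `|c - x| < (1 - t) * r by rewrite ltr_pM2l// subr_gt0.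
have : t * `|c - (x + v)| <= t * r by rewrite ler_wpM2l// ltW.
nra.
Qed.

Lemma mulmxr_continuous p q k (T : 'M[R]_(p, q)) : continuous (fun A : 'M[R]_(k, p) => A *m T).
Proof.
pose L : {linear 'M[R]_(k, p) -> 'M[R]_(k, q)} := mulmxr T.
apply: (@bounded_linear_continuous _ _ _ L (p%:R * `|T|)) => A /=.
by rewrite (le_trans (mx_norm_mul _ _))// mulrAC.
Qed.

Lemma norm_le_small (a : R) (C : R) : (forall k : nat, a <= C / 2 ^+ k) -> a <= 0.
Proof.
move=> H; apply/ler_addgt0Pl => e e0; rewrite addr0.
have := @cvg_geometric R C 2^-1.
rewrite ger0_norm ?invr_ge0// invf_lt1// ltr1n => /(_ isT).
move=> /cvgrPdist_lt/(_ e e0)[N _ /(_ N (leqnn N))] /=.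
rewrite sub0r normrN exprVn => H1; rewrite (le_trans (H N))// (le_trans (ler_norm _))//.
exact: ltW.
Qed.

(** The contraction principle on an open ball. If the first step moves [x0] by [D], all iterates and
    their limit stay within [2 * D] of [x0], so [D < d / 4] keeps them inside. *)
Lemma contraction_solve (f : 'rV[R]_n -> 'rV[R]_n) (x0 z : 'rV[R]_n) (d : R) :
  (forall a b, ball x0 d a -> ball x0 d b -> `|f a - f b| <= 2^-1 * `|a - b|) ->
  0 < d -> `|z + f x0 - x0| < d / 4 ->
  exists l, ball x0 d l /\ l = z + f l.
Proof.
move=> fL d0; set D := `|z + f x0 - x0| => Dd.
pose u k := iter k (fun x => z + f x) x0.
have D0 : 0 <= D := normr_ge0 _.
have ux k : `|u k - x0| <= 2 * D.
  elim: k => [|k IH]; first by rewrite subrr normr0 mulr_ge0.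
  rewrite -[u k.+1]/(z + f (u k)).
  have -> : z + f (u k) - x0 = (f (u k) - f x0) + (z + f x0 - x0).
    by apply/matrixP => i j; rewrite !mxE; ring.
  rewrite (le_trans (ler_normD _ _))// mulr_natl mulr2n lerD//.
  have uk : ball x0 d (u k) by rewrite -ball_normE /= distrC (le_lt_trans IH)//; lra.
  rewrite (le_trans (fL _ _ uk (ballxx _ d0)))//; lra.
have ub k : ball x0 d (u k).
  by rewrite -ball_normE /= distrC (le_lt_trans (ux k))//; lra.
have uD k : `|u k.+1 - u k| <= D / 2 ^+ k.
  elim: k => [|k IH]; first by rewrite expr0 divr1.
  have -> : u k.+2 - u k.+1 = f (u k.+1) - f (u k).
    rewrite -[u k.+2]/(z + f (u k.+1)) -[u k.+1 in X in _ - X]/(z + f (u k)).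
    by rewrite opprD addrACA subrr add0r.
  rewrite (le_trans (fL _ _ (ub _) (ub _)))// exprS invfM mulrCA.
  by rewrite ler_wpM2l.
have [l lP] := geometric_limit uD.
have bl : ball x0 d l.
  have := lP 0%N; rewrite expr0 divr1 -ball_normE /= => H.
  by rewrite (le_lt_trans H)//; lra.
exists l; split=> //; apply/eqP; rewrite -subr_eq0 -normr_le0.
apply: (@norm_le_small _ (4 * D)) => k.
have -> : l - (z + f l) = - (u k.+1 - l) + (f (u k) - f l).
  rewrite -[u k.+1]/(z + f (u k)).
  by apply/matrixP => i j; rewrite !mxE; ring.
rewrite (le_trans (ler_normD _ _))// normrN.
have H1 := lP k.+1; have H2 := fL _ _ (ub k) bl; have H3 := lP k.
have -> : 4 * D / 2 ^+ k = 2 * (2 * D / 2 ^+ k) by ring.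
have E : 2 * D / 2 ^+ k.+1 = 2^-1 * (2 * D / 2 ^+ k) by rewrite exprS invfM; ring.
rewrite E in H1; have H4 : 0 <= 2 * D / 2 ^+ k by apply: le_trans H3.
lra.
Qed.

(** Newton's map with frozen derivative, [x - y x *m T], contracts by 1/2 near [x0], which gives
    both solvability and a Lipschitz inverse. The derivative matrix [th] is a datum, as
    [affine_development] supplies it. *)
Lemma inverse_function (U : set 'rV[R]_n) (y : 'rV[R]_n -> 'rV[R]_n)
    (th : 'rV[R]_n -> 'M[R]_n) (x0 : 'rV[R]_n) :
  open U -> U x0 -> smooth_on U th -> th x0 \in unitmx ->
  (forall x, U x -> differentiable y x /\ forall v, 'D_v y x = v *m th x) ->
  exists W psi, [/\ open W, W `<=` U, W x0, open (y @` W) &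
    [/\ forall x, W x -> psi (y x) = x,
        forall x, W x -> th x \in unitmx & smooth_on (y @` W) psi]].
Proof.
move=> oU Ux0 JC uJ Hy; pose T := invmx (th x0).
have cdet : {for x0, continuous (fun x => \det (th x))}.
  have detS : smooth_on U (fun x => \det (th x)) by move=> k; apply: Ck_det.
  exact: smooth_on_cont detS Ux0.
have det0 : 0 < `|\det (th x0)| by rewrite normr_gt0 -unitfE -unitmxE.
have cdist : {for x0, continuous (fun x => `|1%:M - th x *m T|)}.
  apply: norm_continuous_at.
  have S1 : smooth_on U (fun x => 1%:M - th x *m T).
    move=> k; apply: Ck_add => //; first exact: Ck_cst.
    by apply: Ck_opp => //; apply: Ck_mulmx => //; exact: Ck_cst.
  exact: smooth_on_cont S1 Ux0.
(* [mx_norm_mul] multiplies this bound by [n%:R]; the result is at most 1/2. *)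
have N0 : 0 < (2 * (n%:R + 1))^-1 :> R by rewrite invr_gt0 mulr_gt0// ltr_wpDl.
have /cvgrPdist_lt/(_ _ det0)/nbhs_ballP[r1 /= r10 H1] := cdet.
have /cvgrPdist_lt/(_ _ N0)/nbhs_ballP[r2 /= r20 H2] := cdist.
have /nbhs_ballP[r3 /= r30 H3] : nbhs x0 U by apply: open_nbhs_nbhs.
pose d := Num.min r1 (Num.min r2 r3).
have d0 : 0 < d by rewrite !lt_min r10 r20.
have dU : ball x0 d `<=` U.
  by apply: subset_trans H3; apply: le_ball; rewrite !ge_min lexx !orbT.
have duJ x : ball x0 d x -> th x \in unitmx.
  move=> xd; rewrite unitmxE unitfE; apply/eqP => E.
  have /H1 : ball x0 r1 x by apply: le_ball xd; rewrite ge_min lexx.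
  by rewrite E subr0 ltxx.
have dJ x v : ball x0 d x -> `|v *m (1%:M - th x *m T)| <= 2^-1 * `|v|.
  move=> xd; have /H2 : ball x0 r2 x by apply: le_ball xd; rewrite !ge_min lexx orbT.
  rewrite mulmxV// subrr normr0 sub0r normrN normr_id => H.
  rewrite (le_trans (mx_norm_mul _ _))// mulrAC ler_wpM2r//.
  apply: (@le_trans _ _ (n%:R * (2 * (n%:R + 1))^-1)); first by rewrite ler_wpM2l// ltW.
  have n1 : 0 < n%:R + 1 :> R by rewrite ltr_wpDl.
  by rewrite invfM mulrCA ler_piMr// ler_pdivrMr// mul1r lerDl.
have dy x : ball x0 d x -> differentiable y x by move=> /dU/Hy[].
pose f x := x - y x *m T.
have fL a b : ball x0 d a -> ball x0 d b -> `|f a - f b| <= 2^-1 * `|a - b|.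
  move=> ad bd; rewrite -(subrK b a) [a - b + b]addrC.
  have abd : ball x0 d (b + (a - b)) by rewrite addrC subrK.
  have seg t : 0 <= t <= 1 -> ball x0 d (b + t *: (a - b)) by apply: ball_segment.
  have dyT x : ball x0 d x -> differentiable (fun x => y x *m T) x.
    move=> /dy xd; apply: (@differentiable_comp _ _ _ _ y (mulmxr T)) => //.
    by apply: linear_differentiable; exact: mulmxr_continuous.
  have -> : b + (a - b) - b = a - b by rewrite addrC addKr.
  apply: mean_value_segment => [|t /seg td|t /seg td]; first by rewrite mulr_ge0.
    by apply: differentiableB => //; exact: dyT.
  have -> : 'D_(a - b) f (b + t *: (a - b)) =
      (a - b) *m (1%:M - th (b + t *: (a - b)) *m T).
    rewrite -[f]/(id - (fun x => y x *m T)) deriveB; last 2 first.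
    - exact: derivable_id.
    - by apply: diff_derivable; exact: dyT.
    rewrite derive_id derive_mulmx//; last exact: dy.
    by rewrite derive_cst mulmx0 addr0 (Hy _ (dU _ td)).2 mulmxBr mulmx1 mulmxA.
  exact: dJ.
(* The identity is [f] plus [y *m T], and [f] contracts by 1/2, so the [y] part controls the
   distance. This yields injectivity at once and later the Lipschitz bound on [psi]. *)
have yL a b : ball x0 d a -> ball x0 d b -> `|a - b| <= 2 * n%:R * `|T| * `|y a - y b|.
  move=> ad bd; have := fL a b ad bd.
  have := mx_norm_mul (y a - y b) T; rewrite mulmxBl.
  have : `|a - b| <= `|f a - f b| + `|y a *m T - y b *m T|.
    have {1}-> : a - b = (f a - f b) + (y a *m T - y b *m T).
      by apply/matrixP => i j; rewrite !mxE; ring.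
    exact: ler_normD.
  nra.
have yinj a b : ball x0 d a -> ball x0 d b -> y a = y b -> a = b.
  move=> ad bd ab; apply/eqP; rewrite -subr_eq0 -normr_le0.
  by rewrite (le_trans (yL a b ad bd))// ab subrr normr0 mulr0.
(* The values [z] for which the map sending [x] to [z *m T + f x] moves [x0] by less than [d / 4]; a
   fixed point of this map is a preimage of [z]. *)
pose Z := [set z | `|z *m T - y x0 *m T| < d / 4].
have oZ : open Z.
  have -> : Z = (fun z => z *m T) @^-1` (ball (y x0 *m T) (d / 4)).
    by apply/seteqP; split=> z; rewrite /Z /= -ball_normE /= distrC.
  apply: open_comp => [z _|]; first exact: mulmxr_continuous.
  exact: ball_open.
have surj z : Z z -> exists2 x, ball x0 d x & y x = z.
  move=> Zz; have := @contraction_solve f x0 (z *m T) d fL d0.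
  have -> : z *m T + f x0 - x0 = z *m T - y x0 *m T.
    by rewrite /f; apply/matrixP => i j; rewrite !mxE; ring.
  move=> /(_ Zz)[l [ld E]]; exists l => //.
  have : y l *m T = z *m T.
    have : l + y l *m T - l = z *m T + f l + y l *m T - l by rewrite -E.
    rewrite addrC addKr => ->; rewrite /f.
    by apply/matrixP => i j; rewrite !mxE; ring.
  by move=> /(congr1 (mulmx^~ (th x0))); rewrite -!mulmxA mulVmx// !mulmx1.
pose W := [set x | ball x0 d x /\ Z (y x)].
have oW : open W.
  rewrite openE => x [xd Zx]; apply: filterI.
    by apply: open_nbhs_nbhs; split=> //; exact: ball_open.
  have cy : {for x, continuous y} by apply: differentiable_continuous; exact: dy.
  by apply: cy; apply: open_nbhs_nbhs.
have yW : y @` W = Z.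
  apply/seteqP; split=> [_ [x [_ Zx] <-]//|z Zz].
  by have [x xd yx] := surj z Zz; exists x => //; split=> //; rewrite yx.
pose psi z := xget x0 [set x | ball x0 d x /\ y x = z].
have psiP z : Z z -> ball x0 d (psi z) /\ y (psi z) = z.
  move=> /surj[x xd yx].
  exact: (@xgetPex _ x0 [set x | ball x0 d x /\ y x = z] (ex_intro _ x (conj xd yx))).
have psiK x : W x -> psi (y x) = x.
  by move=> [xd Zx]; have [pd py] := psiP _ Zx; exact: yinj.
have dpsi z : Z z -> differentiable psi z /\ forall v, 'D_v psi z = v *m invmx (th (psi z)).
  move=> Zz; have [xd yx] := psiP z Zz.
  set x := psi z in xd yx *.
  pose L : {linear 'rV[R]_n -> 'rV[R]_n} := mulmxr (invmx (th x)).
  suff [dL EL] : differentiable psi z /\ 'd psi z = L :> (_ -> _).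
    by split=> // v; rewrite deriveE// EL.
  apply: diff_remainderP; first exact: mulmxr_continuous.
  move=> e e0.
  pose C := 2 * n%:R * `|T|.
  have C0 : 0 <= C by rewrite !mulr_ge0.
  pose K := n%:R * `|invmx (th x)| * C.
  have K0 : 0 <= K by rewrite !mulr_ge0.
  have e1 : 0 < e / (K + 1) by rewrite divr_gt0// ltr_wpDl.
  have /nbhs_ballP[r /= r0 Hr] := diff_remainder (dy x xd) e1.
  have nZ : nbhs z Z by apply: open_nbhs_nbhs.
  have rC : 0 < r / (C + 1) by rewrite divr_gt0// ltr_wpDl.
  have nB : nbhs z (ball z (r / (C + 1))).
    by apply: open_nbhs_nbhs; split; [exact: ball_open|exact: ballxx].
  apply: filterS2 nZ nB => z' Zz' z'r.
  have [ad ya] := psiP z' Zz'; rewrite -/x.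
  set a := psi z' in ad ya *.
  have aL : `|a - x| <= C * `|z' - z| by rewrite -ya -yx; exact: yL.
  have : ball x r a.
    rewrite -ball_normE /= distrC (le_lt_trans aL)//.
    move: z'r; rewrite -ball_normE /= distrC ltr_pdivlMr ?ltr_wpDl// => H.
    by rewrite (le_lt_trans _ H)// mulrC ler_wpM2l// lerDl.
  have dE v : 'd y x v = v *m th x.
    by rewrite -deriveE; [exact: (Hy _ (dU _ xd)).2|exact: dy].
  move=> /Hr; rewrite dE ya yx => H.
  have -> : a - x - L (z' - z) = - ((z' - z - (a - x) *m th x) *m invmx (th x)).
    by rewrite /= [in RHS]mulmxBl -[in RHS]mulmxA (mulmxV (duJ x xd)) mulmx1 opprB.
  rewrite normrN (le_trans (mx_norm_mul _ _))//.
  apply: (@le_trans _ _ (n%:R * (e / (K + 1) * (C * `|z' - z|)) * `|invmx (th x)|)).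
    rewrite ler_wpM2r// ler_wpM2l// (le_trans H)// ler_wpM2l// ltW//.
  have -> : n%:R * (e / (K + 1) * (C * `|z' - z|)) * `|invmx (th x)| =
     e / (K + 1) * K * `|z' - z| by rewrite /K; ring.
  apply: ler_wpM2r => //; rewrite mulrAC ler_pdivrMr ?ltr_wpDl//.
  by apply: ler_wpM2l; [exact: ltW|rewrite lerDl].
exists W, psi; rewrite yW; split=> //.
- by move=> x [/dU].
- split; first exact: ballxx.
  by rewrite /Z /= subrr normr0 divr_gt0.
split=> // [x [/duJ]//|k].
(* Bootstrapping: the derivative of [psi] is a smooth function of [psi], so each order of
   differentiability gives the next. *)
elim: k => [z Zz|k IH]; first exact: differentiable_continuous (dpsi z Zz).1.
split=> [z /dpsi[]//|v].
apply: (@Ck_ext _ _ _ k Z (fun z => v *m invmx (th (psi z)))) => //.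
  by move=> z; rewrite inE => /dpsi[_ ->].
apply: Ck_mulmx => //; first exact: Ck_cst.
apply: Ck_invmx => //; first by move=> z /psiP[/duJ].
apply: (@Ck_comp _ _ _ k n n Z U psi (fun x => th x)) => //.
by move=> z /psiP[/dU].
Qed.

End InverseFunction.

(** * Bump functions *)

Section FlatExp.
Context {R : realType}.

(** From [s / k <= expR (s / k)] raised to the power [k]; exponent 0 is treated apart because of the
    division. *)
Lemma expr_expRN (k : nat) (s : R) : 0 <= s -> s ^+ k * expR (- s) <= k%:R ^+ k.
Proof.
case: k => [|k] s0; first by rewrite !expr0 mul1r expR_le1 oppr_le0.
have k0 : 0 < k.+1%:R :> R by rewrite ltr0n.
have H : (s / k.+1%:R) ^+ k.+1 <= expR s.
  have -> : expR s = expR (s / k.+1%:R) ^+ k.+1.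
    by rewrite -expRM_natl mulrCA divff ?gt_eqF// mulr1.
  apply: lerXn2r; rewrite ?nnegrE ?divr_ge0// ?expR_ge0//.
  by rewrite (le_trans _ (expR_ge1Dx _))// lerDr.
rewrite expRN ler_pdivrMr ?expR_gt0//.
by move: H; rewrite expr_div_n ler_pdivrMr ?exprn_gt0// mulrC.
Qed.

Lemma horner_expRN_bounded (p : {poly R}) : exists C : R, forall s : R, 0 <= s ->
  `|p.[s]| * expR (- s) <= C.
Proof.
exists (\sum_(i < size p) `|p`_i| * i%:R ^+ i) => s s0.
rewrite horner_coef (le_trans (ler_wpM2r (expR_ge0 _) (ler_norm_sum _ _ _)))//.
rewrite mulr_suml; apply: ler_sum => i _.
by rewrite normrM -mulrA ler_wpM2l// ger0_norm ?exprn_ge0// expr_expRN.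
Qed.

(* The functions t |-> p(1/t) exp(-1/t), extended by 0 to t <= 0, are closed
   under differentiation. *)
Definition flat_exp (p : {poly R}) (t : R) : R :=
  if 0 < t then p.[t^-1] * expR (- t^-1) else 0.

(** The polynomial [p * 'X^2] at 1/t carries the factor 1/t^2, so its boundedness against the
    exponential is exactly this bound. It yields derivative 0 at the origin. *)
Lemma flat_exp_quadratic (p : {poly R}) : exists C : R, forall t : R, `|flat_exp p t| <= C * `|t| ^+ 2.
Proof.
have [C HC] := horner_expRN_bounded (p * 'X^2).
exists C => t; rewrite /flat_exp; case: ifPn => t0; last first.
  rewrite normr0 mulr_ge0// ?exprn_ge0//.
  by rewrite (le_trans _ (HC 0 (lexx _)))// mulr_ge0// expR_ge0.
have := HC t^-1; rewrite invr_ge0 => /(_ (ltW t0)).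
have t2 : 0 <= t^-1 ^+ 2 by rewrite exprn_ge0// invr_ge0 ltW.
have -> : `|(p * 'X^2).[t^-1]| = `|p.[t^-1]| * t^-1 ^+ 2.
  by rewrite hornerM hornerXn normrM (ger0_norm t2).
have -> : `|p.[t^-1] * expR (- t^-1)| = `|p.[t^-1]| * expR (- t^-1).
  by rewrite normrM (ger0_norm (expR_ge0 _)).
move=> H; rewrite (gtr0_norm t0) -ler_pdivrMr ?exprn_gt0// -exprVn.
by rewrite mulrAC.
Qed.

(** The derivative of 1/t is -1/t^2, whence the factor ['X^2]; the exponential then contributes [p],
    and the polynomial contributes its derivative with a minus sign. *)
Lemma derive_flat_exp (p : {poly R}) (t : R) :
  is_derive t 1 (flat_exp p) (flat_exp ('X^2 * (p - p^`())) t).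
Proof.
have [t0|t0|t0] := ltrgt0P t.
- have ti : is_derive t 1 (fun s : R => s^-1) (- t^-1 ^+ 2).
    have tn : (id : R -> R) t != 0 by rewrite gt_eqF.
    have d := derivableV tn (@derivable_id R R t 1).
    split; first exact: d.
    by rewrite (deriveV tn (@derivable_id R R t 1)) derive_id /= -exprVn [LHS]mulr1.
  have d1 : is_derive t 1 (fun s : R => p.[s^-1]) (- t^-1 ^+ 2 * p^`().[t^-1]).
    have := @is_derive1_comp R (horner p) (fun s => s^-1) t _ _ (is_derive_poly p t^-1) ti.
    by rewrite mulrC.
  have d2 : is_derive t 1 (fun s : R => expR (- s^-1)) (t^-1 ^+ 2 * expR (- t^-1)).
    have tN : is_derive t 1 (fun s : R => - s^-1) (t^-1 ^+ 2).
      by rewrite -[X in is_derive _ _ _ X]opprK; exact: is_deriveN.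
    have := @is_derive1_comp R expR (fun s => - s^-1) t _ _ (is_derive_expR _) tN.
    by rewrite mulrC.
  have d3 := is_deriveM d1 d2.
  apply: (@near_eq_is_derive _ _ _ ((fun s : R => p.[s^-1]) * (fun s : R => expR (- s^-1)))).
    near=> s; have s0 : 0 < s by near: s; exact: lt_nbhsr.
    by rewrite /flat_exp s0.
  have -> : flat_exp ('X^2 * (p - p^`())) t =
     p.[t^-1] *: (t^-1 ^+ 2 * expR (- t^-1)) + expR (- t^-1) *: (- t^-1 ^+ 2 * p^`().[t^-1]).
    rewrite /flat_exp t0 !hornerE.
    set a := p.[_]; set b := p^`().[_]; set c := expR _; rewrite -[RHS]/(a * _ + c * _).
    by rewrite expr2; ring.
  exact: d3.
- have -> : flat_exp ('X^2 * (p - p^`())) t = 0 by rewrite /flat_exp ltNge (ltW t0).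
  apply: (@near_eq_is_derive R R R (cst 0) (flat_exp p)).
  near=> s; have s0 : s < 0 by near: s; exact: lt_nbhsl.
  by rewrite /flat_exp ltNge (ltW s0).
- rewrite t0; have -> : flat_exp ('X^2 * (p - p^`())) 0 = 0 by rewrite /flat_exp ltxx.
  have [C HC] := flat_exp_quadratic p.
  have l0 : linear (fun _ : R => 0 : R) by move=> a x y; rewrite scaler0 addr0.
  pose L : {linear R -> R} := HB.pack (fun _ : R => 0 : R) (GRing.isLinear.Build _ _ _ _ _ l0).
  have cL : continuous L by move=> x; exact: cvg_cst.
  have f0 : flat_exp p 0 = 0 by rewrite /flat_exp ltxx.
  have [|df Ef] := @quadratic_remainder R R R (flat_exp p) 0 L C cL.
    by near=> y; rewrite f0 !subr0 HC.
  by split; [exact: diff_derivable|rewrite deriveE// Ef].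
Unshelve. all: by end_near. Qed.

Lemma Ck_flat_exp k (p : {poly R}) : Ck k [set: R] (flat_exp p).
Proof.
elim: k p => [|k IH] p.
  move=> x _; apply: differentiable_continuous; apply/derivable1_diffP.
  by have [] := derive_flat_exp p x.
have df x : differentiable (flat_exp p) x.
  by apply/derivable1_diffP; have [] := derive_flat_exp p x.
split=> [x _|v]; first exact: df.
have := Ck_scale v openT (IH ('X^2 * (p - p^`()))); apply: Ck_ext; first exact: openT.
move=> x _; rewrite deriveE// -[v in RHS]mulr1 [X in 'd _ _ X](_ : _ = v *: (1 : R))//.
by rewrite linearZ /= -deriveE//; have [_ ->] := derive_flat_exp p x.
Qed.

End FlatExp.

Section Bump.
Context {R : realType}.

Lemma Ck_comp_real k (V : normedModType R) (U : set V) (f : V -> R) (g : R -> R) :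
  open U -> Ck k U f -> Ck k setT g -> Ck k U (g \o f).
Proof.
move=> oU; elim: k g => [|k IH] g /= => [cf cg x Ux|[df Df] [dg Dg]].
  by apply: continuous_comp; [exact: cf|exact: cg].
split=> [x Ux|v]; first by apply: differentiable_comp; [exact: df|exact: dg].
apply: (@Ck_ext _ _ _ k U (fun x => 'D_v f x * 'D_1 g (f x))) => //.
  move=> x; rewrite inE => Ux.
  have dgf : differentiable (g \o f) x.
    by apply: differentiable_comp; [exact: df|exact: dg].
  rewrite [RHS]deriveE// diff_comp; [|exact: df|exact: dg].
  rewrite /= -(deriveE _ (df x Ux)) -[X in 'd g _ X]mulr1.
  by rewrite -[X in 'd g _ X]/('D_v f x *: (1 : R)) linearZ /= -deriveE//; exact: dg.
by apply: Ck_mul => //; apply: (IH (fun x => 'D_1 g x)) => //; exact: CkW.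
Qed.

(** The usual smooth transition from 0 to 1: [t] and [1 - t] are never both nonpositive, so the
    denominator is positive. *)
Definition smooth_step (t : R) : R := flat_exp 1 t / (flat_exp 1 t + flat_exp 1 (1 - t)).

Lemma flat_exp1_ge0 (t : R) : 0 <= flat_exp 1 t.
Proof. by rewrite /flat_exp; case: ifP => // _; rewrite hornerC mul1r expR_ge0. Qed.

Lemma flat_exp1_gt0 (t : R) : 0 < t -> 0 < flat_exp 1 t.
Proof. by rewrite /flat_exp => ->; rewrite hornerC mul1r expR_gt0. Qed.

Lemma smooth_step_den (t : R) : 0 < flat_exp 1 t + flat_exp 1 (1 - t).
Proof.
have [t0|t0] := ltP 0 t; first by rewrite ltr_pwDl ?flat_exp1_ge0 ?flat_exp1_gt0.
by rewrite ltr_wpDl ?flat_exp1_ge0// flat_exp1_gt0// subr_gt0 (le_lt_trans t0).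
Qed.

Lemma Ck_smooth_step k : Ck k setT smooth_step.
Proof.
have oT : open [set: R] := openT.
apply: Ck_mul => //; first exact: Ck_flat_exp.
apply: Ck_inv => //; first by move=> x _; rewrite gt_eqF// smooth_step_den.
apply: Ck_add => //; first exact: Ck_flat_exp.
apply: (@Ck_comp_real k R setT (fun t => 1 - t)) => //; last exact: Ck_flat_exp.
apply: Ck_add => //; first exact: Ck_cst.
apply: Ck_opp => //.
have cL : continuous (idfun : R -> R) by move=> x; exact: cvg_id.
exact: (Ck_lin k setT cL).
Qed.

Lemma smooth_step0 (t : R) : t <= 0 -> smooth_step t = 0.
Proof. by move=> t0; rewrite /smooth_step {1}/flat_exp ltNge t0 mul0r. Qed.

Lemma smooth_step1 (t : R) : 1 <= t -> smooth_step t = 1.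
Proof.
move=> t1; rewrite /smooth_step.
have -> : flat_exp 1 (1 - t) = 0 by rewrite /flat_exp ltNge subr_le0 t1.
by rewrite addr0 divff// gt_eqF// flat_exp1_gt0// (lt_le_trans _ t1).
Qed.

(** Balls of the maximum norm are cubes, so a product of one-variable steps, one for each
    coordinate, cuts off at the right places. *)
Lemma ex_bump n (x0 : 'rV[R]_n) (r : R) : 0 < r -> exists chi : 'rV[R]_n -> R,
  [/\ smooth_on setT chi, forall x, `|x - x0| < r / 2 -> chi x = 1 &
      forall x, r <= `|x - x0| -> chi x = 0].
Proof.
move=> r0; pose rho := r / 2; have rho0 : 0 < rho by rewrite divr_gt0.
have oT : open [set: 'rV[R]_n] := openT.
(* The function 2 - s^2 is at least 1 for |s| <= 1 and at most -2 for |s| >= 2, and the square,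
   unlike the absolute value, is smooth. *)
pose a i (x : 'rV[R]_n) : R := 2 - ((x 0 i - x0 0 i) / rho) ^+ 2.
exists (fun x => \prod_i smooth_step (a i x)); split=> [k|x xr|x xr].
- apply: Ck_prod => // i _.
  apply: (Ck_comp_real (f := a i) oT _ (Ck_smooth_step k)).
  apply: Ck_add => //; first exact: Ck_cst.
  apply: Ck_opp => //.
  have Cc : Ck k setT (fun x : 'rV[R]_n => x 0 i).
    have cL : continuous (idfun : 'rV[R]_n -> 'rV[R]_n) by move=> x; exact: cvg_id.
    exact: (Ck_entry 0 i oT (Ck_lin k setT cL)).
  have C1 : Ck k setT (fun x : 'rV[R]_n => (x 0 i - x0 0 i) / rho).
    apply: Ck_mul => //; last exact: Ck_cst.
    by apply: Ck_add => //; exact: Ck_cst.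
  exact: Ck_mul.
- apply: big1 => i _; apply: smooth_step1; rewrite /a.
  have : `|x 0 i - x0 0 i| < rho.
    by have := mx_entry_le (x - x0) 0 i; rewrite !mxE => /le_lt_trans; apply.
  rewrite -(ltr_pM2r (x := rho^-1)) ?invr_gt0// divff ?gt_eqF//.
  rewrite -[X in _ * X < _]gtr0_norm ?invr_gt0// -normrM => H.
  have : ((x 0 i - x0 0 i) / rho) ^+ 2 <= 1.
    by rewrite -real_normK ?num_real// expr_le1// ltW.
  lra.
- have [i Hi] : exists i, r <= `|x 0 i - x0 0 i|.
    apply: contrapT => H; move: xr; apply/negP; rewrite -ltNge.
    rewrite [ltLHS]/Num.Def.normr/= mx_normrE; apply: bigmax_lt => // -[j i] _ /=.
    by rewrite ord1 !mxE ltNge; apply/negP => ri; apply: H; exists i.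
  rewrite (bigD1 i)//= smooth_step0 ?mul0r// /a.
  have : 2 <= `|(x 0 i - x0 0 i) / rho|.
    by rewrite normrM [`|rho^-1|]gtr0_norm ?invr_gt0// ler_pdivlMr// /rho mulrC divfK.
  have := real_normK (num_real ((x 0 i - x0 0 i) / rho)) => <-.
  nra.
Qed.

End Bump.

(** * Charts and vector fields *)

Lemma closed_norm_le (R : realType) (V : normedModType R) (x0 : V) (r : R) :
  closed [set x | `|x - x0| <= r].
Proof.
have -> : [set x | `|x - x0| <= r] = (fun x => `|x - x0|) @^-1` [set t | t <= r] by [].
apply: preimage_closed; last exact: closed_le.
by move=> x _; apply: cvg_norm; apply: cvgB; [exact: cvg_id|exact: cvg_cst].
Qed.

Section Charts.
Context {R : realType} {n : nat}.

Section OneChart.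
Context {T : topologicalType} (c : chart R n T).

Lemma chart_invK p : chart_dom c p -> chart_inv c (c p) = p.
Proof. by move=> pc; apply: chart_funK; rewrite inE. Qed.

Lemma chart_imgP p : chart_dom c p -> chart_img c (c p).
Proof. by move=> pc; exists p. Qed.

Lemma chart_inv_dom x : chart_img c x -> chart_dom c (chart_inv c x).
Proof. by move=> [p pc <-]; rewrite chart_invK. Qed.

Lemma chart_funV x : chart_img c x -> c (chart_inv c x) = x.
Proof. by move=> [p pc <-]; rewrite chart_invK. Qed.

Lemma chart_continuous p : chart_dom c p -> {for p, continuous c}.
Proof.
move=> pc; have := chart_fun_continuous (c := c).
by rewrite continuous_open_subspace; [apply; rewrite inE|exact: chart_dom_open].
Qed.

Lemma chart_inv_continuous_at x : chart_img c x -> {for x, continuous (chart_inv c)}.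
Proof.
move=> xc; have := chart_inv_continuous (c := c).
by rewrite continuous_open_subspace; [apply; rewrite inE|exact: chart_img_open].
Qed.

Lemma chart_image_open (O : set T) : open O -> open (c @` (chart_dom c `&` O)).
Proof.
move=> oO; rewrite openE => _ [p [pc Op] <-].
have pi := chart_imgP pc.
have n1 : nbhs (c p) (chart_img c) by apply: open_nbhs_nbhs; split=> //; exact: chart_img_open.
have n2 : nbhs (c p) (chart_inv c @^-1` O).
  apply: (chart_inv_continuous_at pi); rewrite chart_invK//.
  exact: open_nbhs_nbhs.
apply: filterS2 n1 n2 => x xi Ox; exists (chart_inv c x); last exact: chart_funV.
by split=> //; exact: chart_inv_dom.
Qed.

Lemma chart_imageP (O : set T) x : (c @` (chart_dom c `&` O)) x <->
  chart_img c x /\ O (chart_inv c x).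
Proof.
split=> [[p [pc Op] <-]|[xi Ox]]; first by rewrite chart_invK//; split=> //; exact: chart_imgP.
by exists (chart_inv c x); [split=> //; exact: chart_inv_dom|exact: chart_funV].
Qed.

End OneChart.

Context {T : topologicalType}.
Implicit Types (a b c d : chart R n T).

Lemma compatible_sym a b : compatible a b -> compatible b a.
Proof. by rewrite /compatible setIC => -[]; rewrite setIC. Qed.

Definition transition_jacobian a b (p : T) : 'M[R]_n := 'J (b \o chart_inv a) (a p).

Lemma transition_diff a b p : compatible a b -> chart_dom a p -> chart_dom b p ->
  differentiable (b \o chart_inv a) (a p).
Proof. by move=> [/smooth_on_diff ab _] pa pb; apply: ab; exists p. Qed.

Lemma transition_near a b c p : chart_dom a p -> chart_dom b p ->
  \forall x \near a p, (c \o chart_inv b) ((b \o chart_inv a) x) = (c \o chart_inv a) x.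
Proof.
move=> pa pb.
have oO : open (a @` (chart_dom a `&` chart_dom b)) by apply: chart_image_open; exact: chart_dom_open.
apply: (open_in_nearW oO); last by rewrite inE; exists p.
by move=> x; rewrite inE => /chart_imageP[_ xb] /=; rewrite chart_invK.
Qed.

Lemma transition_jacobian_comp a b c p : compatible a b -> compatible b c ->
  chart_dom a p -> chart_dom b p -> chart_dom c p ->
  transition_jacobian a b p *m transition_jacobian b c p = transition_jacobian a c p.
Proof.
move=> ab bc pa pb pc.
have dab := transition_diff ab pa pb.
have dbc := transition_diff bc pb pc.
have E : (b \o chart_inv a) (a p) = b p by rewrite /= chart_invK.
have dbc' : differentiable (c \o chart_inv b) ((b \o chart_inv a) (a p)) by rewrite E.
have := jacobian_comp dab dbc'; rewrite E => H.
apply: etrans (esym H) _; apply: near_eq_jacobian; first exact: transition_near.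
exact: differentiable_comp.
Qed.

Lemma transition_jacobian_id a p : chart_dom a p -> transition_jacobian a a p = 1%:M.
Proof.
move=> pa; rewrite -(jacobian_id (a p)); apply: esym; apply: near_eq_jacobian; last by [].
have oO : open (chart_img a) by exact: chart_img_open.
apply: (open_in_nearW oO); last by rewrite inE; exact: chart_imgP.
by move=> x; rewrite inE => xi /=; rewrite chart_funV.
Qed.

Lemma transition_jacobianV a b p : compatible a b -> chart_dom a p -> chart_dom b p ->
  transition_jacobian a b p *m transition_jacobian b a p = 1%:M.
Proof.
by move=> ab pa pb; rewrite transition_jacobian_comp ?transition_jacobian_id//; exact: compatible_sym.
Qed.

End Charts.

(** * Local and global fields on a manifold *)

Section Fields.
Context {R : realType} {n : nat} (M : manifold R n).
Implicit Types (c d : chart R n M) (p q : M) (X Y : M -> 'rV[R]_n).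

Lemma atlas_smooth_chart c : atlas c -> smooth_chart c.
Proof. by move=> ac d; apply: atlas_compatible. Qed.

Lemma smooth_chart_at c p : smooth_chart c -> compatible c (chart_at p).
Proof. by apply; exact: chart_at_atlas. Qed.

Lemma coord_frameE c p : coord_frame c p = transition_jacobian c (chart_at p) p.
Proof. by []. Qed.

Lemma coordsE c p : coords c p = transition_jacobian (chart_at p) c p.
Proof. by []. Qed.

Lemma coord_frameK c p : smooth_chart c -> chart_dom c p -> coord_frame c p *m coords c p = 1%:M.
Proof.
move=> cS pc; rewrite coord_frameE coordsE transition_jacobianV//; first exact: smooth_chart_at.
exact: chart_at_dom.
Qed.

Lemma coordsK c p : smooth_chart c -> chart_dom c p -> coords c p *m coord_frame c p = 1%:M.
Proof. by move=> cS pc; apply: mulmx1C; exact: coord_frameK. Qed.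

Lemma coords_change c d p : smooth_chart c -> atlas d -> chart_dom c p -> chart_dom d p ->
  coords c p *m transition_jacobian c d p = coords d p.
Proof.
move=> cS ad pc pd; rewrite !coordsE transition_jacobian_comp//.
- exact/compatible_sym/smooth_chart_at.
- exact: cS.
- exact: chart_at_dom.
Qed.

Lemma coord_frame_change c d p : smooth_chart c -> atlas d -> chart_dom c p -> chart_dom d p ->
  coord_frame c p *m coords d p = transition_jacobian c d p.
Proof. by move=> cS ad pc pd; rewrite -(coords_change cS)// mulmxA coord_frameK// mul1mx. Qed.

Lemma coords_chart_at p : coords (chart_at p) p = 1%:M.
Proof. by rewrite coordsE transition_jacobian_id//; exact: chart_at_dom. Qed.

Section Extension.
Context (c : chart R n M) (ac : atlas c) (x0 : 'rV[R]_n) (r : R) (chi : 'rV[R]_n -> R).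
Hypotheses (r0 : 0 < r) (rc : [set x | `|x - x0| <= r] `<=` chart_img c)
  (chiS : smooth_on setT chi) (chi0 : forall x, r <= `|x - x0| -> chi x = 0).

(** Makes local data global, since [nabla] takes global fields. Outside the chart domain the value
    of [c] means nothing, hence the case distinction. *)
Definition extend {W : lmodType R} (F : M -> W) (q : M) : W :=
  if `[< chart_dom c q >] then chi (c q) *: F q else 0.

Lemma extend_in {W : lmodType R} (F : M -> W) q : chart_dom c q ->
  extend F q = chi (c q) *: F q.
Proof. by move=> qc; rewrite /extend asboolT. Qed.

(** The image of a compact ball is compact, hence closed since the manifold is Hausdorff. In a space
    that is not Hausdorff, extension by zero could fail to be continuous. *)
Lemma support_closed : closed (chart_inv c @` [set x | `|x - x0| <= r]).
Proof.
apply: compact_closed; first exact: manifold_hausdorff.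
apply: continuous_compact.
  apply: continuous_in_subspaceT => x; rewrite inE => /rc; exact: chart_inv_continuous_at.
apply: bounded_closed_compact.
  exists (`|x0| + r); split; first exact: num_real.
  move=> y ry x /= xr; rewrite (le_trans _ (ltW ry))// -(subrK x0 x).
  by rewrite (le_trans (ler_normD _ _))// addrC lerD2l.
exact: closed_norm_le.
Qed.

Lemma extend_out {W : lmodType R} (F : M -> W) q :
  ~ (chart_inv c @` [set x | `|x - x0| <= r]) q -> extend F q = 0.
Proof.
move=> qK; rewrite /extend; case: asboolP => // qc.
rewrite chi0 ?scale0r// leNgt; apply/negP => H; apply: qK.
by exists (c q) => /=; [exact: ltW|exact: chart_invK].
Qed.

(** Two open sets cover the image of [d]: the overlap with [c], and the complement of the closed
    support, where [F] is 0. *)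
Lemma smooth_extension {W : normedModType R} d (F : M -> W) : atlas d ->
  smooth_on (d @` (chart_dom d `&` chart_dom c)) (F \o chart_inv d) ->
  (forall q, ~ (chart_inv c @` [set x | `|x - x0| <= r]) q -> F q = 0) ->
  smooth_on (chart_img d) (F \o chart_inv d).
Proof.
move=> ad FS F0 k; apply: Ck_local => x xd.
have qd := chart_inv_dom xd.
have [qc|qc] := pselect (chart_dom c (chart_inv d x)).
  exists (d @` (chart_dom d `&` chart_dom c)); split; last exact: FS.
    by apply: chart_image_open; exact: chart_dom_open.
  exact/chart_imageP.
pose K := ~` (chart_inv c @` [set x | `|x - x0| <= r]).
have oK : open K by apply: closed_openC; exact: support_closed.
have oO : open (d @` (chart_dom d `&` K)) by exact: chart_image_open.
exists (d @` (chart_dom d `&` K)); split=> //.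
  apply/chart_imageP; split=> // -[y /rc yc Ey]; apply: qc; rewrite -Ey.
  exact: chart_inv_dom.
apply: (Ck_ext oO _ (Ck_cst k _ (0 : W))) => y; rewrite inE => /chart_imageP[_ Ky] /=.
by rewrite F0.
Qed.

Lemma overlap_comp d (m1 m2 : nat) (F : M -> 'M[R]_(m1, m2)) (G : 'rV[R]_n -> 'M[R]_(m1, m2)) : atlas d ->
  smooth_on (c @` (chart_dom c `&` chart_dom d)) G ->
  (forall q, chart_dom c q -> chart_dom d q -> F q = G (c q)) ->
  smooth_on (d @` (chart_dom d `&` chart_dom c)) (F \o chart_inv d).
Proof.
move=> ad GS FG k.
have o1 : open (d @` (chart_dom d `&` chart_dom c)) by apply: chart_image_open; exact: chart_dom_open.
have o2 : open (c @` (chart_dom c `&` chart_dom d)) by apply: chart_image_open; exact: chart_dom_open.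
have [tS _] := atlas_compatible ad ac.
have mapO x : (d @` (chart_dom d `&` chart_dom c)) x ->
    (c @` (chart_dom c `&` chart_dom d)) ((c \o chart_inv d) x).
  move=> /chart_imageP[xd xc]; exists (chart_inv d x) => //; split=> //; exact: chart_inv_dom.
have := Ck_comp o1 o2 mapO (tS k) (GS k); apply: Ck_ext => // x.
rewrite inE => /chart_imageP[xd xc] /=; rewrite FG//; exact: chart_inv_dom.
Qed.

Lemma smooth_function_extend (f : 'rV[R]_n -> R) : smooth_on (chart_img c) f ->
  smooth_function (extend (fun q => f (c q) : R^o)).
Proof.
move=> fS d ad.
(* The scalar is viewed as a 1 by 1 matrix, since [overlap_comp] is stated for matrices. *)
have S1 : smooth_on (d @` (chart_dom d `&` chart_dom c))
    ((fun q => (extend (fun q => f (c q) : R^o) q)%:M : 'M[R]_1) \o chart_inv d).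
  apply: (@overlap_comp d 1 1 _ (fun x => (chi x * f x)%:M)) => // [k|q qc qd].
    have oO : open (c @` (chart_dom c `&` chart_dom d)) by apply: chart_image_open; exact: chart_dom_open.
    apply: Ck_mx => // i j; rewrite !ord1.
    apply: (@Ck_ext _ _ _ k _ (fun x => chi x * f x)) => //.
      by move=> x _; rewrite mxE.
    apply: Ck_mul => //; first by apply: Ck_sub (chiS k).
    by apply: Ck_sub (fS k) => x /chart_imageP[].
  by rewrite extend_in.
have S2 : smooth_on (chart_img d)
    ((fun q => (extend (fun q => f (c q) : R^o) q)%:M : 'M[R]_1) \o chart_inv d).
  apply: smooth_extension => // q /extend_out E; by rewrite E; apply/matrixP => i j; rewrite !mxE mul0rn.
move=> k; have oO : open (chart_img d) by exact: chart_img_open.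
have := Ck_entry 0 0 oO (S2 k); apply: Ck_ext => // x _; by rewrite /= mxE.
Qed.

Lemma smooth_field_extend (f : 'rV[R]_n -> 'rV[R]_n) : smooth_on (chart_img c) f ->
  smooth_vector_field (extend (fun q => f (c q) *m coord_frame c q)).
Proof.
move=> fS d ad.
pose F q := extend (fun q => f (c q) *m coord_frame c q) q *m coords d q.
have S1 : smooth_on (d @` (chart_dom d `&` chart_dom c)) (F \o chart_inv d).
  apply: (@overlap_comp d 1 n _ (fun x => chi x *: (f x *m 'J (d \o chart_inv c) x))) => // [k|q qc qd].
    have oO : open (c @` (chart_dom c `&` chart_dom d)) by apply: chart_image_open; exact: chart_dom_open.
    have [tS _] := atlas_compatible ac ad.
    apply: Ck_scalemx => //; first by apply: Ck_sub (chiS k).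
    apply: Ck_mulmx => //; last by apply: Ck_jacobian.
    by apply: Ck_sub (fS k) => x /chart_imageP[].
  rewrite /F extend_in// -scalemxAl -mulmxA coord_frame_change//.
  exact: atlas_smooth_chart.
by apply: (@smooth_extension _ d F) => // q qK; rewrite /F extend_out// mul0mx.
Qed.

Lemma local_field_extend (f : 'rV[R]_n -> 'rV[R]_n) x : chart_img c x ->
  local_field c (extend (fun q => f (c q) *m coord_frame c q)) x = chi x *: f x.
Proof.
move=> xc; have qc := chart_inv_dom xc.
rewrite /local_field extend_in// -scalemxAl -mulmxA coord_frameK ?mulmx1 ?chart_funV//.
exact: atlas_smooth_chart.
Qed.

End Extension.
End Fields.

Lemma derive_compD (R : realType) (U V W : normedModType R) (f : U -> V) (g : V -> W) x v :
  differentiable f x -> differentiable g (f x) ->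
  'D_v (g \o f) x = 'D_('D_v f x) g (f x).
Proof.
move=> df dg; rewrite [LHS]deriveE; last exact: differentiable_comp.
rewrite diff_comp //=; have <- : 'D_v f x = 'd f x v by rewrite deriveE.
by rewrite (deriveE _ dg).
Qed.

Section FieldOperations.
Context {R : realType} {n : nat} (M : manifold R n).
Implicit Types (c d : chart R n M) (p q : M) (X Y Z : M -> 'rV[R]_n) (f : M -> R).

Lemma local_smooth c X : atlas c -> smooth_vector_field X -> smooth_on (chart_img c) (local_field c X).
Proof. by move=> ac XS; apply: XS. Qed.

Lemma local_function_smooth c f : atlas c -> smooth_function f ->
  smooth_on (chart_img c) ((f : M -> R) \o chart_inv c).
Proof. by move=> ac fS; apply: fS. Qed.

Lemma local_field_at c X p : chart_dom c p -> local_field c X (c p) = X p *m coords c p.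
Proof. by move=> pc; rewrite /local_field chart_invK. Qed.

Lemma smooth_field_lin f X Y : smooth_function f -> smooth_vector_field X ->
  smooth_vector_field Y -> smooth_vector_field (fun q => f q *: X q + Y q).
Proof.
move=> fS XS YS c ac k; have oi : open (chart_img c) by exact: chart_img_open.
have Cf : Ck k (chart_img c) ((f : M -> R) \o chart_inv c) by apply: local_function_smooth.
have := Ck_add oi (Ck_scalemx oi Cf (local_smooth ac XS k)) (local_smooth ac YS k).
by apply: Ck_ext => // x _; rewrite /= mulmxDl scalemxAl.
Qed.

Lemma smooth_field0 : smooth_vector_field (M := M) (fun=> 0).
Proof.
move=> c ac k; have oi : open (chart_img c) by exact: chart_img_open.
by apply: (Ck_ext oi _ (Ck_cst k _ 0)) => x _; rewrite /= mul0mx.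
Qed.

Lemma smooth_function_cst (a : R) : smooth_function (M := M) (fun=> a).
Proof. by move=> c ac k; exact: Ck_cst. Qed.

Lemma smooth_field_sum (I : Type) (s : seq I) (f : I -> M -> R) (X : I -> M -> 'rV[R]_n) :
  (forall i, smooth_function (f i)) -> (forall i, smooth_vector_field (X i)) ->
  smooth_vector_field (fun q => \sum_(i <- s) f i q *: X i q).
Proof.
move=> fS XS; elim: s => [|i s IH].
  have -> : (fun q => \sum_(i <- [::]) f i q *: X i q) = (fun=> 0).
    by apply/funext => q; rewrite big_nil.
  exact: smooth_field0.
have -> : (fun q => \sum_(i0 <- i :: s) f i0 q *: X i0 q) =
    (fun q => f i q *: X i q + \sum_(i0 <- s) f i0 q *: X i0 q).
  by apply/funext => q; rewrite big_cons.
exact: smooth_field_lin.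
Qed.

(** The definition uses the preferred chart of each point, which varies with the point; the chain
    rule carries it to one fixed chart. *)
Lemma directional_derivative_chart c p f X : atlas c -> chart_dom c p -> smooth_function f ->
  directional_derivative X f p =
  'D_(local_field c X (c p)) ((f : M -> R) \o chart_inv c) (c p).
Proof.
move=> ac pc fS; rewrite local_field_at//.
have pa := chart_at_dom p; have aa := chart_at_atlas p.
have dt : differentiable (c \o chart_inv (chart_at p)) (chart_at p p).
  by apply: transition_diff => //; exact: atlas_compatible.
have df : differentiable ((f : M -> R) \o chart_inv c) ((c \o chart_inv (chart_at p)) (chart_at p p)).
  rewrite /= chart_invK//; apply: (smooth_on_diff (local_function_smooth ac fS)).
  exact: chart_imgP.
have := derive_compD (X p) dt df; rewrite deriveEjacobian//.
have -> : (c \o chart_inv (chart_at p)) (chart_at p p) = c p by rewrite /= chart_invK.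
rewrite -/(coords c p) => <-; apply: near_eq_derive.
have oO : open (chart_at p @` (chart_dom (chart_at p) `&` chart_dom c)).
  by apply: chart_image_open; exact: chart_dom_open.
apply: (open_in_nearW oO); last by rewrite inE; exists p.
by move=> x; rewrite inE => /chart_imageP[_ xb] /=; rewrite chart_invK.
Qed.

End FieldOperations.

(** * Local form of a connection *)

Section LocalForm.
Context {R : realType} {n : nat} (M : manifold R n).
Context (nabla : (M -> 'rV[R]_n) -> (M -> 'rV[R]_n) -> M -> 'rV[R]_n).
Hypothesis nablaC : covariant_derivative nabla.
Implicit Types (X Y Z : M -> 'rV[R]_n).

Lemma nabla_smooth X Y : smooth_vector_field X -> smooth_vector_field Y ->
  smooth_vector_field (nabla X Y).
Proof. by have [H _ _] := nablaC; apply: H. Qed.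

(** The axiom combines additivity and homogeneity; at [f = 1] and zero fields it reads
    [a = a + a]. *)
Lemma nabla0l Y p : smooth_vector_field Y -> nabla (fun=> 0) Y p = 0.
Proof.
move=> YS; have [_ H _] := nablaC.
have := H (fun=> 1) (fun=> 0) (fun=> 0) Y (@smooth_function_cst R n M 1) (@smooth_field0 R n M) (@smooth_field0 R n M) YS p.
have -> : (fun q : M => 1 *: (0 : 'rV[R]_n) + 0) = (fun=> 0) by apply/funext => q; rewrite scaler0 addr0.
by rewrite scale1r => /eqP; rewrite -subr_eq0 opprD addNKr oppr_eq0 => /eqP.
Qed.

Lemma nabla0r X p : smooth_vector_field X -> nabla X (fun=> 0) p = 0.
Proof.
move=> XS; have [_ _ H] := nablaC.
have := H (fun=> 1) X (fun=> 0) (fun=> 0) (@smooth_function_cst R n M 1) XS (@smooth_field0 R n M) (@smooth_field0 R n M) p.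
have -> : (fun q : M => 1 *: (0 : 'rV[R]_n) + 0) = (fun=> 0) by apply/funext => q; rewrite scaler0 addr0.
by rewrite scale1r scaler0 add0r => /eqP; rewrite -subr_eq0 opprD addNKr oppr_eq0 => /eqP.
Qed.

Lemma nabla_suml (I : Type) (s : seq I) (f : I -> M -> R) (E : I -> M -> 'rV[R]_n) Y p :
  (forall i, smooth_function (f i)) -> (forall i, smooth_vector_field (E i)) ->
  smooth_vector_field Y ->
  nabla (fun q => \sum_(i <- s) f i q *: E i q) Y p = \sum_(i <- s) f i p *: nabla (E i) Y p.
Proof.
move=> fS ES YS; have [_ H _] := nablaC; elim: s => [|i s IH].
  have -> : (fun q => \sum_(i <- [::]) f i q *: E i q) = (fun=> 0).
    by apply/funext => q; rewrite big_nil.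
  by rewrite nabla0l// big_nil.
have -> : (fun q => \sum_(i0 <- i :: s) f i0 q *: E i0 q) =
    (fun q => f i q *: E i q + \sum_(i0 <- s) f i0 q *: E i0 q).
  by apply/funext => q; rewrite big_cons.
by rewrite H// ?big_cons ?IH//; exact: smooth_field_sum.
Qed.

Lemma nabla_sumr (I : Type) (s : seq I) (f : I -> M -> R) (E : I -> M -> 'rV[R]_n) X p :
  (forall i, smooth_function (f i)) -> (forall i, smooth_vector_field (E i)) ->
  smooth_vector_field X ->
  nabla X (fun q => \sum_(i <- s) f i q *: E i q) p =
  \sum_(i <- s) (directional_derivative X (f i) p *: E i p + f i p *: nabla X (E i) p).
Proof.
move=> fS ES XS; have [_ _ H] := nablaC; elim: s => [|i s IH].
  have -> : (fun q => \sum_(i <- [::]) f i q *: E i q) = (fun=> 0).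
    by apply/funext => q; rewrite big_nil.
  by rewrite nabla0r// big_nil.
have -> : (fun q => \sum_(i0 <- i :: s) f i0 q *: E i0 q) =
    (fun q => f i q *: E i q + \sum_(i0 <- s) f i0 q *: E i0 q).
  by apply/funext => q; rewrite big_cons.
by rewrite H// ?big_cons ?IH//; exact: smooth_field_sum.
Qed.

Section Bump.
Context (c : chart R n M) (ac : atlas c) (x0 : 'rV[R]_n) (r : R) (chi : 'rV[R]_n -> R).
Hypotheses (r0 : 0 < r) (rc : [set x | `|x - x0| <= r] `<=` chart_img c)
  (chiS : smooth_on setT chi) (chi0 : forall x, r <= `|x - x0| -> chi x = 0)
  (chi1 : forall x, `|x - x0| < r / 2 -> chi x = 1).

(** Where the bump is 1, its components in [c] are the constant [v]: a global stand-in for a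
    constant combination of coordinate fields. *)
Definition bump_field (v : 'rV[R]_n) : M -> 'rV[R]_n :=
  extend c chi (fun q => v *m coord_frame c q).

Lemma bump_field_smooth v : smooth_vector_field (bump_field v).
Proof.
apply: (smooth_field_extend ac rc chiS chi0 (f := fun=> v)) => k; exact: Ck_cst.
Qed.

Lemma bump_field_local v x : chart_img c x -> local_field c (bump_field v) x = chi x *: v.
Proof. exact: (local_field_extend ac chi (fun=> v)). Qed.

Local Notation W := (ball x0 (r / 2)).

Lemma bump_ball x : W x -> `|x - x0| < r / 2.
Proof. by rewrite -ball_normE /= distrC. Qed.

Lemma bump_ball_img x : W x -> chart_img c x.
Proof. by move=> /bump_ball xr; apply: rc => /=; rewrite (le_trans (ltW xr))// ler_pdivrMr// ler_pMr// ler1n. Qed.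

Lemma bump_ball1 x : W x -> chi x = 1.
Proof. by move=> /bump_ball; exact: chi1. Qed.

Definition bump_coord X (i : 'I_n) : M -> R :=
  extend c chi (fun q => local_field c X (c q) 0 i : R^o).

Lemma bump_coord_smooth X i : smooth_vector_field X -> smooth_function (bump_coord X i).
Proof.
move=> XS; apply: (smooth_function_extend ac rc chiS chi0 (f := fun x => local_field c X x 0 i)).
move=> k; have oi : open (chart_img c) by exact: chart_img_open.
exact: (Ck_entry 0 i oi (local_smooth ac XS k)).
Qed.

Definition bump_square : M -> R := extend c chi (fun q => chi (c q) : R^o).

Lemma bump_square_smooth : smooth_function bump_square.
Proof.
apply: (smooth_function_extend ac rc chiS chi0 (f := chi)) => k.
by apply: Ck_sub (chiS k).
Qed.

(* Multiplying by the square of the bump turns any field into a global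
   combination of the fields [bump_field]. *)
Lemma bump_decomposition X q :
  bump_square q *: X q + 0 = \sum_i bump_coord X i q *: bump_field (delta_mx 0 i) q.
Proof.
rewrite addr0 /bump_square /bump_coord /bump_field /extend; case: asboolP => qc; last first.
  by rewrite scale0r big1// => i _; rewrite scale0r.
rewrite local_field_at//.
have cS := atlas_smooth_chart ac.
have -> : X q = (X q *m coords c q) *m coord_frame c q by rewrite -mulmxA coordsK ?mulmx1.
move: (X q *m coords c q) => v; rewrite -mulmxA coord_frameK// mulmx1.
rewrite [X in _ *: (X *m _) = _]row_sum_delta mulmx_suml scaler_sumr; apply: eq_bigr => i _.
by rewrite -scalemxAl !scalerA; congr (_ *: _); rewrite -[LHS]/(chi (c q) * chi (c q) * _) -[RHS]/(chi (c q) * _ * chi (c q)) mulrAC.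
Qed.

(** Locality of [nabla]. Where the bump is 1, multiplying either argument by its square changes
    nothing, and [bump_decomposition] then reduces both arguments to the fixed fields
    [bump_field]. *)
Lemma nabla_decompose X Y x : smooth_vector_field X -> smooth_vector_field Y -> W x ->
  nabla X Y (chart_inv c x) = \sum_i local_field c X x 0 i *: \sum_j
    ('D_(delta_mx 0 i) (fun y => local_field c Y y 0 j : R) x *: bump_field (delta_mx 0 j) (chart_inv c x)
     + local_field c Y x 0 j *: nabla (bump_field (delta_mx 0 i)) (bump_field (delta_mx 0 j)) (chart_inv c x)).
Proof.
move=> XS YS Wx; set p := chart_inv c x.
have xi := bump_ball_img Wx.
have pc : chart_dom c p by exact: chart_inv_dom.
have cp : c p = x by exact: chart_funV.
have [_ Hl Hr] := nablaC.
have sq1 : bump_square p = 1.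
  by rewrite /bump_square extend_in// cp (bump_ball1 Wx) scale1r.
have bc Z i y : W y -> bump_coord Z i (chart_inv c y) = local_field c Z y 0 i.
  move=> Wy; have yi := bump_ball_img Wy; have yd := chart_inv_dom yi.
  by rewrite /bump_coord extend_in// chart_funV// (bump_ball1 Wy) scale1r.
have oW : open W by exact: ball_open.
have E1 : nabla X Y p = nabla (fun q => \sum_i bump_coord X i q *: bump_field (delta_mx 0 i) q) Y p.
  have -> : (fun q => \sum_i bump_coord X i q *: bump_field (delta_mx 0 i) q) =
     (fun q => bump_square q *: X q + 0) by apply/funext => q; rewrite bump_decomposition.
  rewrite Hl//; [|exact: bump_square_smooth|exact: smooth_field0].
  by rewrite sq1 scale1r nabla0l// addr0.
have E2 Z : smooth_vector_field Z -> nabla Z Y p =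
    nabla Z (fun q => \sum_i bump_coord Y i q *: bump_field (delta_mx 0 i) q) p.
  move=> ZS; have -> : (fun q => \sum_i bump_coord Y i q *: bump_field (delta_mx 0 i) q) =
     (fun q => bump_square q *: Y q + 0) by apply/funext => q; rewrite bump_decomposition.
  rewrite Hr//; [|exact: bump_square_smooth|exact: smooth_field0].
  rewrite sq1 scale1r nabla0r// addr0 (directional_derivative_chart _ ac pc bump_square_smooth) cp.
  (* [bump_square] is constant near the point, so the Leibniz term vanishes. *)
  have -> : 'D_(local_field c Z x) (bump_square \o chart_inv c) x = 0.
    rewrite -(derive_cst (1 : R) x (local_field c Z x)); apply: near_eq_derive.
    apply: (open_in_nearW oW); last by rewrite inE.
    move=> y; rewrite inE => Wy; have yi := bump_ball_img Wy; have yd := chart_inv_dom yi.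
    by rewrite /= /bump_square extend_in// chart_funV// (bump_ball1 Wy) scale1r.
  by rewrite scale0r add0r.
rewrite E1 nabla_suml//; [|by move=> i; exact: bump_coord_smooth|by move=> i; exact: bump_field_smooth].
apply: eq_bigr => i _; rewrite bc// E2; last exact: bump_field_smooth.
rewrite nabla_sumr//; [|by move=> j; exact: bump_coord_smooth|by move=> j; exact: bump_field_smooth|exact: bump_field_smooth].
have D j : directional_derivative (bump_field (delta_mx 0 i)) (bump_coord Y j) p =
    'D_(delta_mx 0 i) (fun y => local_field c Y y 0 j : R) x.
  rewrite (directional_derivative_chart _ ac pc (bump_coord_smooth j YS)) cp.
  rewrite bump_field_local// (bump_ball1 Wx) scale1r; apply: near_eq_derive.
  apply: (open_in_nearW oW); last by rewrite inE.
  by move=> y; rewrite inE => Wy /=; rewrite bc.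
apply: (congr1 ( *:%R (local_field c X x 0 i))); apply: eq_bigr => j _.
by rewrite (D j) (bc Y j x Wx).
Qed.

(** Rows are the derivatives of the bump fields, so that a row of components multiplies from the
    left. On [W] these are the Christoffel symbols of [c]; elsewhere the matrices are merely
    smooth. *)
Definition christoffel (v x : 'rV[R]_n) : 'M[R]_n :=
  \sum_i v 0 i *: \matrix_(j < n)
    local_field c (nabla (bump_field (delta_mx 0 i)) (bump_field (delta_mx 0 j))) x.

Lemma christoffel_smooth v : smooth_on (chart_img c) (christoffel v).
Proof.
move=> k; have oi : open (chart_img c) by exact: chart_img_open.
apply: Ck_sum => // i _; apply: Ck_scale => //; apply: Ck_mx => // j l.
apply: (@Ck_ext _ _ _ k _ (fun x => local_field c (nabla (bump_field (delta_mx 0 i)) (bump_field (delta_mx 0 j))) x 0 l)) => //.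
  by move=> x _; rewrite mxE.
apply: (Ck_entry 0 l oi); apply: (local_smooth ac).
by apply: nabla_smooth; exact: bump_field_smooth.
Qed.

Lemma christoffel_linear x : linear (christoffel^~ x).
Proof.
move=> a v w; rewrite /christoffel scaler_sumr -big_split /=; apply: eq_bigr => i _.
by rewrite !mxE scalerDl scalerA.
Qed.

Lemma nabla_local X Y x : smooth_vector_field X -> smooth_vector_field Y -> W x ->
  local_field c (nabla X Y) x =
  'D_(local_field c X x) (local_field c Y) x + local_field c Y x *m christoffel (local_field c X x) x.
Proof.
move=> XS YS Wx; rewrite {1}/local_field nabla_decompose//.
have xi := bump_ball_img Wx; have pc := chart_inv_dom xi.
have cS := atlas_smooth_chart ac.
have dY : differentiable (local_field c Y) x by exact: smooth_on_diff (local_smooth ac YS) xi.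
rewrite derive_sum_delta// /christoffel mulmx_sumr mulmx_suml -big_split /=; apply: eq_bigr => i _.
rewrite -scalemxAl -scalemxAr -scalerDr; congr (_ *: _).
rewrite mulmx_suml [X in X + _]row_sum_delta mulmx_sum_row -big_split /=; apply: eq_bigr => j _.
rewrite mulmxDl -!scalemxAl derive_entry//; congr (_ *: _ + _ *: _).
  have := bump_field_local (delta_mx 0 j) xi; rewrite /local_field => ->.
  by rewrite (bump_ball1 Wx) scale1r.
by apply/rowP => l; rewrite !mxE.
Qed.

End Bump.
End LocalForm.

(** * Brackets and curvature in coordinates *)

Section PureCalculus.
Context {R : realType} {n : nat}.
Implicit Types (U : set 'rV[R]_n) (X Y Z t : 'rV[R]_n -> 'rV[R]_n).

Lemma smooth_derive_along m1 m2 U X (F : 'rV[R]_n -> 'M[R]_(m1, m2)) : open U ->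
  smooth_on U X -> smooth_on U F -> smooth_on U (fun x => 'D_(X x) F x).
Proof.
move=> oU XS FS k.
apply: (@Ck_ext _ _ _ k U (fun x => \sum_i X x 0 i *: 'D_(delta_mx 0 i) F x)) => //.
  by move=> x; rewrite inE => Ux; rewrite [RHS]derive_sum_delta//; exact: smooth_on_diff FS Ux.
apply: Ck_sum => // i _; apply: Ck_scalemx => //; first exact: (Ck_entry 0 i oU (XS k)).
exact: (smooth_onD (delta_mx 0 i) FS k).
Qed.

Lemma derive_linear_dir (W : normedModType R) (F : 'rV[R]_n -> W) x v w : differentiable F x ->
  'D_(v - w) F x = 'D_v F x - 'D_w F x.
Proof. by move=> dF; rewrite !(deriveE _ dF) linearB. Qed.

(** The term with direction frozen at [X x] is a true second derivative, symmetric by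
    [derive_swap_mx]; the other one goes into the derivative along the bracket. *)
Lemma derive_derive_along U X Z x v : open U -> smooth_on U X -> smooth_on U Z -> U x ->
  'D_v (fun y => 'D_(X y) Z y) x = 'D_('D_v X x) Z x + 'D_v (fun y => 'D_(X x) Z y) x.
Proof.
move=> oU XS ZS Ux.
have dJ : differentiable (fun y => 'J Z y) x.
  have JS : smooth_on U (fun y => 'J Z y) by move=> k; apply: Ck_jacobian.
  exact: smooth_on_diff JS Ux.
have dX := smooth_on_diff XS Ux; have dZ := smooth_on_diff ZS Ux.
have E (A : 'rV[R]_n -> 'rV[R]_n) : 'D_v (fun y => 'D_(A y) Z y) x = 'D_v (fun y => A y *m 'J Z y) x.
  apply: near_eq_derive; apply: (open_in_nearW oU); last by rewrite inE.
  by move=> y; rewrite inE => Uy; rewrite deriveEjacobian//; exact: smooth_on_diff ZS Uy.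
rewrite (E X) (E (fun=> X x)) !derive_mulmx// derive_cst mul0mx add0r.
by rewrite [in RHS]deriveEjacobian.
Qed.

(** The last term is the second derivative of [t] on [v] and [Ya y]. Its symmetry makes it disappear
    from the bracket. *)
Lemma pushforward_derive U t (Ya Yc : 'rV[R]_n -> 'rV[R]_n) y v : open U -> U y -> smooth_on U t ->
  differentiable Ya y -> differentiable Yc (t y) ->
  (forall z, U z -> Yc (t z) = Ya z *m 'J t z) ->
  'D_(v *m 'J t y) Yc (t y) = 'D_v Ya y *m 'J t y + 'D_v (fun z => 'D_(Ya y) t z) y.
Proof.
move=> oU Uy tS dYa dYc H.
have dt := smooth_on_diff tS Uy.
have JS : smooth_on U (fun y => 'J t y) by move=> k; apply: Ck_jacobian.
have dJ := smooth_on_diff JS Uy.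
rewrite -deriveEjacobian// -derive_compD//.
have -> : 'D_v (Yc \o t) y = 'D_v (fun z => Ya z *m 'J t z) y.
  apply: near_eq_derive; apply: (open_in_nearW oU); last by rewrite inE.
  by move=> z; rewrite inE => Uz /=; rewrite H.
rewrite derive_mulmx//; congr (_ + _).
have -> : 'D_v (fun z => 'D_(Ya y) t z) y = 'D_v (fun z => Ya y *m 'J t z) y.
  apply: near_eq_derive; apply: (open_in_nearW oU); last by rewrite inE.
  by move=> z; rewrite inE => Uz; rewrite deriveEjacobian//; exact: smooth_on_diff tS Uz.
by rewrite derive_mulmx// derive_cst mul0mx add0r.
Qed.

Lemma bracket_pushforward U t (Xa Xc Ya Yc : 'rV[R]_n -> 'rV[R]_n) y : open U -> U y -> smooth_on U t ->
  differentiable Xa y -> differentiable Xc (t y) ->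
  differentiable Ya y -> differentiable Yc (t y) ->
  (forall z, U z -> Xc (t z) = Xa z *m 'J t z) ->
  (forall z, U z -> Yc (t z) = Ya z *m 'J t z) ->
  ('D_(Xa y) Ya y - 'D_(Ya y) Xa y) *m 'J t y =
  'D_(Xc (t y)) Yc (t y) - 'D_(Yc (t y)) Xc (t y).
Proof.
move=> oU Uy tS dXa dXc dYa dYc HX HY.
rewrite (HX y Uy) (HY y Uy) (pushforward_derive (Xa y) oU Uy tS dYa dYc HY).
rewrite (pushforward_derive (Ya y) oU Uy tS dXa dXc HX).
rewrite (derive_swap_mx (Xa y) (Ya y) oU (tS 2%N) Uy) mulmxBl.
have cancel (a b e : 'rV[R]_n) : a - b = a + e - (b + e) by rewrite opprD addrACA subrr addr0.
exact: cancel.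
Qed.

Context (Gam : 'rV[R]_n -> 'rV[R]_n -> 'M[R]_n).

(** Vectors are rows, so the derivative along [v] of the derivative along [w] produces
    [Gam w x *m Gam v x], the reverse of the order for column vectors. *)
Definition curvature_matrix (v w x : 'rV[R]_n) : 'M[R]_n :=
  'D_v (Gam w) x + Gam w x *m Gam v x - ('D_w (Gam v) x + Gam v x *m Gam w x).

Hypothesis Glin : forall x, linear (Gam^~ x).

Lemma gamma_sum v x : Gam v x = \sum_i v 0 i *: Gam (delta_mx 0 i) x.
Proof.
pose L : {linear 'rV[R]_n -> 'M[R]_n} := HB.pack (Gam^~ x) (GRing.isLinear.Build _ _ _ _ _ (@Glin x)).
rewrite -[LHS]/(L v) {1}[v]row_sum_delta raddf_sum; apply: eq_bigr => i _; exact: linearZ_LR.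
Qed.

Lemma gamma_sub v w x : Gam (v - w) x = Gam v x - Gam w x.
Proof.
pose L : {linear 'rV[R]_n -> 'M[R]_n} := HB.pack (Gam^~ x) (GRing.isLinear.Build _ _ _ _ _ (@Glin x)).
exact: (raddfB L).
Qed.

Context (U : set 'rV[R]_n).
Hypotheses (oU : open U) (GS : forall v, smooth_on U (Gam v)).

Lemma smooth_gamma_along Y : smooth_on U Y -> smooth_on U (fun y => Gam (Y y) y).
Proof.
move=> YS k; apply: (@Ck_ext _ _ _ k U (fun y => \sum_i Y y 0 i *: Gam (delta_mx 0 i) y)) => //.
  by move=> x _; rewrite [RHS]gamma_sum.
apply: Ck_sum => // i _; apply: Ck_scalemx => //; first exact: (Ck_entry 0 i oU (YS k)).
exact: (GS (delta_mx 0 i) k).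
Qed.

Lemma derive_gamma_along Y x v : smooth_on U Y -> U x ->
  'D_v (fun y => Gam (Y y) y) x = Gam ('D_v Y x) x + 'D_v (Gam (Y x)) x.
Proof.
move=> YS Ux; have dY := smooth_on_diff YS Ux.
have dG w : differentiable (Gam w) x by exact: smooth_on_diff (GS w) Ux.
have E (A : 'rV[R]_n -> 'rV[R]_n) : differentiable A x ->
    'D_v (fun y => Gam (A y) y) x = \sum_i ('D_v A x 0 i *: Gam (delta_mx 0 i) x + A x 0 i *: 'D_v (Gam (delta_mx 0 i)) x).
  move=> dA; have dAi i : differentiable (fun y => A y 0 i : R) x by move/diff_mxP: dA.
  have -> : (fun y => Gam (A y) y) = \sum_i (fun y => A y 0 i *: Gam (delta_mx 0 i) y : 'M[R]_n).
    by apply/funext => y; rewrite fct_sumE gamma_sum.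
  have dS i : derivable (fun y => A y 0 i *: Gam (delta_mx 0 i) y : 'M[R]_n) x v.
    have /derivableP h1 : derivable (fun y => A y 0 i : R) x v by exact: diff_derivable.
    have /derivableP h2 : derivable (Gam (delta_mx 0 i)) x v by exact: diff_derivable.
    by have [] := is_derive_scalemx h1 h2.
  rewrite derive_sum//; apply: eq_bigr => i _.
  by rewrite derive_scalemx// derive_entry.
have -> : 'D_v (Gam (Y x)) x = 'D_v (fun y => Gam ((fun=> Y x) y) y) x by [].
have dc : differentiable (cst (Y x) : 'rV[R]_n -> 'rV[R]_n) x by exact: differentiable_cst.
apply: etrans (E Y dY) _; apply: etrans _ (esym (congr1 (+%R _) (E (fun=> Y x) dc))).
rewrite gamma_sum -big_split /=; apply: eq_bigr => i _.
by rewrite derive_cst mxE scale0r add0r.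
Qed.

Definition local_nabla (X Y : 'rV[R]_n -> 'rV[R]_n) (x : 'rV[R]_n) : 'rV[R]_n :=
  'D_(X x) Y x + Y x *m Gam (X x) x.

Lemma derive_local_nabla Y Z x v : smooth_on U Y -> smooth_on U Z -> U x ->
  'D_v (local_nabla Y Z) x =
  'D_('D_v Y x) Z x + 'D_v (fun y => 'D_(Y x) Z y) x
  + ('D_v Z x *m Gam (Y x) x + Z x *m (Gam ('D_v Y x) x + 'D_v (Gam (Y x)) x)).
Proof.
move=> YS ZS Ux.
have d1 : differentiable (fun y => 'D_(Y y) Z y) x.
  exact: smooth_on_diff (smooth_derive_along oU YS ZS) Ux.
have d2 : differentiable (fun y => Gam (Y y) y) x.
  exact: smooth_on_diff (smooth_gamma_along YS) Ux.
have d3 : differentiable Z x by exact: smooth_on_diff ZS Ux.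
have d4 : differentiable (fun y => Z y *m Gam (Y y) y) x.
  have S : smooth_on U (fun y => Z y *m Gam (Y y) y).
    by move=> k; apply: Ck_mulmx => //; exact: smooth_gamma_along.
  exact: smooth_on_diff S Ux.
rewrite -[local_nabla Y Z]/((fun y => 'D_(Y y) Z y) + (fun y => Z y *m Gam (Y y) y)).
rewrite deriveD; [|exact: diff_derivable|exact: diff_derivable].
by rewrite (derive_derive_along _ oU YS ZS Ux) derive_mulmx// derive_gamma_along.
Qed.

(** All derivatives of [Z] cancel: the second ones by Schwarz, those along the bracket against the
    third term, and the mixed products in pairs. *)
Lemma local_curvature X Y Z x : smooth_on U X -> smooth_on U Y -> smooth_on U Z -> U x ->
  local_nabla X (local_nabla Y Z) x - local_nabla Y (local_nabla X Z) x
  - ('D_('D_(X x) Y x - 'D_(Y x) X x) Z x + Z x *m Gam ('D_(X x) Y x - 'D_(Y x) X x) x) =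
  Z x *m curvature_matrix (X x) (Y x) x.
Proof.
move=> XS YS ZS Ux; have d3 : differentiable Z x by exact: smooth_on_diff ZS Ux.
rewrite {1 3}/local_nabla !derive_local_nabla//.
rewrite (derive_swap_mx (X x) (Y x) oU (ZS 2%N) Ux) derive_linear_dir// gamma_sub.
rewrite /local_nabla /curvature_matrix !(mulmxDl, mulmxDr, mulmxBr) !mulmxN !mulmxDr -!mulmxA.
move: ('D_('D_(X x) Y x) Z x) ('D_('D_(Y x) X x) Z x) => A1 A2.
move: ('D_(X x) (fun y => 'D_(Y x) Z y) x) ('D_(Y x) (fun y => 'D_(X x) Z y) x) => B1 B2.
move: ('D_(X x) Z x *m Gam (Y x) x) ('D_(Y x) Z x *m Gam (X x) x) => C1 C2.
move: (Z x *m Gam ('D_(X x) Y x) x) (Z x *m Gam ('D_(Y x) X x) x) => D1 D2.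
move: (Z x *m 'D_(X x) (Gam (Y x)) x) (Z x *m 'D_(Y x) (Gam (X x)) x) => E1 E2.
move: (Z x *m (Gam (X x) x *m Gam (Y x) x)) (Z x *m (Gam (Y x) x *m Gam (X x) x)) => F1 F2.
by apply/matrixP => i j; rewrite !mxE; ring.
Qed.

End PureCalculus.

Section BracketCharts.
Context {R : realType} {n : nat} (M : manifold R n).
Implicit Types (X Y Z : M -> 'rV[R]_n) (c : chart R n M).

(** The bracket at each point is computed in the preferred chart of that point. One formula over a
    whole chart is what smoothness and the local torsion require. *)
Lemma lie_bracket_chart X Y c p : atlas c -> chart_dom c p ->
  smooth_vector_field X -> smooth_vector_field Y ->
  lie_bracket X Y p *m coords c p =
  'D_(local_field c X (c p)) (local_field c Y) (c p) - 'D_(local_field c Y (c p)) (local_field c X) (c p).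
Proof.
move=> ac pc XS YS; set a := chart_at p.
have aa : atlas a := chart_at_atlas p; have pa : chart_dom a p := chart_at_dom p.
pose t := c \o chart_inv a.
have ty : t (a p) = c p by rewrite /t /= chart_invK.
have pai := chart_imgP pa; have pci := chart_imgP pc.
have oO : open (a @` (chart_dom a `&` chart_dom c)).
  by apply: chart_image_open; exact: chart_dom_open.
have H Z z : (a @` (chart_dom a `&` chart_dom c)) z -> local_field c Z (t z) = local_field a Z z *m 'J t z.
  move=> /chart_imageP[za zc]; have zd := chart_inv_dom za.
  have E : chart_inv c (t z) = chart_inv a z := chart_invK zc.
  have EJ : coords a (chart_inv a z) *m 'J t z = coords c (chart_inv a z).
    have := coords_change (atlas_smooth_chart aa) ac zd zc.
    by rewrite /transition_jacobian (chart_funV za).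
  rewrite /local_field E.
  exact: etrans (congr1 (mulmx (Z (chart_inv a z))) (esym EJ)) (mulmxA _ _ _).
have Op : (a @` (chart_dom a `&` chart_dom c)) (a p) by exists p.
have tS : smooth_on (a @` (chart_dom a `&` chart_dom c)) t by have [] := atlas_compatible aa ac.
have La Z : smooth_vector_field Z -> differentiable (local_field a Z) (a p).
  by move=> ZS; exact: smooth_on_diff (local_smooth aa ZS) pai.
have Lc Z : smooth_vector_field Z -> differentiable (local_field c Z) (t (a p)).
  by rewrite ty => ZS; exact: smooth_on_diff (local_smooth ac ZS) pci.
have := bracket_pushforward oO Op tS (La X XS) (Lc X XS) (La Y YS) (Lc Y YS) (H X) (H Y).
have e Z : local_field a Z (a p) = Z p.
  by rewrite local_field_at// coords_chart_at mulmx1.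
by rewrite (e X) (e Y) ty => E; exact: E.
Qed.

Lemma lie_bracket_smooth X Y : smooth_vector_field X -> smooth_vector_field Y ->
  smooth_vector_field (lie_bracket X Y).
Proof.
move=> XS YS c ac k; have oi : open (chart_img c) by exact: chart_img_open.
have Xc := local_smooth ac XS; have Yc := local_smooth ac YS.
have := Ck_add oi (smooth_derive_along oi Xc Yc k) (Ck_opp oi (smooth_derive_along oi Yc Xc k)).
apply: Ck_ext => // x; rewrite inE => xi; have xd := chart_inv_dom xi.
by have := lie_bracket_chart ac xd XS YS; rewrite (chart_funV xi) => H; exact: esym H.
Qed.

Lemma lie_bracket_local X Y c x : atlas c -> chart_img c x ->
  smooth_vector_field X -> smooth_vector_field Y ->
  local_field c (lie_bracket X Y) x =
  'D_(local_field c X x) (local_field c Y) x - 'D_(local_field c Y x) (local_field c X) x.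
Proof.
move=> ac xi XS YS; have xd := chart_inv_dom xi.
by have := lie_bracket_chart ac xd XS YS; rewrite (chart_funV xi) => H; exact: H.
Qed.

End BracketCharts.

(** * Almost golden structures in a chart *)

Section GoldenRatio.
Context {R : realType}.

Lemma golden_sum : @golden R + golden_conj = 1.
Proof. by rewrite /golden /golden_conj; field. Qed.

Lemma golden_prod : @golden R * golden_conj = -1.
Proof.
have s5 : Num.sqrt 5 ^+ 2 = 5 :> R by rewrite sqr_sqrtr.
rewrite /golden /golden_conj.
have -> : (1 + Num.sqrt 5) / 2 * ((1 - Num.sqrt 5) / 2) = (1 - Num.sqrt 5 ^+ 2) / 4 :> R by field.
by rewrite s5; field.
Qed.

Lemma golden_neq : @golden R != golden_conj.
Proof.
have s5 : 0 < Num.sqrt 5 :> R by rewrite sqrtr_gt0.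
by rewrite -subr_eq0 gt_eqF// /golden /golden_conj; lra.
Qed.

Lemma golden_factor n (P : 'M[R]_n) : P *m P = P + 1%:M ->
  (P - (golden_conj)%:M) *m (P - golden%:M) = 0 /\
  (P - golden%:M) *m (P - (golden_conj)%:M) = 0.
Proof.
move=> PP.
have H (a b : R) : a + b = 1 -> a * b = -1 -> (P - a%:M) *m (P - b%:M) = 0.
  move=> ab1 ab; rewrite mulmxBl !mulmxBr PP -scalar_mxM ab mul_mx_scalar mul_scalar_mx.
  have -> : b *: P = (1 - a) *: P by rewrite -ab1 addrAC subrr add0r.
  rewrite scalerBl scale1r raddfN /= opprB.
  by apply/matrixP => i j; rewrite !mxE; ring.
split; apply: H; rewrite ?golden_sum ?golden_prod//.
  by rewrite addrC golden_sum.
by rewrite mulrC golden_prod.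
Qed.

End GoldenRatio.

Section BilinearEntries.
Context {R : realType} {n : nat}.

Lemma bilinear_delta (A : 'M[R]_n) i j :
  ((delta_mx 0 i : 'rV_n) *m A *m (delta_mx 0 j : 'rV_n)^T) 0 0 = A i j.
Proof. by rewrite -rowE trmx_delta -colE !mxE. Qed.

Lemma bilinear_eq (A B : 'M[R]_n) :
  (forall v w : 'rV[R]_n, (v *m A *m w^T) 0 0 = (v *m B *m w^T) 0 0) -> A = B.
Proof. by move=> H; apply/matrixP => i j; rewrite -!bilinear_delta H. Qed.

Lemma linear_eq (A B : 'M[R]_n) : (forall v : 'rV[R]_n, v *m A = v *m B) -> A = B.
Proof. by move=> H; apply/row_matrixP => i; rewrite !rowE H. Qed.

End BilinearEntries.

Section LocalTensors.
Context {R : realType} {n : nat} (M : manifold R n).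
Implicit Types (X Y Z : M -> 'rV[R]_n) (c : chart R n M) (phi g : M -> 'M[R]_n).

Definition endo_local c phi (x : 'rV[R]_n) : 'M[R]_n :=
  coord_frame c (chart_inv c x) *m phi (chart_inv c x) *m coords c (chart_inv c x).

Definition metric_local c g (x : 'rV[R]_n) : 'M[R]_n :=
  coord_frame c (chart_inv c x) *m g (chart_inv c x) *m (coord_frame c (chart_inv c x))^T.

Lemma local_apply_endo c phi X x : atlas c -> chart_img c x ->
  local_field c (apply_endo phi X) x = local_field c X x *m endo_local c phi x.
Proof.
move=> ac xi; have xd := chart_inv_dom xi; have cS := atlas_smooth_chart ac.
have K : coords c (chart_inv c x) *m coord_frame c (chart_inv c x) = 1%:M := coordsK cS xd.
rewrite /local_field /endo_local /apply_endo.
move: (coords c _) (coord_frame c _) (phi _) (X _) K => A B P v K.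
by rewrite !mulmxA -[in RHS](mulmxA v A B) K mulmx1.
Qed.

Lemma inner_local c g X Y p : atlas c -> chart_dom c p ->
  inner g X Y p = ((X p *m coords c p) *m metric_local c g (c p) *m (Y p *m coords c p)^T) 0 0.
Proof.
move=> ac pc; have cS := atlas_smooth_chart ac.
rewrite /inner /metric_local chart_invK// trmx_mul.
have K : coords c p *m coord_frame c p = 1%:M := coordsK cS pc.
have KT : (coord_frame c p)^T *m (coords c p)^T = 1%:M by rewrite -trmx_mul K trmx1.
move: (coords c p) (coord_frame c p) (X p) (Y p)^T K KT => A B v w K KT.
by rewrite !mulmxA -[in RHS](mulmxA v A B) K mulmx1 -[in RHS](mulmxA _ B^T) KT mulmx1.
Qed.

Lemma smooth_apply_endo phi X : smooth_endomorphism phi -> smooth_vector_field X ->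
  smooth_vector_field (apply_endo phi X).
Proof.
move=> phiS XS c ac k; have oi : open (chart_img c) by exact: chart_img_open.
have CP : Ck k (chart_img c) (endo_local c phi) := phiS c ac k.
have := Ck_mulmx oi (local_smooth ac XS k) CP; apply: Ck_ext => // x; rewrite inE => xi.
exact: esym (local_apply_endo _ _ ac xi).
Qed.

Lemma smooth_inner g X Y : smooth_form g -> smooth_vector_field X -> smooth_vector_field Y ->
  smooth_function (inner g X Y).
Proof.
move=> gS XS YS c ac k; have oi : open (chart_img c) by exact: chart_img_open.
have CG : Ck k (chart_img c) (metric_local c g) := gS c ac k.
have := Ck_entry 0 0 oi (Ck_mulmx oi (Ck_mulmx oi (local_smooth ac XS k) CG) (Ck_trmx oi (local_smooth ac YS k))).
apply: Ck_ext => // x; rewrite inE => xi; have xd := chart_inv_dom xi.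
by have := inner_local g X Y ac xd; rewrite (chart_funV xi) => E; exact: esym E.
Qed.

End LocalTensors.

(** * The tensor equations in terms of [Gam] *)

Section LocalEquations.
Context {R : realType} {n : nat} (M : manifold R n).
Context (nabla : (M -> 'rV[R]_n) -> (M -> 'rV[R]_n) -> M -> 'rV[R]_n).
Hypothesis nablaC : covariant_derivative nabla.
Context (c : chart R n M) (ac : atlas c) (x0 : 'rV[R]_n) (r : R) (chi : 'rV[R]_n -> R).
Hypotheses (r0 : 0 < r) (rc : [set x | `|x - x0| <= r] `<=` chart_img c)
  (chiS : smooth_on setT chi) (chi0 : forall x, r <= `|x - x0| -> chi x = 0)
  (chi1 : forall x, `|x - x0| < r / 2 -> chi x = 1).
Implicit Types (X Y Z : M -> 'rV[R]_n) (phi g : M -> 'M[R]_n).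

Local Notation W := (ball x0 (r / 2)).
Local Notation Gam := (christoffel nabla c chi).
Local Notation E := (bump_field c chi).

Let oW : open W. Proof. exact: ball_open. Qed.
Let Wi x : W x -> chart_img c x. Proof. exact: (bump_ball_img r0 rc). Qed.
Let nabla_loc := nabla_local nablaC ac r0 rc chiS chi0 chi1.
Let ES v := bump_field_smooth ac rc chiS chi0 v.

Let Eloc v x : W x -> local_field c (E v) x = v.
Proof. by move=> Wx; rewrite (bump_field_local ac _ _ (Wi Wx)) (bump_ball1 chi1 Wx) scale1r. Qed.

Let DEloc v w x : W x -> 'D_w (local_field c (E v)) x = 0.
Proof.
move=> Wx; rewrite -(derive_cst v x w); apply: near_eq_derive.
apply: (open_in_nearW oW); last by rewrite inE.
by move=> y; rewrite inE => Wy; rewrite Eloc.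
Qed.

Let GamS v : smooth_on W (Gam v).
Proof. by move=> k; apply: Ck_sub (christoffel_smooth nablaC ac rc chiS chi0 v k) => x; exact: Wi. Qed.

Let Glin := christoffel_linear nabla c chi.

Lemma torsion_local X Y x : smooth_vector_field X -> smooth_vector_field Y -> W x ->
  torsion nabla X Y (chart_inv c x) *m coords c (chart_inv c x) =
  local_field c Y x *m Gam (local_field c X x) x - local_field c X x *m Gam (local_field c Y x) x.
Proof.
move=> XS YS Wx; rewrite /torsion.
apply: etrans (_ : local_field c (nabla X Y) x - local_field c (nabla Y X) x - local_field c (lie_bracket X Y) x = _).
  rewrite /local_field; move: (lie_bracket X Y _) => L; by rewrite !mulmxBl.
rewrite (nabla_loc XS YS Wx) (nabla_loc YS XS Wx) (lie_bracket_local ac (Wi Wx) XS YS).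
move: ('D_(local_field c X x) (local_field c Y) x) ('D_(local_field c Y x) (local_field c X) x) => A B.
move: (local_field c Y x *m _) (local_field c X x *m _) => C D.
by apply/matrixP => i j; rewrite !mxE; ring.
Qed.

Lemma curvature_local X Y Z x : smooth_vector_field X -> smooth_vector_field Y ->
  smooth_vector_field Z -> W x ->
  curvature nabla X Y Z (chart_inv c x) *m coords c (chart_inv c x) =
  local_field c Z x *m curvature_matrix Gam (local_field c X x) (local_field c Y x) x.
Proof.
move=> XS YS ZS Wx; rewrite /curvature !mulmxBl.
apply: etrans (_ : local_field c (nabla X (nabla Y Z)) x - local_field c (nabla Y (nabla X Z)) x
   - local_field c (nabla (lie_bracket X Y) Z) x = _); first by [].
have LS A : smooth_vector_field A -> smooth_on W (local_field c A).
  by move=> AS k; apply: Ck_sub (local_smooth ac AS k) => y; exact: Wi.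
have NE A B : smooth_vector_field A -> smooth_vector_field B ->
   local_field c (nabla A (nabla B Z)) x = local_nabla Gam (local_field c A) (local_nabla Gam (local_field c B) (local_field c Z)) x.
  move=> AS BS; apply: etrans (nabla_loc AS (nabla_smooth nablaC BS ZS) Wx) _.
  have near_loc : \forall y \near x, local_field c (nabla B Z) y = local_nabla Gam (local_field c B) (local_field c Z) y.
    apply: (open_in_nearW oW); last by rewrite inE.
    by move=> y; rewrite inE => Wy; exact: nabla_loc.
  rewrite {1}/local_nabla (near_eq_derive _ near_loc) (nabla_loc BS ZS Wx).
  by [].
rewrite (NE X Y XS YS) (NE Y X YS XS) (nabla_loc (lie_bracket_smooth XS YS) ZS Wx).
rewrite (lie_bracket_local ac (Wi Wx) XS YS).
exact: (local_curvature Glin oW GamS (LS X XS) (LS Y YS) (LS Z ZS) Wx).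
Qed.

Lemma torsion_free_local : torsion_vanishes nabla ->
  forall x v w, W x -> w *m Gam v x = v *m Gam w x.
Proof.
move=> T x v w Wx; have := torsion_local (ES v) (ES w) Wx.
rewrite (T _ _ (ES v) (ES w)) mul0mx !Eloc// => /esym/eqP.
by rewrite subr_eq0 => /eqP.
Qed.

Lemma curvature_free_local : curvature_vanishes nabla ->
  forall x v w, W x -> curvature_matrix Gam v w x = 0.
Proof.
move=> C x v w Wx; apply: linear_eq => z.
have := curvature_local (ES v) (ES w) (ES z) Wx.
by rewrite (C _ _ _ (ES v) (ES w) (ES z)) mul0mx !Eloc// mulmx0.
Qed.

Lemma endo_local_smooth phi : smooth_endomorphism phi -> smooth_on W (endo_local c phi).
Proof. by move=> pS k; apply: Ck_sub (pS c ac k) => x; exact: Wi. Qed.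

Lemma metric_local_smooth g : smooth_form g -> smooth_on W (metric_local c g).
Proof. by move=> gS k; apply: Ck_sub (gS c ac k) => x; exact: Wi. Qed.

(** Tested on fields with constant components near [x]: the derivative then falls on the local
    matrix of [phi] alone. *)
Lemma parallel_endo_local phi : smooth_endomorphism phi -> parallel_endomorphism nabla phi ->
  forall x v, W x -> 'D_v (endo_local c phi) x + endo_local c phi x *m Gam v x = Gam v x *m endo_local c phi x.
Proof.
move=> pS pP x v Wx; apply: linear_eq => w.
have pES := smooth_apply_endo pS (ES w).
have /(congr1 (mulmx^~ (coords c (chart_inv c x)))) := pP _ _ (ES v) (ES w) (chart_inv c x).
rewrite mul0mx mulmxBl => /eqP; rewrite subr_eq0 => /eqP H.
have {}H : local_field c (nabla (E v) (apply_endo phi (E w))) x =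
    local_field c (apply_endo phi (nabla (E v) (E w))) x by exact: H.
rewrite (nabla_loc (ES v) pES Wx) (local_apply_endo phi _ ac (Wi Wx)) in H.
rewrite (local_apply_endo phi _ ac (Wi Wx)) (nabla_loc (ES v) (ES w) Wx) in H.
rewrite (Eloc v Wx) (Eloc w Wx) (DEloc w v Wx) add0r in H.
have dP : differentiable (endo_local c phi) x by exact: smooth_on_diff (endo_local_smooth pS) Wx.
have ED : 'D_v (local_field c (apply_endo phi (E w))) x = w *m 'D_v (endo_local c phi) x.
  rewrite -(derive_mulmxl w v dP).
  apply: near_eq_derive; apply: (open_in_nearW oW); last by rewrite inE.
  move=> y; rewrite inE => Wy; apply: etrans (local_apply_endo phi _ ac (Wi Wy)) _.
  exact: (congr1 (mulmx^~ _) (Eloc w Wy)).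
by rewrite ED in H; rewrite mulmxDr !mulmxA in H *; rewrite -H.
Qed.

Lemma parallel_metric_local g : smooth_form g -> parallel_metric nabla g ->
  forall x v, W x -> 'D_v (metric_local c g) x =
    Gam v x *m metric_local c g x + metric_local c g x *m (Gam v x)^T.
Proof.
move=> gS gP x v Wx; apply: bilinear_eq => w z.
have xd := chart_inv_dom (Wi Wx); have xi := Wi Wx.
have iS := smooth_inner gS (ES w) (ES z).
have := gP _ _ _ (ES v) (ES w) (ES z) (chart_inv c x).
rewrite (directional_derivative_chart _ ac xd iS) !(inner_local g _ _ ac xd) (chart_funV xi).
have LE A : A (chart_inv c x) *m coords c (chart_inv c x) = local_field c A x by [].
rewrite (LE (nabla (E v) (E w))) (LE (nabla (E v) (E z))) (LE (E w)) (LE (E z)).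
rewrite !(nabla_loc _ _ Wx)// (Eloc v Wx) (Eloc w Wx) (Eloc z Wx) !DEloc// !add0r.
have dG : differentiable (metric_local c g) x by exact: smooth_on_diff (metric_local_smooth gS) Wx.
have -> : 'D_v (inner g (E w) (E z) \o chart_inv c) x = (w *m 'D_v (metric_local c g) x *m z^T) 0 0.
  have d1 : differentiable (fun y => w *m metric_local c g y) x.
    have S1 : smooth_on W (fun y => w *m metric_local c g y).
      by move=> k; apply: Ck_mulmx => //; [exact: Ck_cst|exact: metric_local_smooth].
    exact: smooth_on_diff S1 Wx.
  have d2 : differentiable (fun y => w *m metric_local c g y *m z^T) x.
    have S2 : smooth_on W (fun y => w *m metric_local c g y *m z^T).
      move=> k; apply: Ck_mulmx => //; last exact: Ck_cst.
      by apply: Ck_mulmx => //; [exact: Ck_cst|exact: metric_local_smooth].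
    exact: smooth_on_diff S2 Wx.
  have e1 : 'D_v (fun y => w *m metric_local c g y) x = w *m 'D_v (metric_local c g) x.
    exact: derive_mulmxl.
  have e2 : 'D_v (fun y => w *m metric_local c g y *m z^T) x =
      'D_v (fun y => w *m metric_local c g y) x *m z^T.
    exact: derive_mulmxr.
  rewrite -e1 -e2; apply: etrans (esym (derive_entry v 0 0 d2)).
  apply: near_eq_derive; apply: (open_in_nearW oW); last by rewrite inE.
  move=> y; rewrite inE => Wy; have yd := chart_inv_dom (Wi Wy).
  apply: etrans (inner_local g _ _ ac yd) _; rewrite (chart_funV (Wi Wy)).
  have LY A : A (chart_inv c y) *m coords c (chart_inv c y) = local_field c A y by [].
  by rewrite (LY (E w)) (LY (E z)) (Eloc w Wy) (Eloc z Wy).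
move=> /eqP; rewrite -addrA -opprD subr_eq0 => /eqP ->.
by rewrite mulmxDr mulmxDl [RHS]mxE trmx_mul !mulmxA.
Qed.

Lemma symmetric_endo_local phi g : smooth_endomorphism phi ->
  (forall X Y, smooth_vector_field X -> smooth_vector_field Y ->
    forall p, inner g (apply_endo phi X) Y p = inner g X (apply_endo phi Y) p) ->
  forall x, W x -> endo_local c phi x *m metric_local c g x = metric_local c g x *m (endo_local c phi x)^T.
Proof.
move=> pS H x Wx; apply: bilinear_eq => v w.
have xd := chart_inv_dom (Wi Wx); have xi := Wi Wx.
have := H _ _ (ES v) (ES w) (chart_inv c x).
rewrite !(inner_local g _ _ ac xd) (chart_funV xi).
have LE A : A (chart_inv c x) *m coords c (chart_inv c x) = local_field c A x by [].
rewrite (LE (apply_endo phi (E v))) (LE (apply_endo phi (E w))) (LE (E v)) (LE (E w)).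
rewrite !(local_apply_endo phi _ ac xi) (Eloc v Wx) (Eloc w Wx).
by rewrite trmx_mul !mulmxA.
Qed.

Lemma endo_local_square phi : (forall p, phi p *m phi p = phi p + 1%:M) ->
  forall x, chart_img c x -> endo_local c phi x *m endo_local c phi x = endo_local c phi x + 1%:M.
Proof.
move=> H x xi; have xd := chart_inv_dom xi; have cS := atlas_smooth_chart ac.
have K1 := coordsK cS xd; have K2 := coord_frameK cS xd; have Hp := H (chart_inv c x).
rewrite /endo_local; move: (coords c _) (coord_frame c _) (phi _) K1 K2 Hp => A B P K1 K2 Hp.
have -> : B *m P *m A *m (B *m P *m A) = B *m (P *m P) *m A.
  by rewrite !mulmxA -(mulmxA _ A B) K1 mulmx1.
by rewrite Hp mulmxDr mulmxDl mulmx1 K2.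
Qed.

(** The torsion condition needs fields that are eigenfields everywhere, which [bump_field] does not
    provide. The abstract [a] and [b] let the lemma serve both eigenvalues. *)
Lemma adapted_torsion_local phi g (a b : R) : smooth_endomorphism phi ->
  (forall p, (phi p - b%:M) *m (phi p - a%:M) = 0) -> a != b ->
  (forall X Y Z, smooth_vector_field X -> smooth_vector_field Y -> smooth_vector_field Z ->
     in_eigendistribution phi a X -> in_eigendistribution phi a Z ->
     forall p, inner g (torsion nabla X Y) Z p = inner g (torsion nabla Z Y) X p) ->
  forall x v w z, W x -> v *m endo_local c phi x = a *: v -> z *m endo_local c phi x = a *: z ->
  ((w *m Gam v x - v *m Gam w x) *m metric_local c g x *m z^T) 0 0 =
  ((w *m Gam z x - z *m Gam w x) *m metric_local c g x *m v^T) 0 0.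
Proof.
move=> pS fac ab H x v w z Wx va za.
have cS := atlas_smooth_chart ac.
(* The polynomial (X - b)/(a - b) in the local matrix of [phi] projects onto the eigenspace of [a].
   Projecting the constant row [u] at every point gives a smooth eigenfield with value [u] at [x] if
   [u] is an eigenvector there. *)
pose k (u y : 'rV[R]_n) := (a - b)^-1 *: (u *m (endo_local c phi y - b%:M)).
pose F (u : 'rV[R]_n) := extend c chi (fun q => k u (c q) *m coord_frame c q).
have kS u : smooth_on (chart_img c) (k u).
  move=> j; have oi : open (chart_img c) by exact: chart_img_open.
  apply: Ck_scale => //; apply: Ck_mulmx => //; first exact: Ck_cst.
  by apply: Ck_add => //; [exact: (pS c ac j)|exact: Ck_cst].
have FS u : smooth_vector_field (F u) by apply: (smooth_field_extend ac rc chiS chi0 (kS u)).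
have Fx u : u *m endo_local c phi x = a *: u -> local_field c (F u) x = u.
  move=> ua; have -> : local_field c (F u) x = chi x *: k u x by exact: (local_field_extend ac chi (k u) (Wi Wx)).
  rewrite (bump_ball1 chi1 Wx) scale1r /k mulmxBr ua mul_mx_scalar -scalerBl scalerA mulVf ?scale1r//.
  by rewrite subr_eq0.
have FD u : in_eigendistribution phi a (F u).
  move=> q; apply/eigenspaceP; rewrite /F /extend; case: asboolP => qc; last first.
    by rewrite mul0mx scaler0.
  have K1 := coordsK cS qc; have K2 := coord_frameK cS qc; have fq := fac q.
  rewrite /k /endo_local chart_invK//.
  move: (coords c q) (coord_frame c q) (phi q) K1 K2 fq => A B P K1 K2 fq.
  have EV (y : 'rV[R]_n) : y *m (P - a%:M) = 0 -> y *m P = a *: y.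
    by rewrite mulmxBr mul_mx_scalar => /eqP; rewrite subr_eq0 => /eqP.
  apply: EV; rewrite -!scalemxAl.
  have -> : u *m (B *m P *m A - b%:M) *m B = u *m B *m (P - b%:M).
    rewrite mulmxBr mulmxBl !mulmxA -(mulmxA _ A B) K1 mulmx1 mulmxBr.
    by rewrite !mul_mx_scalar -scalemxAl.
  by rewrite -mulmxA fq mulmx0 !scaler0.
clearbody F.
have xd := chart_inv_dom (Wi Wx); have xi := Wi Wx.
have key A B z' : smooth_vector_field A -> smooth_vector_field B ->
    inner g (torsion nabla A B) z' (chart_inv c x) =
    ((local_field c B x *m Gam (local_field c A x) x - local_field c A x *m Gam (local_field c B x) x)
      *m metric_local c g x *m (local_field c z' x)^T) 0 0.
  move=> AS BS; apply: etrans (inner_local g _ _ ac xd) _.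
  by rewrite (torsion_local AS BS Wx) (chart_funV xi).
have E1 := key _ _ (F z) (FS v) (ES w); rewrite (Eloc w Wx) (Fx _ va) (Fx _ za) in E1.
have E2 := key _ _ (F v) (FS z) (ES w); rewrite (Eloc w Wx) (Fx _ va) (Fx _ za) in E2.
by rewrite -E1 -E2; exact: H.
Qed.

End LocalEquations.

(** * Adapted connections and frames at a point *)

Section EigenSplitting.
Context {R : realType} {n : nat} (P : 'M[R]_n) (a b : R).
Hypotheses (ab : a != b) (Pba : (P - b%:M) *m (P - a%:M) = 0)
  (Pab : (P - a%:M) *m (P - b%:M) = 0).

Lemma eigen_equation m (v : 'M[R]_(m, n)) (l : R) : v *m (P - l%:M) = 0 -> v *m P = l *: v.
Proof. by rewrite mulmxBr mul_mx_scalar => /eqP; rewrite subr_eq0 => /eqP. Qed.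

(** The Lagrange polynomials (X - b)/(a - b) and (X - a)/(b - a), evaluated at [P], are
    complementary projections onto the two eigenspaces. *)
Lemma eigen_split (v : 'rV[R]_n) : exists v1 v2 : 'rV[R]_n,
  [/\ v = v1 + v2, v1 *m P = a *: v1 & v2 *m P = b *: v2].
Proof.
exists ((a - b)^-1 *: (v *m (P - b%:M))), (- ((a - b)^-1 *: (v *m (P - a%:M)))); split.
- rewrite -scalerBr -mulmxBr.
  have -> : P - b%:M - (P - a%:M) = (a - b)%:M.
    by apply/matrixP => i j; rewrite !mxE; case: eqP => _; rewrite ?mulr1n ?mulr0n; ring.
  by rewrite mul_mx_scalar scalerA mulVf ?scale1r// subr_eq0.
- by apply: eigen_equation; rewrite -scalemxAl -mulmxA Pba mulmx0 scaler0.
- by apply: eigen_equation; rewrite mulNmx -scalemxAl -mulmxA Pab mulmx0 scaler0 oppr0.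
Qed.

Lemma eigen_ranks : (\rank (eigenspace P a) + \rank (eigenspace P b))%N = n.
Proof.
have cap : (eigenspace P a :&: eigenspace P b)%MS = 0.
  apply/eqP/rowV0P => v; rewrite sub_capmx => /andP[/eigenspaceP va /eigenspaceP].
  rewrite va => /eqP; rewrite -subr_eq0 -scalerBl scaler_eq0 subr_eq0 (negbTE ab) /=.
  by move/eqP.
rewrite -mxrank_sum_cap cap mxrank0 addn0.
suff /eqP : row_full (eigenspace P a + eigenspace P b)%MS by [].
rewrite -sub1mx; apply/row_subP => i; have [v1 [v2 [-> v1a v2b]]] := eigen_split (row i 1%:M).
by apply: addmx_sub_adds; exact/eigenspaceP.
Qed.

End EigenSplitting.

(* With [f v w z = g(S_v w, z)], which is skew in [w, z] and vanishes for [w], [z]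
   in distinct eigenspaces, the torsion condition reads
   [f v w z - f z w v = 2 f w v z] for [v], [z] in the same eigenspace. *)
Lemma adapted_connection_unique {R : realType} {n : nat} (P G : 'M[R]_n) (a b : R)
    (S : 'rV[R]_n -> 'M[R]_n) : a != b ->
  (P - b%:M) *m (P - a%:M) = 0 -> (P - a%:M) *m (P - b%:M) = 0 ->
  G^T = G -> G \in unitmx -> P *m G = G *m P^T -> linear S ->
  (forall v, S v *m G + G *m (S v)^T = 0) -> (forall v, P *m S v = S v *m P) ->
  (forall l v w z, l = a \/ l = b -> v *m P = l *: v -> z *m P = l *: z ->
    ((w *m S v - v *m S w) *m G *m z^T) 0 0 = ((w *m S z - z *m S w) *m G *m v^T) 0 0) ->
  forall v, S v = 0.
Proof.
move=> ab Pba Pab GT Gu PG Sl SG SP ST.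
pose f (v w z : 'rV[R]_n) : R := (w *m S v *m G *m z^T) 0 0.
have SD v v' : S (v + v') = S v + S v' by rewrite -[v]scale1r Sl !scale1r.
have fD1 v v' w z : f (v + v') w z = f v w z + f v' w z.
  by rewrite /f SD mulmxDr !mulmxDl mxE.
have fD2 v w w' z : f v (w + w') z = f v w z + f v w' z.
  by rewrite /f !mulmxDl mxE.
have fD3 v w z z' : f v w (z + z') = f v w z + f v w z'.
  by rewrite /f linearD /= !mulmxDr mxE.
have fN v w z : f v w z = - f v z w.
  have E : f v z w = (w *m (G *m (S v)^T) *m z^T) 0 0.
    rewrite /f -[in LHS](trmxK (z *m S v *m G *m w^T)) mxE.
    by rewrite !trmx_mul !trmxK GT !mulmxA.
  have /eqP := SG v; rewrite addrC addr_eq0 => /eqP E2.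
  by rewrite E E2 mulmxN mulNmx mxE opprK /f !mulmxA.
(* [S v] commutes with [P], and [P] is self-adjoint for [G], so multiplying by [l] and by [m] gives
   the same number. *)
have f0 v w z l m : l != m -> w *m P = l *: w -> z *m P = m *: z -> f v w z = 0.
  move=> lm wl zm.
  have : l * f v w z = m * f v w z.
    have -> : l * f v w z = (w *m P *m S v *m G *m z^T) 0 0.
      by rewrite wl -!scalemxAl mxE.
    have -> : m * f v w z = (w *m S v *m G *m (z *m P)^T) 0 0.
      by rewrite zm linearZ /= -scalemxAr mxE.
    by rewrite trmx_mul -(mulmxA w P) SP !mulmxA -[in RHS](mulmxA _ G P^T) -PG !mulmxA.
  by move/eqP; rewrite -subr_eq0 -mulrBl mulf_eq0 subr_eq0 (negbTE lm) => /eqP.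
have fT l v w z : l = a \/ l = b -> v *m P = l *: v -> z *m P = l *: z ->
    f v w z - f z w v = 2 * f w v z.
  move=> lab vl zl; have := ST _ _ w _ lab vl zl.
  have D (A B : 'M[R]_1) : (A - B) 0 0 = A 0 0 - B 0 0 by rewrite !mxE.
  rewrite !mulmxBl !D -/(f v w z) -/(f w v z) -/(f z w v) -/(f w z v) (fN w z v); lra.
have fE l m v w z : l = a \/ l = b -> m = a \/ m = b -> v *m P = l *: v -> z *m P = l *: z ->
    w *m P = m *: w -> f w v z = 0.
  move=> lab mab vl zl wm; have := fT _ _ w _ lab vl zl.
  (* If [w] lies in the other eigenspace, both terms on the left of [fT] vanish by [f0]. Otherwise
     the cyclic permutations of [fT], with skewness, form a nonsingular linear system in three
     unknowns. *)
  have [lm|lm] := eqVneq l m; last first.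
    by rewrite (f0 v w z m l) 1?eq_sym// (f0 z w v m l) 1?eq_sym// subr0; lra.
  rewrite -lm in wm; have := fT _ _ v _ lab zl wm; have := fT _ _ z _ lab wm vl.
  by rewrite (fN z w v) (fN z v w) (fN v z w) (fN w z v); have := fN z v w; have := fN v w z; have := fN w v z; lra.
have fab l m v w z : l = a \/ l = b -> m = a \/ m = b -> (l = m \/ l != m) ->
    w *m P = l *: w -> z *m P = m *: z -> forall k, k = a \/ k = b -> v *m P = k *: v -> f v w z = 0.
  move=> la ma [lm|lm] wl zm k ka vk; last exact: f0 wl zm.
  by rewrite lm in wl; exact: (fE m k).
have f00 v w z : f v w z = 0.
  have [v1 [v2 [-> v1a v2b]]] := eigen_split ab Pba Pab v.
  have [w1 [w2 [-> w1a w2b]]] := eigen_split ab Pba Pab w.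
  have [z1 [z2 [-> z1a z2b]]] := eigen_split ab Pba Pab z.
  have L (l m : R) : l = m \/ l != m by case: (eqVneq l m); [left|right].
  have la : a = a \/ a = b by left.
  have lb : b = a \/ b = b by right.
  rewrite !fD1 !fD2 !fD3.
  rewrite (fab a a v1 w1 z1 la la (L _ _) w1a z1a a la v1a) (fab a b v1 w1 z2 la lb (L _ _) w1a z2b a la v1a).
  rewrite (fab b a v1 w2 z1 lb la (L _ _) w2b z1a a la v1a) (fab b b v1 w2 z2 lb lb (L _ _) w2b z2b a la v1a).
  rewrite (fab a a v2 w1 z1 la la (L _ _) w1a z1a b lb v2b) (fab a b v2 w1 z2 la lb (L _ _) w1a z2b b lb v2b).
  rewrite (fab b a v2 w2 z1 lb la (L _ _) w2b z1a b lb v2b) (fab b b v2 w2 z2 lb lb (L _ _) w2b z2b b lb v2b).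
  by rewrite !addr0.
move=> v; have : S v *m G = 0.
  by apply: bilinear_eq => w z; rewrite mulmx0 mul0mx [RHS]mxE -(f00 v w z) /f !mulmxA.
by move/(congr1 (mulmx^~ (invmx G))); rewrite mulmxK// mul0mx.
Qed.

Section AdaptedFrame.
Context {R : realType}.

Definition posdef n (G : 'M[R]_n) : Prop := forall v : 'rV[R]_n, v != 0 -> 0 < (v *m G *m v^T) 0 0.

Lemma posdef_congruent n m (A : 'M[R]_(m, n)) (G : 'M[R]_n) : posdef G -> row_free A ->
  posdef (A *m G *m A^T).
Proof.
move=> Gp Af v v0; have : v *m A != 0.
  apply: contra v0 => /eqP vA; move: (mulmx_free_eq0 v Af); rewrite vA eqxx => /esym.
  by move->.
by move/Gp; rewrite trmx_mul !mulmxA.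
Qed.

Lemma posdef_diag_block n (a : R) (H : 'M[R]_n) : posdef (block_mx (a%:M : 'M[R]_1) 0 0 H) ->
  0 < a /\ posdef H.
Proof.
move=> Gp; have E (x : 'M[R]_1) (v : 'rV[R]_n) : row_mx x v *m block_mx (a%:M : 'M[R]_1) 0 0 H *m (row_mx x v)^T
    = a *: (x *m x^T) + v *m H *m v^T.
  by rewrite mul_row_block tr_row_mx mul_row_col !mulmx0 addr0 add0r mul_mx_scalar scalemxAl.
split=> [|v v0].
  have := Gp (row_mx 1%:M 0); rewrite E trmx0 mulmx0 addr0 trmx1 mulmx1 !mxE eqxx mulr1; apply.
  by apply/eqP => /matrixP /(_ 0 (lshift n 0)); rewrite row_mxEl !mxE eqxx => /eqP; rewrite oner_eq0.
have := Gp (row_mx 0 v); rewrite E mul0mx scaler0 add0r; apply.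
by apply: contra v0 => /eqP X; apply/eqP; rewrite -[v](row_mxKr (0 : 'M[R]_1)) X linear0.
Qed.

(** Block elimination by induction: [T] clears the first row and column off the diagonal, what
    remains is the Schur complement, again positive definite, and the first vector is scaled by the
    inverse square root of [a]. *)
Lemma orthonormalization n (G : 'M[R]_n) : G^T = G -> posdef G ->
  exists Q : 'M[R]_n, Q *m G *m Q^T = 1%:M.
Proof.
elim: n G => [|n IH] G GT Gp; first by exists 0; apply/matrixP => -[].
rewrite -[n.+1]add1n in G GT Gp *.
pose a := G 0 0; pose u : 'rV[R]_n := ursubmx G.
have Ga : ulsubmx G = a%:M.
  by apply/matrixP => i j; rewrite !ord1 !mxE eqxx mulr1n; congr (G _ _); exact/val_inj.
have GE : G = block_mx a%:M u u^T (drsubmx G).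
  have uT : u^T = dlsubmx G by rewrite trmx_ursub GT.
  by rewrite uT -Ga submxK.
have a0 : a != 0.
  have := Gp (delta_mx 0 0); rewrite bilinear_delta => /(_ _)/lt0r_neq0; apply.
  apply/eqP => /matrixP /(_ 0 0); rewrite !mxE eqxx => /eqP; rewrite oner_eq0//.
pose T : 'M[R]_(1 + n) := block_mx 1%:M 0 (- a^-1 *: u^T) 1%:M.
have Tfree : row_free T.
  by rewrite row_free_unit unitmxE det_lblock !det1 mulr1 unitr1.
have TG : T *m G *m T^T = block_mx a%:M 0 0 (drsubmx G - a^-1 *: (u^T *m u)).
  rewrite GE /T tr_block_mx !mulmx_block !trmx1 trmx0 !mul1mx !mulmx1 !mul0mx !mulmx0 !addr0.
  rewrite linearZ /= trmxK mul_scalar_mx mul_mx_scalar -!scalemxAl -!scalemxAr !scalerA.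
  rewrite !mulrN divff// !scaleN1r !addNr.
  rewrite block_mxKdr.
  by congr block_mx; rewrite // mul0mx scaler0 add0r scaleNr addrC.
have := posdef_congruent Gp Tfree; rewrite TG => /posdef_diag_block[ap Hp].
have [|Q QH] := IH _ _ Hp.
  by rewrite linearB /= linearZ /= trmx_mul trmxK trmx_drsub GT.
pose S : 'M[R]_(1 + n) := block_mx (Num.sqrt a)^-1%:M 0 0 Q.
exists (S *m T).
have -> : S *m T *m G *m (S *m T)^T = S *m (T *m G *m T^T) *m S^T.
  by rewrite trmx_mul !mulmxA.
rewrite TG /S tr_block_mx !mulmx_block !trmx0 !mul0mx !mulmx0 !addr0 !mul0mx !add0r QH.
rewrite tr_scalar_mx -!scalar_mxM mulrAC -invfM -expr2 sqr_sqrtr ?ltW// mulVf//.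
by rewrite -scalar_mx_block.
Qed.

Lemma rank_basis n m k (A : 'M[R]_(m, n)) : \rank A = k ->
  exists B : 'M[R]_(k, n), row_free B /\ (B <= A)%MS.
Proof. by move=> <-; exists (row_base A); split; [exact: row_base_free|rewrite eq_row_base]. Qed.

(** Each eigenspace is orthonormalized separately; the two are orthogonal because [P] is
    self-adjoint for [G] and [a != b]. *)
Lemma adapted_frame_exists n (P G : 'M[R]_n) (a b : R) r s : a != b ->
  (P - b%:M) *m (P - a%:M) = 0 -> (P - a%:M) *m (P - b%:M) = 0 ->
  G^T = G -> posdef G -> P *m G = G *m P^T ->
  \rank (eigenspace P a) = r -> \rank (eigenspace P b) = s ->
  exists F : 'M[R]_n, F *m G *m F^T = 1%:M /\
    F *m P = diag_mx (\row_i (if (i < r)%N then a else b)) *m F.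
Proof.
move=> ab Pba Pab GT Gp PG ra rb.
have rs : (r + s)%N = n by rewrite -ra -rb; exact: eigen_ranks.
have [A0 [A0f A0a]] := rank_basis ra; have [B0 [B0f B0b]] := rank_basis rb.
have sym m (A : 'M[R]_(m, n)) : (A *m G *m A^T)^T = A *m G *m A^T.
  by rewrite !trmx_mul trmxK GT mulmxA.
have [QA QAE] := orthonormalization (sym _ A0) (posdef_congruent Gp A0f).
have [QB QBE] := orthonormalization (sym _ B0) (posdef_congruent Gp B0f).
pose A := QA *m A0; pose B := QB *m B0.
have AP : A *m P = a *: A by rewrite -mulmxA (eigenspaceP A0a) -scalemxAr.
have BP : B *m P = b *: B by rewrite -mulmxA (eigenspaceP B0b) -scalemxAr.
have AA : A *m G *m A^T = 1%:M by rewrite -QAE /A trmx_mul !mulmxA.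
have BB : B *m G *m B^T = 1%:M by rewrite -QBE /B trmx_mul !mulmxA.
have AB : A *m G *m B^T = 0.
  have E : a *: (A *m G *m B^T) = b *: (A *m G *m B^T).
    have -> : a *: (A *m G *m B^T) = A *m P *m G *m B^T by rewrite AP -!scalemxAl.
    have -> : b *: (A *m G *m B^T) = A *m G *m (B *m P)^T by rewrite BP linearZ /= -scalemxAr.
    by rewrite (trmx_mul B P) !mulmxA -[in LHS](mulmxA A P G) PG !mulmxA.
  apply/eqP; have := E; move/eqP; rewrite -subr_eq0 -scalerBl scaler_eq0 subr_eq0 (negbTE ab).
  by [].
have BA : B *m G *m A^T = 0.
  by rewrite -[LHS]trmxK (trmx_mul _ A^T) trmxK (trmx_mul B) GT mulmxA AB trmx0.
(* Stacking [A] on [B] gives a square matrix only up to [r + s = n]; replacing [n] by [r + s] avoids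
   a cast. *)
clearbody A B; subst n.
exists (col_mx A B); split.
  by rewrite tr_col_mx mul_col_mx mul_col_row AA BB AB BA -scalar_mx_block.
rewrite mul_col_mx AP BP; apply/row_matrixP => i; rewrite row_mul row_diag_mx mxE -scalemxAl -rowE.
case: (split_ordP i) => j ->.
  by rewrite !rowKu linearZ.
by rewrite !rowKd linearZ.
Qed.

Lemma eigen_rows n (P F : 'M[R]_n) (d : 'rV[R]_n) : F *m P = diag_mx d *m F <->
  forall i, (row i F <= eigenspace P (d 0 i))%MS.
Proof.
split=> [E i|H].
  by apply/eigenspaceP; rewrite -row_mul E row_mul row_diag_mx -scalemxAl -rowE.
by apply/row_matrixP => i; rewrite !row_mul (eigenspaceP (H i)) row_diag_mx -scalemxAl -rowE.
Qed.

End AdaptedFrame.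

(** * Charts with parallel frames *)

Section FlatChart.
Context {R : realType} {n : nat}.
Implicit Types (U W : set 'rV[R]_n).

(** Along rays from [x0], [gronwall] with error 0 forces [E] to vanish. The two-sided form covers
    both defects of adaptedness: [C] is the transpose of [Gam] for the metric, and 0 for the
    endomorphism. *)
Lemma linear_equation_unique m p U (x0 : 'rV[R]_n) (A : 'rV[R]_n -> 'rV[R]_n -> 'M[R]_m)
    (C : 'rV[R]_n -> 'rV[R]_n -> 'M[R]_p) (E : 'rV[R]_n -> 'M[R]_(m, p)) :
  open U -> U x0 -> (forall v, smooth_on U (A v)) -> (forall v, smooth_on U (C v)) ->
  (forall x, linear (A^~ x)) -> (forall x, linear (C^~ x)) ->
  (forall x, U x -> differentiable E x) ->
  (forall x v, U x -> 'D_v E x = A v x *m E x + E x *m C v x) -> E x0 = 0 ->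
  exists d, [/\ 0 < d, ball x0 d `<=` U & forall x, ball x0 d x -> E x = 0].
Proof.
move=> oU Ux0 AS CS Al Cl dE DE E0.
pose S x := \sum_i `|A (delta_mx 0 i) x| + \sum_i `|C (delta_mx 0 i) x|.
have cS : {for x0, continuous S}.
  have c0 : {for x0, continuous (fun x => \sum_i `|A (delta_mx 0 i) x|)}.
    apply: sum_continuous_at => i; apply: norm_continuous_at.
    exact: smooth_on_cont (AS _) Ux0.
  have c1 : {for x0, continuous (fun x => \sum_i `|C (delta_mx 0 i) x|)}.
    apply: sum_continuous_at => i; apply: norm_continuous_at.
    exact: smooth_on_cont (CS _) Ux0.
  exact: (continuousD c0 c1).
have [r [K [r0 K0 HK]]] := ex_ball_bound oU Ux0 cS.
(* Times the norm of the direction, [L] bounds the coefficient along the ray; the [+ 1] keeps it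
   positive. The radius then makes the coefficient at most 1/2, as [gronwall] asks. *)
pose L : R := m%:R * K + p%:R * K + 1.
have L0 : 0 < L by rewrite ltr_wpDl// addr_ge0 ?mulr_ge0.
pose d := Num.min r (2 * L)^-1.
have d0 : 0 < d by rewrite lt_min r0 invr_gt0 mulr_gt0.
have dr x : ball x0 d x -> ball x0 r x by apply: le_ball; rewrite ge_min lexx.
exists d; split=> // [x /dr/HK[]//|x xd].
pose h := x - x0.
have hd : `|h| < d by move: xd; rewrite -ball_normE /ball_ /= distrC.
have seg t : t \in `[0, 1] -> ball x0 d (x0 + t *: h).
  rewrite in_itv /= => /andP[t0 t1]; rewrite -ball_normE /ball_ /=.
  by rewrite opprD addrA subrr add0r normrN normrZ ger0_norm// (le_lt_trans _ hd)// ler_piMl.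
have := @gronwall _ m p (fun t => E (x0 + t *: h)) (fun t => 'D_h E (x0 + t *: h)) (L * `|h|) 0 (lexx _).
have -> : x = x0 + 1 *: h by rewrite scale1r addrC subrK.
move=> G; apply/eqP; rewrite -normr_eq0 -normr_le0 normr_id -(mulr0 2).
apply: (G _ _ _ _ 1); last by rewrite in_itv /= ler01 lexx.
- rewrite mulr_ge0 ?(ltW L0)//=.
  have : L * `|h| <= L * (2 * L)^-1.
    by rewrite ler_wpM2l ?(ltW L0)// (le_trans (ltW hd))// ge_min lexx orbT.
  by rewrite invfM mulrCA mulfV ?mulr1// gt_eqF.
- by rewrite scale0r addr0.
- by move=> t /seg/dr/HK[Ut _]; exact: (is_derive_line (dE _ Ut)).
move=> t /seg/dr/HK[Ut St]; set z := x0 + t *: h in Ut St *.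
rewrite (DE _ _ Ut) addr0.
have a1 : `|A h z| <= `|h| * K.
  apply: le_trans (linear_row_bound h (Al z)) _; rewrite ler_wpM2l//.
  by apply: le_trans St; rewrite lerDl sumr_ge0.
have c1 : `|C h z| <= `|h| * K.
  apply: le_trans (linear_row_bound h (Cl z)) _; rewrite ler_wpM2l//.
  by apply: le_trans St; rewrite lerDr sumr_ge0.
apply: le_trans (ler_normD _ _) _.
have b1 := mx_norm_mul (A h z) (E z); have b2 := mx_norm_mul (E z) (C h z).
have e0 := normr_ge0 (E z).
have b3 : m%:R * `|A h z| * `|E z| <= m%:R * (`|h| * K) * `|E z| by rewrite ler_wpM2r// ler_wpM2l.
have b4 : p%:R * `|E z| * `|C h z| <= p%:R * `|E z| * (`|h| * K) by rewrite ler_wpM2l ?mulr_ge0.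
have b5 : 0 <= `|h| * `|E z| by rewrite mulr_ge0.
have -> : L * `|h| * `|E z| = m%:R * (`|h| * K) * `|E z| + p%:R * `|E z| * (`|h| * K) + `|h| * `|E z|.
  by rewrite /L; ring.
lra.
Qed.

Lemma trmx_linear (Gam : 'rV[R]_n -> 'rV[R]_n -> 'M[R]_n) x : linear (Gam^~ x) ->
  linear (fun v => (Gam v x)^T).
Proof. by move=> Gl a v w; rewrite Gl linearP. Qed.

Section Development.
Context U (x0 : 'rV[R]_n) (Gam : 'rV[R]_n -> 'rV[R]_n -> 'M[R]_n) (theta0 : 'M[R]_n).
Hypotheses (oU : open U) (Ux0 : U x0) (GamS : forall v, smooth_on U (Gam v))
  (Glin : forall x, linear (Gam^~ x))
  (Gtor : forall x v w, U x -> w *m Gam v x = v *m Gam w x)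
  (Gflat : forall x v w, U x -> curvature_matrix Gam v w x = 0).

(** The matrix of the affine connection: for [u = col_mx (y x) (theta x)] the equation
    ['D_v u = B v *m u] contains the equations of both [y] and [theta]. *)
Let B (v x : 'rV[R]_n) : 'M[R]_(1 + n) := block_mx 0 v 0 (Gam v x).

(** Embeds a block as a product with constant matrices, so that the rules for products give its
    smoothness and its derivative. *)
Let Llin (M : 'M[R]_n) : 'M[R]_(1 + n) := col_mx 0 1%:M *m M *m row_mx 0 1%:M.

Let LlinE M : Llin M = block_mx 0 0 0 M.
Proof.
by rewrite /Llin mul_col_mx mul0mx mul1mx mul_col_row !mul0mx !mulmx0 mulmx1.
Qed.

Let BE v x : B v x = Llin (Gam v x) + block_mx 0 v 0 0.
Proof. by rewrite LlinE add_block_mx !addr0 add0r. Qed.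

Let BS v : smooth_on U (B v).
Proof.
move=> k; apply: (Ck_ext oU (f := fun x => Llin (Gam v x) + block_mx 0 v 0 0)).
  by move=> x _; rewrite -BE.
apply: Ck_add => //; last exact: Ck_cst.
by apply: Ck_mulmx => //; [apply: Ck_mulmx => //; [exact: Ck_cst|exact: GamS]|exact: Ck_cst].
Qed.

Let DB v w x : U x -> 'D_w (B v) x = block_mx 0 0 0 ('D_w (Gam v) x).
Proof.
move=> Ux; rewrite -LlinE.
have dG : differentiable (Gam v) x by exact: smooth_on_diff (GamS v) Ux.
have -> : B v = (fun y => Llin (Gam v y) + block_mx 0 v 0 0) by apply/funext => y; exact: BE.
have S1 : smooth_on U (fun y => col_mx 0 1%:M *m Gam v y : 'M[R]_(1 + n, n)).
  by move=> k; apply: Ck_mulmx => //; [exact: Ck_cst|exact: GamS].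
have S2 : smooth_on U (fun y => Llin (Gam v y)).
  by move=> k; apply: Ck_mulmx => //; exact: Ck_cst.
have d1 := smooth_on_diff S1 Ux; have d2 := smooth_on_diff S2 Ux.
have e1 : 'D_w (fun y => col_mx 0 1%:M *m Gam v y : 'M[R]_(1 + n, n)) x = col_mx 0 1%:M *m 'D_w (Gam v) x.
  exact: derive_mulmxl.
have e2 : 'D_w (fun y => Llin (Gam v y)) x = Llin ('D_w (Gam v) x).
  by apply: etrans (derive_mulmxr _ w d1) _; rewrite e1.
have := @deriveD R 'rV[R]_n 'M[R]_(1 + n) (fun y => Llin (Gam v y)) (fun=> block_mx 0 v 0 0) x w.
rewrite derive_cst addr0 e2; apply; apply: diff_derivable => //; exact: differentiable_cst.
Qed.

(** Of the products only the two right-hand blocks survive: the upper one is the torsion identity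
    [Gtor], the lower one is [Gflat]. *)
Let Bflat x v w : U x -> 'D_w (B v) x + B v x *m B w x = 'D_v (B w) x + B w x *m B v x.
Proof.
have K (D1 D2 G1 G2 : 'M[R]_n) : v *m G2 = w *m G1 -> D1 + G1 *m G2 = D2 + G2 *m G1 ->
    block_mx 0 0 0 D1 + block_mx 0 v 0 G1 *m block_mx 0 w 0 G2 =
    block_mx 0 0 0 D2 + block_mx 0 w 0 G2 *m block_mx 0 v 0 G1 :> 'M[R]_(1 + n).
  by move=> e1 e2; rewrite !mulmx_block !mul0mx !mulmx0 !add0r !add_block_mx !add0r e1 e2.
move=> Ux; rewrite (DB v w Ux) (DB w v Ux); apply: K; first exact: Gtor.
by apply/eqP; rewrite -subr_eq0; apply/eqP; exact: Gflat.
Qed.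

Let Blin x : linear (B^~ x).
Proof.
by move=> a v w; rewrite /B Glin scale_block_mx add_block_mx !scaler0 !addr0.
Qed.

Lemma affine_development : exists d y theta, [/\ 0 < d, ball x0 d `<=` U, theta x0 = theta0,
  smooth_on (ball x0 d) theta &
  forall x, ball x0 d x -> [/\ differentiable y x, forall v, 'D_v y x = v *m theta x &
    forall v, 'D_v theta x = Gam v x *m theta x]].
Proof.
(* The zero row in the initial value places the origin of the coordinates [y] at [x0]. *)
have [d [u [d0 dU ux0 Hu]]] := flat_system (col_mx 0 theta0) oU Ux0 (fun v => BS v 2%N) Blin Bflat.
pose y x : 'rV[R]_n := row_mx 1%:M 0 *m u x.
pose theta x : 'M[R]_n := row_mx 0 1%:M *m u x.
have ob : open (ball x0 d) by exact: ball_open.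
have H x : ball x0 d x -> [/\ differentiable y x, differentiable theta x, forall v, 'D_v y x = v *m theta x &
    forall v, 'D_v theta x = Gam v x *m theta x].
  move=> /Hu[du Du].
  have dm (p : nat) (A : 'M[R]_(p, 1 + n)) : differentiable (fun z => A *m u z) x /\
     forall v, 'D_v (fun z => A *m u z) x = A *m 'D_v u x.
    split.
      apply/diff_mxP => i j; have -> : (fun z => (A *m u z) i j) = \sum_k (fun z => A i k *: (u z k j : R)).
        by apply/funext => z; rewrite mxE fct_sumE.
      by apply: differentiable_sum => k; apply: differentiableZ; exact: (diff_mxP u x).1.
    by move=> v; exact: derive_mulmxl.
  have uE : u x = col_mx (y x) (theta x).
    by rewrite -mul_col_mx -[col_mx _ _]/(block_mx _ _ _ _) -scalar_mx_block mul1mx.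
  split; [exact: (dm _ _).1|exact: (dm _ _).1|move=> v|move=> v].
    rewrite (dm _ _).2 Du uE /B mul_block_col mul0mx add0r mul0mx add0r mul_row_col mul1mx mul0mx addr0.
    by [].
  rewrite (dm _ _).2 Du uE /B mul_block_col mul0mx add0r mul0mx add0r mul_row_col mul1mx mul0mx add0r.
  by [].
exists d, y, theta; split=> //.
- by rewrite /theta ux0 mul_row_col mul0mx mul1mx add0r.
- elim=> [|k IH]; first by move=> x /H[_ /differentiable_continuous].
  split=> [x /H[]//|v]; apply: (Ck_ext ob (f := fun x => Gam v x *m theta x)).
    by move=> x; rewrite inE => /H[_ _ _ ->].
  by apply: Ck_mulmx => //; apply: Ck_sub dU _; exact: GamS.
- by move=> x /H[].
Qed.

Lemma flat_chart (G P : 'rV[R]_n -> 'M[R]_n) (D : 'M[R]_n) :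
  smooth_on U G -> smooth_on U P ->
  (forall x v, U x -> 'D_v G x = Gam v x *m G x + G x *m (Gam v x)^T) ->
  (forall x v, U x -> 'D_v P x + P x *m Gam v x = Gam v x *m P x) ->
  theta0 \in unitmx -> G x0 = theta0 *m theta0^T -> P x0 *m theta0 = theta0 *m D ->
  exists W y psi, [/\ [/\ open W, W `<=` U, W x0 & open (y @` W)],
    smooth_on W y, smooth_on (y @` W) psi, forall x, W x -> psi (y x) = x &
    forall x, W x -> [/\ 'J y x \in unitmx, G x = 'J y x *m ('J y x)^T & P x *m 'J y x = 'J y x *m D]].
Proof.
move=> GS PS DG DP uth G0 P0.
have [d [y [theta [d0 dU th0 thS Hy]]]] := affine_development.
have ob : open (ball x0 d) by exact: ball_open.
have bx0 : ball x0 d x0 by exact: ballxx.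
have GamT v : smooth_on (ball x0 d) (fun x => (Gam v x)^T).
  by move=> k; apply: Ck_trmx => //; apply: Ck_sub dU _; exact: GamS.
have GamSb v : smooth_on (ball x0 d) (Gam v) by move=> k; apply: Ck_sub dU _; exact: GamS.
have thT : smooth_on (ball x0 d) (fun x => (theta x)^T) by move=> k; apply: Ck_trmx.
have tt : smooth_on (ball x0 d) (fun x => theta x *m (theta x)^T) by move=> k; apply: Ck_mulmx.
have GSb : smooth_on (ball x0 d) G by move=> k; apply: Ck_sub dU _; exact: GS.
have PSb : smooth_on (ball x0 d) P by move=> k; apply: Ck_sub dU _; exact: PS.
(* [theta *m theta^T] satisfies the equation [DG] of the parallel metric, so the difference does
   too, and it vanishes at [x0]. *)
pose E1 x := G x - theta x *m (theta x)^T.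
have E1S : smooth_on (ball x0 d) E1.
  by move=> k; apply: Ck_add => //; apply: Ck_opp.
have DE1 x v : ball x0 d x -> 'D_v E1 x = Gam v x *m E1 x + E1 x *m (Gam v x)^T.
  move=> xd; have [_ _ Dth] := Hy x xd.
  have : 'D_v E1 x = 'D_v G x - 'D_v (fun x => theta x *m (theta x)^T) x.
    by apply: deriveB; apply: diff_derivable; [exact: smooth_on_diff GSb xd|exact: smooth_on_diff tt xd].
  rewrite (DG _ _ (dU _ xd)) (derive_mulmx v (smooth_on_diff thS xd) (smooth_on_diff thT xd)).
  rewrite (derive_trmx v (smooth_on_diff thS xd)) Dth => ->; rewrite /E1 mulmxBr mulmxBl trmx_mul !mulmxA.
  by rewrite opprD addrACA.
(* [theta *m D] satisfies the equation of [theta] because [D] is constant, and [P *m theta]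
   satisfies it because [P] is parallel. *)
pose E2 x := P x *m theta x - theta x *m D.
have S1 : smooth_on (ball x0 d) (fun x => P x *m theta x) by move=> k; apply: Ck_mulmx.
have S2 : smooth_on (ball x0 d) (fun x => theta x *m D) by move=> k; apply: Ck_mulmx => //; exact: Ck_cst.
have E2S : smooth_on (ball x0 d) E2.
  by move=> k; apply: Ck_add => //; apply: Ck_opp.
have DE2 x v : ball x0 d x -> 'D_v E2 x = Gam v x *m E2 x + E2 x *m (0 : 'M[R]_n).
  move=> xd; have [_ _ Dth] := Hy x xd.
  have : 'D_v E2 x = 'D_v (fun x => P x *m theta x) x - 'D_v (fun x => theta x *m D) x.
    by apply: deriveB; apply: diff_derivable; [exact: smooth_on_diff S1 xd|exact: smooth_on_diff S2 xd].
  have -> : 'D_v (fun x => theta x *m D) x = 'D_v theta x *m D.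
    exact: derive_mulmxr (smooth_on_diff thS xd).
  rewrite (derive_mulmx v (smooth_on_diff PSb xd) (smooth_on_diff thS xd)) Dth => ->.
  by rewrite mulmxA -mulmxDl (DP x v (dU _ xd)) mulmx0 addr0 /E2 mulmxBr !mulmxA.
have E1x0 : E1 x0 = 0 by rewrite /E1 th0 G0 subrr.
have E2x0 : E2 x0 = 0 by rewrite /E2 th0 P0 subrr.
have [d1 [d10 d1d H1]] := linear_equation_unique ob bx0 GamSb GamT Glin (fun x => trmx_linear (Glin x))
   (fun x xd => smooth_on_diff E1S xd) DE1 E1x0.
have Z0S (v : 'rV[R]_n) : smooth_on (ball x0 d) (fun=> 0 : 'M[R]_n) by move=> k; exact: Ck_cst.
have Z0l (x : 'rV[R]_n) : linear (fun _ : 'rV[R]_n => 0 : 'M[R]_n) by move=> a v w; rewrite scaler0 addr0.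
have [d2 [d20 d2d H2]] := linear_equation_unique ob bx0 GamSb Z0S Glin Z0l
   (fun x xd => smooth_on_diff E2S xd) DE2 E2x0.
pose d3 := Num.min d1 d2.
have d3d x : ball x0 d3 x -> [/\ ball x0 d x, E1 x = 0 & E2 x = 0].
  move=> xd3; have x1 : ball x0 d1 x by apply: le_ball xd3; rewrite ge_min lexx.
  have x2 : ball x0 d2 x by apply: le_ball xd3; rewrite ge_min lexx orbT.
  by split; [exact: d1d|exact: H1|exact: H2].
have ob3 : open (ball x0 d3) by exact: ball_open.
have b3x0 : ball x0 d3 x0 by apply: ballxx; rewrite lt_min d10.
have thS3 : smooth_on (ball x0 d3) theta by move=> k; apply: Ck_sub (thS k) => x /d3d[].
have uth3 : theta x0 \in unitmx by rewrite th0.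
have Hy3 x : ball x0 d3 x -> differentiable y x /\ forall v, 'D_v y x = v *m theta x.
  by move=> /d3d[/Hy[]].
have [W [psi [oW WU Wx0 oyW [psiK Wu psiS]]]] := inverse_function ob3 b3x0 thS3 uth3 Hy3.
have Jy x : W x -> 'J y x = theta x.
  by move=> /WU/Hy3[dy Dy]; apply: linear_eq => v; rewrite -deriveEjacobian.
exists W, y, psi; split=> //.
- by split=> // x /WU/d3d[/dU].
- elim=> [|k IH]; first by move=> x /WU/Hy3[/differentiable_continuous].
  split=> [x /WU/Hy3[]//|v]; apply: (Ck_ext oW (f := fun x => v *m theta x)).
    by move=> x; rewrite inE => /WU/Hy3[_ ->].
  by apply: Ck_mulmx => //; [exact: Ck_cst|apply: Ck_sub WU _].
- move=> x Wx; rewrite (Jy _ Wx); have [_ e1 e2] := d3d _ (WU _ Wx); split; first exact: Wu.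
    by apply/eqP; rewrite -subr_eq0; apply/eqP.
  by apply/eqP; rewrite -subr_eq0; apply/eqP.
Qed.
End Development.
End FlatChart.

Section Recoordinatization.
Context {R : realType} {n : nat} (M : manifold R n).
Implicit Types (c d : chart R n M) (p q : M).

Lemma ex_chart_bump c (x0 : 'rV[R]_n) : chart_img c x0 -> exists (r : R) (chi : 'rV[R]_n -> R),
  [/\ 0 < r, [set x | `|x - x0| <= r] `<=` chart_img c, smooth_on setT chi,
      forall x, r <= `|x - x0| -> chi x = 0 & forall x, `|x - x0| < r / 2 -> chi x = 1].
Proof.
move=> xi; have oi : open (chart_img c) by exact: chart_img_open.
have /nbhs_ballP[e /= e0 He] : nbhs x0 (chart_img c) by apply: open_nbhs_nbhs.
have r0 : 0 < e / 2 by rewrite divr_gt0.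
have [chi [chiS chi1 chi0]] := ex_bump x0 r0.
exists (e / 2), chi; split=> // x /= xr; apply: He; rewrite -ball_normE /ball_ /= distrC.
by rewrite (le_lt_trans xr)// ltr_pdivrMr// ltr_pMr// ltr1n.
Qed.

(** The new chart is [c] followed by [y]. It need not belong to the atlas: [integrable_frames] asks
    for compatibility with the atlas, which follows from smoothness of [y] and [psi]. *)
Lemma recoordinatize c (W : set 'rV[R]_n) (y psi : 'rV[R]_n -> 'rV[R]_n) : atlas c ->
  open W -> W `<=` chart_img c -> open (y @` W) -> smooth_on W y -> smooth_on (y @` W) psi ->
  (forall x, W x -> psi (y x) = x) ->
  exists c', [/\ smooth_chart c', chart_dom c' = [set p | chart_dom c p /\ W (c p)] &
    forall p, chart_dom c' p -> transition_jacobian c c' p = 'J y (c p)].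
Proof.
move=> ac oW Wi oyW yS psiS psiK.
pose dom := [set p | chart_dom c p /\ W (c p)].
have odom : open dom.
  rewrite openE => p [pc Wp].
  have n1 : nbhs p (chart_dom c) by apply: open_nbhs_nbhs; split=> //; exact: chart_dom_open.
  have n2 : nbhs p (c @^-1` W) by apply: (chart_continuous pc); exact: open_nbhs_nbhs.
  by apply: filterS2 n1 n2 => q qc Wq.
have imgE : (y \o c) @` dom = y @` W.
  apply/seteqP; split=> [_ [p [pc Wp] <-]|_ [x Wx <-]]; first by exists (c p).
  have xi := Wi _ Wx; exists (chart_inv c x); last by rewrite /= chart_funV.
  by split; [exact: chart_inv_dom|rewrite chart_funV].
have oimg : open ((y \o c) @` dom) by rewrite imgE.
have fK : {in dom, cancel (y \o c) (chart_inv c \o psi)}.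
  by move=> p; rewrite inE => -[pc Wp] /=; rewrite psiK// chart_invK.
have fC : {within dom, continuous (y \o c)}.
  rewrite continuous_open_subspace// => p; rewrite inE => -[pc Wp].
  apply: continuous_comp; first exact: chart_continuous.
  exact: smooth_on_cont yS Wp.
have iC : {within (y \o c) @` dom, continuous (chart_inv c \o psi)}.
  rewrite imgE continuous_open_subspace// => z; rewrite inE => -[x Wx <-].
  apply: continuous_comp; first by apply: smooth_on_cont psiS _; exists x.
  by rewrite psiK//; apply: chart_inv_continuous_at; exact: Wi.
pose c' := @Chart R n M (y \o c) (chart_inv c \o psi) dom odom oimg fK fC iC.
have c'S : smooth_chart c'.
  move=> d ad; have [cd dc] := atlas_compatible ac ad.
  have o1 : open (c' @` (chart_dom c' `&` chart_dom d)) by apply: chart_image_open; exact: chart_dom_open.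
  have o2 : open (c @` (chart_dom c `&` chart_dom d)) by apply: chart_image_open; exact: chart_dom_open.
  have o3 : open (d @` (chart_dom d `&` chart_dom c')) by apply: chart_image_open; exact: chart_dom_open.
  split=> k.
    have mapO z : (c' @` (chart_dom c' `&` chart_dom d)) z -> (c @` (chart_dom c `&` chart_dom d)) (psi z).
      by move=> [q [[qc Wq] qd] <-]; rewrite /= psiK//; exists q.
    have pS : Ck k (c' @` (chart_dom c' `&` chart_dom d)) psi.
      by apply: Ck_sub (psiS k) => _ [q [[qc Wq] qd] <-]; exists (c q).
    exact: (Ck_comp o1 o2 mapO pS (cd k)).
  rewrite setIC.
  have mapO z : (d @` (chart_dom d `&` chart_dom c')) z -> W ((c \o chart_inv d) z).
    by move=> [q [qd [qc Wq]] <-]; rewrite /= chart_invK.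
  have pS : Ck k (d @` (chart_dom d `&` chart_dom c')) (c \o chart_inv d).
    apply: Ck_sub (dc k) => _ [q [qd [qc Wq]] <-]; by exists q.
  exact: (Ck_comp o3 oW mapO pS (yS k)).
exists c'; split; [exact: c'S|reflexivity|move=> p [pc Wp]].
apply: esym; apply: near_eq_jacobian; last exact: smooth_on_diff yS Wp.
apply: (open_in_nearW oW); last by rewrite inE.
by move=> x; rewrite inE => /Wi xi; rewrite /= chart_funV.
Qed.

End Recoordinatization.

Section FrameChange.
Context {R : realType} {n : nat} (A B J F : 'M[R]_n).
Hypotheses (AE : A = J *m F) (AB : A *m B = 1%:M) (BA : B *m A = 1%:M) (Ju : J \in unitmx).

Lemma frame_change_metric m : A *m m *m A^T = J *m J^T <-> F *m m *m F^T = 1%:M.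
Proof.
have JI := mulVmx Ju; have JT : J^T *m (invmx J)^T = 1%:M by rewrite -trmx_mul JI trmx1.
have E : A *m m *m A^T = J *m (F *m m *m F^T) *m J^T by rewrite AE trmx_mul !mulmxA.
rewrite E; split=> [H|->]; last by rewrite mulmx1.
have -> : F *m m *m F^T = invmx J *m (J *m (F *m m *m F^T) *m J^T) *m (invmx J)^T.
  by move: (F *m m *m F^T) => K; rewrite !mulmxA JI mul1mx -mulmxA JT mulmx1.
by rewrite H mulmxA JI mul1mx JT.
Qed.

Lemma frame_change_endo e D : A *m e *m B *m J = J *m D <-> F *m e = D *m F.
Proof.
have JI := mulVmx Ju.
have BJ : B *m J *m F = 1%:M by rewrite -mulmxA -AE.
have FBJ : F *m (B *m J) = 1%:M by exact: mulmx1C.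
split=> H.
  have -> : F *m e = invmx J *m (A *m e) by rewrite AE !mulmxA JI mul1mx.
  have -> : A *m e = A *m e *m B *m J *m F by rewrite -!(mulmxA (A *m e)) BJ mulmx1.
  by rewrite H !mulmxA JI mul1mx.
by rewrite AE -(mulmxA J F e) H -!mulmxA FBJ mulmx1.
Qed.

End FrameChange.

Section FrameTransport.
Context {R : realType} {n : nat} (M : manifold R n).
Implicit Types (c d : chart R n M) (p q : M).

Lemma coord_frame_factor c c' q : atlas c -> smooth_chart c' -> chart_dom c q -> chart_dom c' q ->
  coord_frame c q = transition_jacobian c c' q *m coord_frame c' q /\
  transition_jacobian c c' q \in unitmx.
Proof.
move=> ac c'S qc qc'; have cc' : compatible c c' by exact/compatible_sym/c'S.
have c'q : compatible c' (chart_at q) by exact: smooth_chart_at.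
split; first exact: esym (transition_jacobian_comp cc' c'q qc qc' (chart_at_dom q)).
by have [Ju _] := mulmx1_unit (transition_jacobianV cc' qc qc'); exact: Ju.
Qed.

(** Translates between adaptedness of the frame of [c'] and the equations for the Jacobian in [c].
    Being an equivalence, it serves both directions of the theorem. *)
Lemma adapted_frame_local c c' (phi g : M -> 'M[R]_n) (D : 'M[R]_n) q : atlas c -> smooth_chart c' ->
  chart_dom c q -> chart_dom c' q -> let J := transition_jacobian c c' q in let F := coord_frame c' q in
  (metric_local c g (c q) = J *m J^T <-> F *m g q *m F^T = 1%:M) /\
  (endo_local c phi (c q) *m J = J *m D <-> F *m phi q = D *m F).
Proof.
move=> ac c'S qc qc' J F; have [AE Ju] := coord_frame_factor ac c'S qc qc'.
have cS := atlas_smooth_chart ac.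
have AB := coord_frameK cS qc; have BA := coordsK cS qc.
have Kq := chart_invK qc; rewrite /metric_local /endo_local Kq.
rewrite -/J -/F in AE Ju; move: (coord_frame c q) (coords c q) (g q) (phi q) AE AB BA => A B m e AE AB BA.
split; [exact: (frame_change_metric AE Ju)|exact: (frame_change_endo AE BA Ju)].
Qed.

End FrameTransport.

Section Differences.
Context {R : realType} {n : nat}.

Lemma linear_sub (V W : lmodType R) (f g : V -> W) : linear f -> linear g -> linear (fun v => f v - g v).
Proof. by move=> fl gl k u w; rewrite fl gl scalerBr opprD addrACA. Qed.

Lemma skew_sub (A B G D : 'M[R]_n) : A *m G + G *m A^T = D -> B *m G + G *m B^T = D ->
  (A - B) *m G + G *m (A - B)^T = 0.
Proof. by move=> e1 e2; rewrite linearB /= mulmxBl mulmxBr addrACA -opprD e1 e2 subrr. Qed.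

Lemma comm_sub (A B P D : 'M[R]_n) : D + P *m A = A *m P -> D + P *m B = B *m P ->
  P *m (A - B) = (A - B) *m P.
Proof. by move=> e1 e2; rewrite mulmxBr mulmxBl -e1 -e2 opprD addrACA subrr add0r. Qed.

Lemma torsion_sub (v w : 'rV[R]_n) (A A' B B' : 'M[R]_n) : w *m A' = v *m B' ->
  w *m (A - A') - v *m (B - B') = w *m A - v *m B.
Proof. by move=> e; rewrite !mulmxBr e opprB addrA subrK. Qed.

Lemma cancel_unit_r (A B C : 'M[R]_n) : C \in unitmx -> A *m C = B *m C -> A = B.
Proof. by move=> uC /(congr1 (mulmx^~ (invmx C))); rewrite !mulmxK. Qed.

End Differences.

(** * The connection in the presence of an adapted chart *)

Section ParallelFrame.
Context {R : realType} {n : nat}.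
Context (V : set 'rV[R]_n) (f : 'rV[R]_n -> 'rV[R]_n) (Gam : 'rV[R]_n -> 'rV[R]_n -> 'M[R]_n)
  (G P : 'rV[R]_n -> 'M[R]_n) (D : 'M[R]_n) (a b : R).
Hypotheses (oV : open V) (fS : smooth_on V f) (fu : forall x, V x -> 'J f x \in unitmx)
  (GamS : forall v, smooth_on V (Gam v)) (Glin : forall x, linear (Gam^~ x))
  (PS : smooth_on V P)
  (DG : forall x v, V x -> 'D_v G x = Gam v x *m G x + G x *m (Gam v x)^T)
  (DP : forall x v, V x -> 'D_v P x + P x *m Gam v x = Gam v x *m P x)
  (GJ : forall x, V x -> G x = 'J f x *m ('J f x)^T)
  (PJ : forall x, V x -> P x *m 'J f x = 'J f x *m D)
  (PG : forall x, V x -> P x *m G x = G x *m (P x)^T)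
  (ab : a != b)
  (Pba : forall x, V x -> (P x - b%:M) *m (P x - a%:M) = 0)
  (Pab : forall x, V x -> (P x - a%:M) *m (P x - b%:M) = 0)
  (tor : forall x l v w z, V x -> l = a \/ l = b -> v *m P x = l *: v -> z *m P x = l *: z ->
    ((w *m Gam v x - v *m Gam w x) *m G x *m z^T) 0 0 =
    ((w *m Gam z x - z *m Gam w x) *m G x *m v^T) 0 0).

Let th x := 'J f x.

Let thS : smooth_on V th. Proof. by move=> k; apply: Ck_jacobian. Qed.

Let Df x v : V x -> 'D_v f x = v *m th x.
Proof. by move=> Vx; rewrite deriveEjacobian//; exact: smooth_on_diff fS Vx. Qed.

(** Symmetry of the second derivatives of [f]; it says that the flat connection [('D_v th) *m th^-1]
    has no torsion. *)
Let thsym x v w : V x -> w *m 'D_v th x = v *m 'D_w th x.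
Proof.
move=> Vx; have K u u' : 'D_u' (fun y => 'D_u f y) x = u *m 'D_u' th x.
  have -> : 'D_u' (fun y => 'D_u f y) x = 'D_u' (fun y => u *m th y) x.
    apply: near_eq_derive; apply: (open_in_nearW oV); last by rewrite inE.
    by move=> y; rewrite inE => Vy; exact: Df.
  exact: derive_mulmxl (smooth_on_diff thS Vx).
by rewrite -!K; exact: (derive_swap_mx _ _ oV (fS 2%N) Vx).
Qed.

(** Uniqueness is applied at the single point [x] to the difference [S] of [Gam] and the flat
    connection. As the latter has no torsion, the torsion condition on [Gam] passes to [S]
    unchanged. *)
Lemma parallel_frame x v : V x -> 'D_v th x = Gam v x *m th x.
Proof.
move=> Vx; pose Gam' u := 'D_u th x *m invmx (th x).
have dth : differentiable th x by exact: smooth_on_diff thS Vx.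
have thT : smooth_on V (fun x => (th x)^T) by move=> k; apply: Ck_trmx.
have tu : th x \in unitmx by exact: fu.
have Gth u : Gam' u *m th x = 'D_u th x by rewrite mulmxKV.
have Gx : G x = th x *m (th x)^T by exact: GJ.
have DG' u : 'D_u G x = Gam' u *m G x + G x *m (Gam' u)^T.
  have -> : 'D_u G x = 'D_u (fun y => th y *m (th y)^T) x.
    apply: near_eq_derive; apply: (open_in_nearW oV); last by rewrite inE.
    by move=> y; rewrite inE => Vy; exact: GJ.
  apply: etrans (derive_mulmx u dth (smooth_on_diff thT Vx)) _.
  by rewrite (derive_trmx u dth) Gx mulmxA Gth -(mulmxA (th x)) -trmx_mul Gth.
have DP' u : 'D_u P x + P x *m Gam' u = Gam' u *m P x.
  have E : 'D_u (fun y => P y *m th y) x = 'D_u (fun y => th y *m D) x.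
    apply: near_eq_derive; apply: (open_in_nearW oV); last by rewrite inE.
    by move=> y; rewrite inE => Vy; exact: PJ.
  have E1 : 'D_u (fun y => P y *m th y) x = 'D_u P x *m th x + P x *m 'D_u th x.
    exact: (derive_mulmx u (smooth_on_diff PS Vx) dth).
  have E2 : 'D_u (fun y => th y *m D) x = 'D_u th x *m D.
    exact: derive_mulmxr.
  rewrite E1 E2 in E.
  have E3 : ('D_u P x + P x *m Gam' u) *m th x = Gam' u *m P x *m th x.
    have PJth : P x *m th x = th x *m D := PJ Vx.
    rewrite mulmxDl -(mulmxA (P x) (Gam' u)) (Gth u) E.
    by rewrite -(mulmxA (Gam' u)) PJth (mulmxA (Gam' u)) (Gth u).
  by move/(congr1 (mulmx^~ (invmx (th x)))): E3; rewrite !mulmxK.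
have G'l : linear Gam'.
  by move=> k u w; rewrite /Gam' (derive_linear dth) mulmxDl -scalemxAl.
have tf u w : w *m Gam' u = u *m Gam' w by rewrite /Gam' !mulmxA thsym.
clearbody Gam'; suff -> : Gam v x = Gam' v by rewrite Gth.
have Gl : linear (Gam^~ x) by exact: Glin.
have DGx := fun u => esym (DG u Vx); have DPx := fun u => DP u Vx.
have torx := fun l u w z => tor (l := l) (v := u) w (z := z) Vx.
pose S u := Gam u x - Gam' u.
have S0 : forall u, S u = 0.
  apply: (@adapted_connection_unique R n (P x) (G x) a b S) => //.
  - exact: Pba.
  - exact: Pab.
  - by rewrite Gx trmx_mul trmxK.
  - by rewrite Gx unitmx_mul unitmx_tr tu.
  - exact: PG.
  - by move=> k u w; exact: (linear_sub Gl G'l).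
  - move=> u; rewrite /S; exact: (skew_sub (DGx u) (esym (DG' u))).
  - move=> u; rewrite /S; exact: (comm_sub (DPx u) (DP' u)).
  move=> l u w z ll ul zl.
  have K (u' : 'rV[R]_n) : w *m S u' - u' *m S w = w *m Gam u' x - u' *m Gam w x.
    exact: (torsion_sub (Gam u' x) (Gam w x) (tf u' w)).
  by rewrite (K u) (K z); exact: (torx l u w z ll ul zl).
by apply/eqP; rewrite -subr_eq0; apply/eqP; exact: S0.
Qed.

Lemma parallel_frame_torsion x v w : V x -> w *m Gam v x = v *m Gam w x.
Proof.
move=> Vx; have := thsym v w Vx; rewrite !(parallel_frame _ Vx) !mulmxA.
by move/(congr1 (mulmx^~ (invmx (th x)))); rewrite !mulmxK//; exact: fu.
Qed.

(** Differentiating ['D_v th = Gam v *m th] once more and exchanging the derivatives gives the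
    curvature matrix times the invertible [th]. *)
Lemma parallel_frame_curvature x v w : V x -> curvature_matrix Gam v w x = 0.
Proof.
move=> Vx; have dth : differentiable th x by exact: smooth_on_diff thS Vx.
have K u u' : 'D_u' (fun y => 'D_u th y) x = ('D_u' (Gam u) x + Gam u x *m Gam u' x) *m th x.
  have -> : 'D_u' (fun y => 'D_u th y) x = 'D_u' (fun y => Gam u y *m th y) x.
    apply: near_eq_derive; apply: (open_in_nearW oV); last by rewrite inE.
    by move=> y; rewrite inE => Vy; exact: parallel_frame.
  apply: etrans (derive_mulmx u' (smooth_on_diff (GamS u) Vx) dth) _.
  by rewrite (parallel_frame _ Vx) mulmxDl mulmxA.
have E := etrans (esym (K w v)) (etrans (derive_swap_mx w v oV (thS 2%N) Vx) (K v w)).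
by apply/eqP; rewrite /curvature_matrix subr_eq0; apply/eqP; exact: cancel_unit_r (fu Vx) E.
Qed.

End ParallelFrame.

(** * Both implications at a point *)

Section Adapted.
Context {R : realType} {n r s : nat} (M : manifold R n) (phi g : M -> 'M[R]_n).
Hypotheses (h_golden : almost_golden_riemannian phi g) (h_dim : golden_dimensions phi r s).
Context (nabla : (M -> 'rV[R]_n) -> (M -> 'rV[R]_n) -> M -> 'rV[R]_n)
  (h_adapted : well_adapted phi g nabla).

Let phiS : smooth_endomorphism phi. Proof. by case: h_golden => -[]. Qed.
Let phi2 p : phi p *m phi p = phi p + 1%:M. Proof. by case: h_golden => -[]. Qed.
Let gS : smooth_form g. Proof. by case: h_golden => _ []. Qed.
Let gT p : (g p)^T = g p. Proof. by case: h_golden => _ []. Qed.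
Let gpos p : posdef (g p). Proof. by case: h_golden => _ [_ _ H] _; exact: H. Qed.
Let gphi X Y : smooth_vector_field X -> smooth_vector_field Y ->
  forall p, inner g (apply_endo phi X) Y p = inner g X (apply_endo phi Y) p.
Proof. by case: h_golden => _ _; apply. Qed.
Let nablaC : covariant_derivative nabla. Proof. by case: h_adapted. Qed.
Let nphi : parallel_endomorphism nabla phi. Proof. by case: h_adapted. Qed.
Let ng : parallel_metric nabla g. Proof. by case: h_adapted. Qed.

Let D : 'M[R]_n := diag_mx (\row_i (if (i < r)%N then golden else golden_conj)).

Let golden_framesE p F : golden_frames phi g r p F <-> F *m g p *m F^T = 1%:M /\ F *m phi p = D *m F.
Proof.
rewrite /golden_frames /=; split=> -[H1 H2]; split=> //.
  by apply/eigen_rows => i; rewrite mxE.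
by move=> i; have := (eigen_rows _ _ _).1 H2 i; rewrite mxE.
Qed.

Section AtPoint.
Context (p0 : M).

Let c := chart_at p0.
Let ac : atlas c. Proof. exact: chart_at_atlas. Qed.
Let pc : chart_dom c p0. Proof. exact: chart_at_dom. Qed.
Let x0 := c p0.

Context (e : R) (chi : 'rV[R]_n -> R).
Hypotheses (e0 : 0 < e) (ec : [set x | `|x - x0| <= e] `<=` chart_img c)
  (chiS : smooth_on setT chi) (chi0 : forall x, e <= `|x - x0| -> chi x = 0)
  (chi1 : forall x, `|x - x0| < e / 2 -> chi x = 1).

Local Notation W := (ball x0 (e / 2)).
Local Notation Gam := (christoffel nabla c chi).
Let G := metric_local c g.
Let P := endo_local c phi.

Let oW : open W. Proof. exact: ball_open. Qed.
Let Wx0 : W x0. Proof. by apply: ballxx; rewrite divr_gt0. Qed.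
Let Wi x : W x -> chart_img c x. Proof. exact: (bump_ball_img e0 ec). Qed.
Let GamS v : smooth_on W (Gam v).
Proof. by move=> k; apply: Ck_sub (christoffel_smooth nablaC ac ec chiS chi0 v k) => x; exact: Wi. Qed.
Let Glin x : linear (Gam^~ x). Proof. exact: christoffel_linear. Qed.
Let PS : smooth_on W P. Proof. exact: (endo_local_smooth ac e0 ec phiS). Qed.
Let GS : smooth_on W G. Proof. exact: (metric_local_smooth ac e0 ec gS). Qed.
Let DG x v : W x -> 'D_v G x = Gam v x *m G x + G x *m (Gam v x)^T.
Proof. exact: (parallel_metric_local nablaC ac e0 ec chiS chi0 chi1 gS ng). Qed.
Let DP x v : W x -> 'D_v P x + P x *m Gam v x = Gam v x *m P x.
Proof. exact: (parallel_endo_local nablaC ac e0 ec chiS chi0 chi1 phiS nphi). Qed.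
Let PG x : W x -> P x *m G x = G x *m (P x)^T.
Proof. exact: (symmetric_endo_local ac e0 ec chiS chi0 chi1 phiS gphi). Qed.

Let Pfactor x : W x -> (P x - golden_conj%:M) *m (P x - golden%:M) = 0 /\
  (P x - golden%:M) *m (P x - golden_conj%:M) = 0.
Proof. by move=> Wx; apply: golden_factor; exact: (endo_local_square ac phi2 (Wi Wx)). Qed.

Let tor x (l : R) v w z : W x -> l = golden \/ l = golden_conj -> v *m P x = l *: v -> z *m P x = l *: z ->
  ((w *m Gam v x - v *m Gam w x) *m G x *m z^T) 0 0 =
  ((w *m Gam z x - z *m Gam w x) *m G x *m v^T) 0 0.
Proof.
have [_ _ _ H] := h_adapted.
move=> Wx [->|->] vl zl.
  apply: (adapted_torsion_local nablaC ac e0 ec chiS chi0 chi1 phiS (b := golden_conj) _ golden_neq _ w Wx vl zl).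
    by move=> p; exact: (golden_factor (phi2 p)).1.
  by move=> X Y Z XS YS ZS Xa Za; apply: H => //; left.
apply: (adapted_torsion_local nablaC ac e0 ec chiS chi0 chi1 phiS (b := golden) _ _ _ w Wx vl zl).
- by move=> p; exact: (golden_factor (phi2 p)).2.
- by rewrite eq_sym golden_neq.
by move=> X Y Z XS YS ZS Xa Za; apply: H => //; right.
Qed.

(** [c] is the preferred chart of [p0] itself, so tangent vectors at [p0] are already components in
    [c]. *)
Let coord_frame_id : coord_frame c p0 = 1%:M. Proof. exact: coords_chart_at. Qed.
Let coords_id : coords c p0 = 1%:M. Proof. exact: coords_chart_at. Qed.

Let G0 : G x0 = g p0.
Proof. by rewrite /G /metric_local (chart_invK pc) coord_frame_id mul1mx trmx1 mulmx1. Qed.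

Let P0 : P x0 = phi p0.
Proof. by rewrite /P /endo_local (chart_invK pc) coord_frame_id coords_id mul1mx mulmx1. Qed.

Lemma flat_adapted_chart : torsion_vanishes nabla -> curvature_vanishes nabla ->
  exists c' : chart R n M, [/\ smooth_chart c', chart_dom c' p0 &
    forall q, chart_dom c' q -> golden_frames phi g r q (coord_frame c' q)].
Proof.
move=> T C.
have Gtor x v w : W x -> w *m Gam v x = v *m Gam w x.
  exact: (torsion_free_local nablaC ac e0 ec chiS chi0 chi1 T).
have Gflat x v w : W x -> curvature_matrix Gam v w x = 0.
  exact: (curvature_free_local nablaC ac e0 ec chiS chi0 chi1 C).
have [pba pab] := golden_factor (phi2 p0); have [rr ss] := h_dim p0.
have pg : phi p0 *m g p0 = g p0 *m (phi p0)^T by rewrite -G0 -P0; exact: PG.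
have [F0 [F0g F0p]] := adapted_frame_exists golden_neq pba pab (gT p0) (@gpos p0) pg rr ss.
have F0u : F0 \in unitmx by move: F0g; rewrite -mulmxA => /mulmx1_unit[].
(* [theta] starts at the inverse of the adapted frame [F0], since a coordinate frame is the inverse
   of [theta]; the frame of the new chart at [p0] is then [F0]. *)
have uth : invmx F0 \in unitmx by rewrite unitmx_inv.
have Gx0 : G x0 = invmx F0 *m (invmx F0)^T.
  rewrite G0; have E : g p0 = invmx F0 *m (F0 *m g p0 *m F0^T) *m (invmx F0)^T.
    by rewrite -!mulmxA -trmx_mul mulVmx// trmx1 mulmx1 mulKmx.
  by rewrite {1}E F0g mulmx1.
have Px0 : P x0 *m invmx F0 = invmx F0 *m D.
  rewrite P0; have -> : phi p0 = invmx F0 *m (D *m F0) by rewrite -[X in _ *m X]F0p mulKmx.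
  by rewrite -!mulmxA mulmxV// mulmx1.
have [W' [y [psi [[oW' WW' W'x0 oyW'] yS psiS psiK H]]]] :=
  flat_chart oW Wx0 GamS Glin Gtor Gflat GS PS DG DP uth Gx0 Px0.
have W'i : W' `<=` chart_img c by move=> x /WW'/Wi.
have [c' [c'S c'dom c'J]] := recoordinatize ac oW' W'i oyW' yS psiS psiK.
exists c'; split; [exact: c'S|by rewrite c'dom|move=> q qc'].
have [qc W'q] : chart_dom c q /\ W' (c q) by move: qc'; rewrite c'dom.
apply/golden_framesE; have [_ GE PE] := H _ W'q; have Jq := c'J _ qc'.
have [H1 H2] := adapted_frame_local phi g D ac c'S qc qc'.
split; first by apply: H1.1; rewrite Jq.
by apply: H2.1; rewrite Jq.
Qed.

Context (c' : chart R n M).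
Hypotheses (c'S : smooth_chart c') (pc' : chart_dom c' p0)
  (c'F : forall q, chart_dom c' q -> golden_frames phi g r q (coord_frame c' q)).

Let V := (c @` (chart_dom c `&` chart_dom c')) `&` W.
Let f := c' \o chart_inv c.

Let oV : open V.
Proof. by apply: openI => //; apply: chart_image_open; exact: chart_dom_open. Qed.
Let Vx0 : V x0. Proof. by split=> //; exists p0. Qed.
Let VW x : V x -> W x. Proof. by case. Qed.
Let fS : smooth_on V f.
Proof.
have [_ H] := c'S ac; move=> k; apply: Ck_sub (H k) => x [+ _].
by rewrite setIC.
Qed.

Let frameV x : V x -> [/\ 'J f x \in unitmx, G x = 'J f x *m ('J f x)^T & P x *m 'J f x = 'J f x *m D].
Proof.
move=> [[q [qc qc'] <-] _]; have [_ Ju] := coord_frame_factor ac c'S qc qc'.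
have [H1 H2] := adapted_frame_local phi g D ac c'S qc qc'.
have /golden_framesE[E1 E2] := c'F qc'.
by split; [exact: Ju|exact: H1.2|exact: H2.2].
Qed.

(** The matrices [Gam] describe [nabla] only where the bump is 1, so the conclusion is drawn at the
    centre [p0]; every point then has a bump of its own. *)
Lemma integrable_flat_at :
  (forall X Y, smooth_vector_field X -> smooth_vector_field Y -> torsion nabla X Y p0 = 0) /\
  (forall X Y Z, smooth_vector_field X -> smooth_vector_field Y -> smooth_vector_field Z ->
     curvature nabla X Y Z p0 = 0).
Proof.
have fu x : V x -> 'J f x \in unitmx by case/frameV.
have GJ x : V x -> G x = 'J f x *m ('J f x)^T by case/frameV.
have PJ x : V x -> P x *m 'J f x = 'J f x *m D by case/frameV.
have GamSV v : smooth_on V (Gam v) by move=> k; apply: Ck_sub (GamS v k) => x; exact: VW.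
have PSV : smooth_on V P by move=> k; apply: Ck_sub (PS k) => x; exact: VW.
have DGV x v (Vx : V x) := DG v (VW Vx).
have DPV x v (Vx : V x) := DP v (VW Vx).
have PGV x (Vx : V x) := PG (VW Vx).
have Pba x (Vx : V x) := (Pfactor (VW Vx)).1.
have Pab x (Vx : V x) := (Pfactor (VW Vx)).2.
have torV x l v w z (Vx : V x) := @tor x l v w z (VW Vx).
have T v w := parallel_frame_torsion oV fS fu Glin PSV DGV DPV GJ PJ PGV golden_neq Pba Pab torV v w Vx0.
have C v w := parallel_frame_curvature oV fS fu GamSV Glin PSV DGV DPV GJ PJ PGV golden_neq Pba Pab torV v w Vx0.
split=> [X Y XS YS|X Y Z XS YS ZS].
  have := torsion_local nablaC ac e0 ec chiS chi0 chi1 XS YS Wx0.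
  by rewrite (chart_invK pc) coords_id mulmx1 T subrr.
have := curvature_local nablaC ac e0 ec chiS chi0 chi1 XS YS ZS Wx0.
by rewrite (chart_invK pc) coords_id mulmx1 C mulmx0.
Qed.

End AtPoint.
End Adapted.

Theorem proposition5p3 (R : realType) (n r s : nat) (M : manifold R n)
    (phi g : M -> 'M[R]_n)
    (h_golden : almost_golden_riemannian phi g)
    (h_dim : golden_dimensions phi r s)
    (nabla : (M -> 'rV[R]_n) -> (M -> 'rV[R]_n) -> M -> 'rV[R]_n)
    (h_adapted : well_adapted phi g nabla) :
  integrable_frames (golden_frames phi g r) <->
  torsion_vanishes nabla /\ curvature_vanishes nabla.
Proof.
have bump (p : M) := ex_chart_bump (chart_imgP (chart_at_dom p)).
split=> [H|[T C] p]; last first.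
  have [e [chi [e0 ec chiS chi0 chi1]]] := bump p.
  exact: (flat_adapted_chart h_golden h_dim h_adapted e0 ec chiS chi0 chi1 T C).
have K (p : M) : (forall X Y, smooth_vector_field X -> smooth_vector_field Y -> torsion nabla X Y p = 0) /\
  (forall X Y Z, smooth_vector_field X -> smooth_vector_field Y -> smooth_vector_field Z ->
     curvature nabla X Y Z p = 0).
  have [e [chi [e0 ec chiS chi0 chi1]]] := bump p; have [c' [c'S pc' c'F]] := H p.
  exact: (integrable_flat_at h_golden h_adapted e0 ec chiS chi0 chi1 c'S pc' c'F).
split=> [X Y XS YS p|X Y Z XS YS ZS p]; first exact: (K p).1.
exact: (K p).2.
Qed.
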